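(* Let $L_{W,V}$ be the self-adjoint operator on $L^2_{dV}(\mathbb{T}^d)$ associated with the bilinear form $B_{L_{W,V}}$, and let $\dot B_V$ be the $V$-Gaussian white noise on $L^2_{dV}(\mathbb{T}^d)$. If $\beta>d/4$, then the solution of $L_{W,V}^\beta u=\dot B_V$ given by $$u=L_{W,V}^{-\beta}\dot B_V$$ is a well-defined centered Gaussian $L^2(\Omega,\mathcal{F},P)$-random variable taking values (a.s.) in $\dot H^{2\beta-\frac d2-\epsilon}_{L,W,V}(\mathbb{T}^d)$ for all $\epsilon>0$, with covariance operator $L_{W,V}^{-2\beta}$.
   Context: One-dimensional data. $\mathbb{T}=\mathbb{R}/\mathbb{Z}$. For $k=1,\ldots,d$, $W_k,V_k:\mathbb{R}\to\mathbb{R}$ are strictly increasing, $W_k$ càdlàg (right-continuous with left limits), $V_k$ càglàd (left-continuous with right limits), with $W_k(x+1)-W_k(x)=W_k(1)-W_k(0)$, $V_k(x+1)-V_k(x)=V_k(1)-V_k(0)$ for all $x$, both continuous at $0$ with value $0$ there. They induce finite Borel measures on $\mathbb{T}$ with $dW_k((a,b])=W_k(b)-W_k(a)$, $dV_k([a,b))=V_k(b)-V_k(a)$. One-sided derivatives on $\mathbb{T}$: $D_{W_k}^-f(x)=\lim_{h\to0^-}\frac{f(x+h)-f(x)}{W_k(x+h)-W_k(x)}$, $D_{V_k}^+g(x)=\lim_{h\to0^+}\frac{g(x+h)-g(x)}{V_k(x+h)-V_k(x)}$; $D^{(n)}_{W_k,V_k}$ is the alternating composition of $n$ factors with $D_{W_k}^-$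 applied first. Product structure. $dV=\bigotimes_i dV_i$ on $\mathbb{T}^d$; $dV^k\otimes dW_k$ is the product measure with $dW_k$ in coordinate $k$ and $dV_i$ in coordinates $i\ne k$. $L^2_{dV}(\mathbb{T}^d)=L^2(\mathbb{T}^d,dV)$ with inner product $\langle\cdot,\cdot\rangle_V$; subscript $0$ denotes mean zero. $\partial^{(n)}_{W_k,V_k}f$ is $D^{(n)}_{W_k,V_k}$ applied in the $k$-th variable. $C^\infty_{W,V,0}(\mathbb{T}^d)$ is the space of $f\in L^2_{dV,0}(\mathbb{T}^d)$, càdlàg in each variable separately, such that for all $k$ and $n\ge1$, $\partial^{(n)}_{W_k,V_k}f$ exists everywhere, is in the $k$-th variable càglàd ($n$ odd) or càdlàg ($n$ even), and lies in $L^2_{dV^k\otimes dW_k,0}$ ($n$ odd) or $L^2_{dV,0}$ ($n$ even). $C^\infty_{W,V}(\mathbb{T}^d)=\langle1\rangle\oplus C^\infty_{W,V,0}(\mathbb{T}^d)$. $C^\infty_{V,W}(\mathbb{T}^d)$ is defined analogously with the roles of $W$ and $V$ (and càdlàg/càglàd) exchanged. $I-\Delta_{W,V}$ is the Friedrichs extension in $L^2_{dV}(\mathbb{T}^d)$ of $I-\sum_k\partial^{(2)}_{W_k,V_k}$ on $C^\infty_{W,V}(\mathbb{T}^d)$. $H^1_{W,V}(\mathbb{T}^d)$ is its energetic space, i.e. the $f\in L^2_{dV}(\mathbb{T}^d)$ that are $L^2_{dV}$-limits of sequences in $C^\infty_{W,V}(\mathbb{T}^d)$ that are Cauchy for the norm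 with square $\|f\|_V^2+\sum_k\|\partial^{(1)}_{W_k,V_k}f\|^2_{L^2(dV^k\otimes dW_k)}$; $\partial^{(1)}_{W_k,V_k}$ extends to it by continuity. Operator. $H_k\in C^\infty_{V,W}(\mathbb{T}^d)$ ($k=1,\dots,d$) with $H_k\ge H_0>0$ everywhere, and $\kappa\in C^\infty_{W,V}(\mathbb{T}^d)$ bounded away from zero. $B_{L_{W,V}}[u,v]=\int_{\mathbb{T}^d}\kappa^2uv\,dV+\sum_{k=1}^d\int_{\mathbb{T}^d}H_k\,\partial^{(1)}_{W_k,V_k}u\;\partial^{(1)}_{W_k,V_k}v\;dV^k\otimes dW_k$. Under these assumptions there are constants $C_1,C_2>0$ with $C_1\langle(I-\Delta_{W,V})f,f\rangle_V\le B_{L_{W,V}}[f,f]\le C_2\langle(I-\Delta_{W,V})f,f\rangle_V$ for $f\in H^1_{W,V}(\mathbb{T}^d)$ (quadratic-form sense). $L_{W,V}$ is the self-adjoint operator of the form $B_{L_{W,V}}$ on $H^1_{W,V}(\mathbb{T}^d)$ (the Friedrichs extension of $f\mapsto\kappa^2f-\sum_k\partial_{V_k}^+(H_k\partial_{W_k}^-f)$). It has an orthonormal eigenbasis $e_{j,L}$ of $L^2_{dV}(\mathbb{T}^d)$ with eigenvalues $0<\gamma_{1,L}\le\gamma_{2,L}\le\cdots\to\infty$. For $r\ge0$, $\dot H^r_{L,W,V}(\mathbb{T}^d)=\mathscr{D}(L_{W,V}^{r/2})=\{v\in L^2_{dV}:\sum_j\gamma_{j,L}^r\langle v,e_{j,L}\rangle_V^2<\infty\}$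 with the corresponding Hilbert norm; for $r<0$ it is the dual of $\dot H^{-r}_{L,W,V}$ (which contains $L^2_{dV}$). White noise. $\dot B_V=\{\dot B_V(h):h\in L^2_{dV}(\mathbb{T}^d)\}$ is an isonormal Gaussian process on a complete probability space $(\Omega,\mathcal{F},P)$: centered jointly Gaussian variables with $E(\dot B_V(g)\dot B_V(h))=\int gh\,dV$. Let $(\nu_i)$ be an orthonormal basis of $L^2_{dV}(\mathbb{T}^d)$ of eigenfunctions of $I-\Delta_{W,V}$ and $\xi_i=\dot B_V(\nu_i)$ (i.i.d. standard normal). For a Hilbert-Schmidt operator $T:L^2_{dV}(\mathbb{T}^d)\to\mathcal H$ into a Hilbert space, $T\dot B_V:=\sum_i\xi_iT\nu_i$, convergent in $L^2(\Omega;\mathcal H)$. *)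

(* Defs.v *)
From HB Require Import structures.
From mathcomp Require Import all_boot all_order all_algebra.
From mathcomp Require Import all_classical all_reals all_analysis.
From mathcomp Require Import lra.

Set Implicit Arguments.
Unset Strict Implicit.
Unset Printing Implicit Defensive.

Import Order.TTheory GRing.Theory Num.Theory.
Import numFieldNormedType.Exports.

Local Open Scope classical_set_scope.
Local Open Scope ring_scope.

(* A function on the torus (R/Z)^d is a function of x : d.-tuple R that is
   1-periodic in every coordinate. The measures dW_k, dV_k and their products
   are carried by the fundamental domain [0, 1[ (resp. [0, 1[^d), so that
   elements of the L^2 spaces, which only matter almost everywhere, are not
   required to be periodic. *)

Section one_dimensional_data.
Context {R : realType}.
Implicit Types (f m : R -> R) (x : R).

Definition cadlag f :=
  forall x, f @ x^'+ --> f x /\ cvg (f @ x^'-).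

Definition caglad f :=
  forall x, f @ x^'- --> f x /\ cvg (f @ x^'+).

Definition diff_quot m f x (h : R) := (f (x + h) - f x) / (m (x + h) - m x).

Record W_function := {
  W_fun :> R -> R ;
  W_increasing : {homo W_fun : x y / x < y} ;
  W_cadlag : cadlag W_fun ;
  W_period : forall x, W_fun (x + 1) - W_fun x = W_fun 1 - W_fun 0 ;
  W_continuous0 : {for 0, continuous W_fun} ;
  W_at0 : W_fun 0 = 0 }.

Record V_function := {
  V_fun :> R -> R ;
  V_increasing : {homo V_fun : x y / x < y} ;
  V_caglad : caglad V_fun ;
  V_period : forall x, V_fun (x + 1) - V_fun x = V_fun 1 - V_fun 0 ;
  V_continuous0 : {for 0, continuous V_fun} ;
  V_at0 : V_fun 0 = 0 }.

Lemma W_nondecreasing (W : W_function) : nondecreasing W.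
Proof. exact: ltW_homo (@W_increasing W). Qed.

Lemma W_right_continuous (W : W_function) : right_continuous W.
Proof. by move=> x; have [] := W_cadlag W x. Qed.

HB.instance Definition _ (W : W_function) :=
  isCumulative.Build R _ R (W_fun W) (@W_nondecreasing W)
    (@W_right_continuous W).

Definition V_reflected (V : V_function) x := - V (- x).

Lemma V_reflected_nondecreasing (V : V_function) :
  nondecreasing (V_reflected V).
Proof.
move=> x y xy; rewrite /V_reflected lerN2.
by apply: (ltW_homo (@V_increasing V)); rewrite lerN2.
Qed.

Lemma V_reflected_right_continuous (V : V_function) :
  right_continuous (V_reflected V).
Proof.
move=> x; rewrite /V_reflected; apply: (@cvgN _ R^o).
have [+ _] := V_caglad V (- x).
by move/cvg_at_leftNP; rewrite opprK.
Qed.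

HB.instance Definition _ (V : V_function) :=
  isCumulative.Build R _ R (V_reflected V) (@V_reflected_nondecreasing V)
    (@V_reflected_right_continuous V).


Let unit_itv_measurable : measurable (`[0, 1[%classic : set R).
Proof. exact: measurable_itv. Qed.

Lemma lebesgue_stieltjes_measure_oc (F : cumulative R R) (a b : R) : a <= b ->
  lebesgue_stieltjes_measure F `]a, b]%classic = (F b - F a)%:E.
Proof.
move=> ab; rewrite -(wlength_itv_bnd F false false ab).
by apply: measurable_mu_extE; exact: is_ocitv.
Qed.

Let ls_unit_fin (F : cumulative R R) (A : set R) : measurable A ->
  (forall x, A x -> -1 < x <= 1) ->
  (lebesgue_stieltjes_measure F A < +oo)%E.
Proof.
move=> mA A1; apply: (@le_lt_trans _ _
    (lebesgue_stieltjes_measure F `]-1, 1]%classic)).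
  by apply: le_measure; rewrite ?inE// => x /A1; rewrite /= in_itv.
by rewrite lebesgue_stieltjes_measure_oc ?ltry// lerN10.
Qed.

Definition dW (W : W_function) : set R -> \bar R :=
  fun A => lebesgue_stieltjes_measure W (A `&` `[0, 1[%classic).

(* x |-> - V (- x) is right-continuous and x |-> - x maps ]- b, - a] onto
   [a, b[, so that the measure of [a, b[ is V b - V a. *)
Definition dV (V : V_function) : set R -> \bar R :=
  fun A => lebesgue_stieltjes_measure (V_reflected V)
             (-%R @^-1` (A `&` `[0, 1[%classic)).

Section measures_on_the_circle.
Variables (W : W_function) (V : V_function).

Let dWm := mrestr (lebesgue_stieltjes_measure W) unit_itv_measurable.

Let dW0 : dW W set0 = 0%E. Proof. exact: (measure0 dWm). Qed.

Let dW_ge0 A : (0 <= dW W A)%E. Proof. exact: (measure_ge0 dWm). Qed.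

Let dW_sigma_additive : semi_sigma_additive (dW W).
Proof. exact: (@measure_semi_sigma_additive _ _ _ dWm). Qed.

HB.instance Definition _ :=
  isMeasure.Build _ R R (dW W) dW0 dW_ge0 dW_sigma_additive.

Let dW_fin : fin_num_fun (dW W).
Proof.
move=> A mA; rewrite ge0_fin_numE ?measure_ge0//; apply: ls_unit_fin.
  exact: measurableI.
move=> x [_]; rewrite /= in_itv/= => /andP[x0 x1].
by rewrite (ltW x1) (lt_le_trans _ x0)// ltrN10.
Qed.

HB.instance Definition _ := @Measure_isFinite.Build _ R R (dW W) dW_fin.

Let measurable_opp : measurable_fun [set: measurableTypeR R]
  (-%R : measurableTypeR R -> R).
Proof. exact: (@measurable_realfun.oppr_measurable R setT). Qed.

Let dVm := mrestr
  (measure_function_pushforward__canonical__measure_function_Measure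
    (lebesgue_stieltjes_measure (V_reflected V)) measurable_opp)
  unit_itv_measurable.

Let dV0 : dV V set0 = 0%E. Proof. exact: (measure0 dVm). Qed.

Let dV_ge0 A : (0 <= dV V A)%E. Proof. exact: (measure_ge0 dVm). Qed.

Let dV_sigma_additive : semi_sigma_additive (dV V).
Proof. exact: (@measure_semi_sigma_additive _ _ _ dVm). Qed.

HB.instance Definition _ :=
  isMeasure.Build _ R R (dV V) dV0 dV_ge0 dV_sigma_additive.

Let dV_fin : fin_num_fun (dV V).
Proof.
move=> A mA; rewrite ge0_fin_numE ?measure_ge0//; apply: ls_unit_fin.
  rewrite -[X in measurable X]setTI; apply: measurable_opp => //.
  exact: measurableI.
move=> x [_]; rewrite /= in_itv/= => /andP[x0 x1].
by lra.
Qed.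

HB.instance Definition _ := @Measure_isFinite.Build _ R R (dV V) dV_fin.

Lemma dW_oc (a b : R) : 0 <= a -> a <= b -> b < 1 ->
  dW W `]a, b]%classic = (W b - W a)%:E.
Proof.
move=> a0 ab b1; rewrite /dW setIidl ?lebesgue_stieltjes_measure_oc//.
by move=> x; rewrite /= !in_itv/= => /andP[? ?]; apply/andP; lra.
Qed.

Lemma dV_co (a b : R) : 0 <= a -> a <= b -> b <= 1 ->
  dV V `[a, b[%classic = (V b - V a)%:E.
Proof.
move=> a0 ab b1; rewrite /dV setIidl; last first.
  by move=> x; rewrite /= !in_itv/= => /andP[? ?]; apply/andP; lra.
have -> : -%R @^-1` `[a, b[%classic = `]- b, - a]%classic.
  by apply/seteqP; split=> x; rewrite /= !in_itv/= => /andP[? ?]; apply/andP; lra.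
rewrite lebesgue_stieltjes_measure_oc ?lerN2//.
by rewrite /= /V_reflected !opprK; congr EFin; rewrite addrC.
Qed.

End measures_on_the_circle.

End one_dimensional_data.
Arguments W_function : clear implicits.
Arguments V_function : clear implicits.

Section product_measure.
Context {R : realType}.

Definition tcons n (p : R * n.-tuple R) : n.+1.-tuple R :=
  [the n.+1.-tuple R of p.1 :: p.2].

Lemma measurable_tcons n : measurable_fun setT (@tcons n).
Proof. by apply: measurable_cons. Qed.

Definition cons_measure n (m1 : {finite_measure set R -> \bar R})
    (m2 : {finite_measure set (n.-tuple R) -> \bar R}) :
  set (n.+1.-tuple R) -> \bar R := pushforward (m1 \x m2)%E (@tcons n).

Section cons_measure.
Variables (n : nat) (m1 : {finite_measure set R -> \bar R})
  (m2 : {finite_measure set (n.-tuple R) -> \bar R}).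

Let m := measure_function_pushforward__canonical__measure_function_Measure
  (m1 \x m2)%E (@measurable_tcons n).

Let cm0 : cons_measure m1 m2 set0 = 0%E. Proof. exact: (measure0 m). Qed.

Let cm_ge0 A : (0 <= cons_measure m1 m2 A)%E. Proof. exact: (measure_ge0 m). Qed.

Let cm_sigma_additive : semi_sigma_additive (cons_measure m1 m2).
Proof. exact: (@measure_semi_sigma_additive _ _ _ m). Qed.

HB.instance Definition _ := isMeasure.Build _ _ _
  (cons_measure m1 m2) cm0 cm_ge0 cm_sigma_additive.

Let cm_fin : fin_num_fun (cons_measure m1 m2).
Proof.
move=> A mA; rewrite ge0_fin_numE ?measure_ge0//.
apply: (@le_lt_trans _ _ (cons_measure m1 m2 setT)).
  by apply: le_measure; rewrite ?inE.
rewrite /cons_measure /pushforward preimage_setT -setXTT product_measure1E//.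
by rewrite ltey_eq fin_numM// fin_num_measure.
Qed.

HB.instance Definition _ := @Measure_isFinite.Build _ _ _
  (cons_measure m1 m2) cm_fin.

End cons_measure.

Definition empty_measure : {finite_measure set (0.-tuple R) -> \bar R} :=
  dirac [tuple].

Fixpoint prod_measure (n : nat) :
    ('I_n -> {finite_measure set R -> \bar R}) ->
    {finite_measure set (n.-tuple R) -> \bar R} :=
  match n with
  | 0 => fun=> empty_measure
  | n'.+1 => fun mu =>
      cons_measure (mu ord0) (prod_measure (fun i => mu (lift ord0 i)))
  end.

Lemma prod_measureE n (mu : 'I_n -> {finite_measure set R -> \bar R})
    (A : 'I_n -> set R) : (forall i, measurable (A i)) ->
  prod_measure mu [set x | forall i, A i (tnth x i)] =
    (\prod_(i < n) mu i (A i))%E.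
Proof.
elim: n => [|n IH] in mu A * => mA.
  by rewrite big_ord0 /= /dirac indicE mem_set// => -[].
rewrite big_ord_recl /= /cons_measure /pushforward.
rewrite -IH// -product_measure1E//.
  congr (_ _); apply/seteqP; split => -[a x] /=.
    move=> H; split=> [|i]; first by have := H ord0.
    by have := H (lift ord0 i); rewrite tnthS.
  move=> [Aa Ax] i; case: (unliftP ord0 i) => [j ->|-> //].
  by rewrite tnthS.
have -> : [set x : n.-tuple R | forall i, A (lift ord0 i) (tnth x i)] =
    \bigcap_(i in [set: 'I_n]) ((fun x => tnth x i) @^-1` A (lift ord0 i)).
  by apply/seteqP; split=> x /= H i => [_|]; exact: H.
apply: fin_bigcap_measurable => // i _.
by rewrite -[X in measurable X]setTI; exact: measurable_tnth.
Qed.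

End product_measure.

Notation "'L2[ mu ]" := (Lfun mu 2%:E) (at level 0, format "''L2[' mu ]").

Section L2.
Context {d : measure_display} {X : measurableType d} {R : realType}.
Variable mu : {measure set X -> \bar R}.

Definition norm2 (f : X -> R) : \bar R := 'N[mu]_2%:E[EFin \o f].

Definition inner (f g : X -> R) : R := \int[mu]_x (f x * g x).

Definition orthonormal_basis (e : nat -> X -> R) :=
  [/\ forall i, e i \in 'L2[mu],
      forall i j, inner (e i) (e j) = (i == j)%:R &
      forall f, f \in 'L2[mu] -> (forall i, inner f (e i) = 0) ->
        {ae mu, forall x, f x = 0}].

End L2.

Section torus.
Context {R : realType} {d : nat}.
Local Notation X := (d.-tuple R).
Implicit Types (f g : X -> R) (x : X) (k : 'I_d).

Definition upd x k (t : R) : X :=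
  [tuple if i == k then t else tnth x i | i < d].

Definition slice f k x (t : R) : R := f (upd x k t).

Definition unit_periodic f := forall x k, f (upd x k (tnth x k + 1)) = f x.

(* Left is attached to D_W^-, applied to cadlag functions and producing caglad
   ones; Right is attached to D_V^+, for which the roles are exchanged. *)
Inductive side := Left | Right.

Definition opposite s := if s is Left then Right else Left.

Definition near_side s : set_system R :=
  if s is Left then (0 : R)^'- else (0 : R)^'+.

Definition regular s : (R -> R) -> Prop :=
  if s is Left then cadlag else caglad.

Definition partial_exists s (m : R -> R) k f x : Prop :=
  cvg (diff_quot m (slice f k x) (tnth x k) @ near_side s).

Definition partial s (m : R -> R) k f x : R :=
  lim (diff_quot m (slice f k x) (tnth x k) @ near_side s).

(* In what follows (s, A, muA) is the derivative applied first and the measure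
   of A, while (opposite s, B, muB) is the one applied second: (Left, W, dW)
   and (Right, V, dV) for the spaces indexed by W, V, and the converse for the
   ones indexed by V, W. *)
Section smooth_functions.
Variables (s : side) (A B : 'I_d -> R -> R).
Variables (muA muB : 'I_d -> {finite_measure set R -> \bar R}).

Definition side_of (n : nat) := if odd n then opposite s else s.

Definition driver_of (n : nat) k := if odd n then B k else A k.

Fixpoint iter_partial k (n : nat) f : X -> R :=
  if n is n'.+1
  then partial (side_of n') (driver_of n' k) k (iter_partial k n' f)
  else f.

Definition mixed_measure k : {finite_measure set X -> \bar R} :=
  prod_measure (fun i => if i == k then muA i else muB i).

Definition measure_of k (n : nat) : {finite_measure set X -> \bar R} :=
  if odd n then mixed_measure k else prod_measure muB.

Definition Cinfty0 f : Prop :=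
  [/\ unit_periodic f,
      f \in 'L2[prod_measure muB],
      \int[prod_measure muB]_x f x = 0,
      forall k x, regular s (slice f k x) &
      forall k n,
        [/\ forall x, partial_exists (side_of n) (driver_of n k) k
              (iter_partial k n f) x,
            forall x, regular (side_of n.+1) (slice (iter_partial k n.+1 f) k x),
            iter_partial k n.+1 f \in 'L2[measure_of k n.+1] &
            \int[measure_of k n.+1]_x iter_partial k n.+1 f x = 0]].

Definition Cinfty f : Prop :=
  exists c f0, Cinfty0 f0 /\ f = (fun x => c + f0 x).

End smooth_functions.

End torus.

Section spaces_and_operators.
Context {R : realType} {d : nat}.
Variables (W : 'I_d -> W_function R) (V : 'I_d -> V_function R).
Local Notation X := (d.-tuple R).
Implicit Types (f g u v : X -> R) (k : 'I_d) (r : R).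

Definition dWs k : {finite_measure set R -> \bar R} := dW (W k).
Definition dVs k : {finite_measure set R -> \bar R} := dV (V k).

Definition Cinfty_WV : (X -> R) -> Prop :=
  Cinfty Left (fun k => W k : R -> R) (fun k => V k : R -> R) dWs dVs.

Definition Cinfty_VW : (X -> R) -> Prop :=
  Cinfty Right (fun k => V k : R -> R) (fun k => W k : R -> R) dVs dWs.

Definition mV : {finite_measure set X -> \bar R} := prod_measure dVs.

Definition mVW k : {finite_measure set X -> \bar R} := mixed_measure dWs dVs k.

Definition partial_WV (n : nat) k f : X -> R :=
  iter_partial Left (fun k => W k : R -> R) (fun k => V k : R -> R) k n f.

Definition energy_norm_sq f : \bar R :=
  (norm2 mV f ^+ 2 + \sum_(k < d) norm2 (mVW k) (partial_WV 1 k f) ^+ 2)%E.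

Definition energy_cauchy (phi : nat -> X -> R) :=
  forall eps : R, 0 < eps -> exists N : nat, forall m n : nat,
    (N <= m)%N -> (N <= n)%N ->
    (energy_norm_sq (fun x => (phi m x - phi n x)%R) < eps%:E)%E.

Definition H1_approx f (phi : nat -> X -> R) :=
  [/\ forall n, Cinfty_WV (phi n), energy_cauchy phi &
      norm2 mV (fun x => phi n x - f x) @[n --> \oo] --> 0%E].

Definition H1 f := f \in 'L2[mV] /\ exists phi, H1_approx f phi.

(* The extension by continuity of (partial_WV 1 k)_k from Cinfty_WV to H1; it
   is determined up to null sets of mVW k. *)
Definition is_gradient f (G : 'I_d -> X -> R) :=
  exists2 phi, H1_approx f phi & forall k, G k \in 'L2[mVW k] /\
    norm2 (mVW k) (fun x => partial_WV 1 k (phi n) x - G k x) @[n --> \oo]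
      --> 0%E.

Definition gradient f : 'I_d -> X -> R :=
  xget (fun _ _ => 0) [set G | is_gradient f G].

Definition form_L (H : 'I_d -> X -> R) (kappa : X -> R) u v : \bar R :=
  (\int[mV]_x (kappa x ^+ 2 * u x * v x)%:E +
   \sum_(k < d) \int[mVW k]_x (H k x * gradient u k x * gradient v k x)%:E)%E.

(* Operators on L^2(dV) are represented by their graphs: A f g means that f is
   in the domain of A and that A f = g. *)
Definition L_op (H : 'I_d -> X -> R) (kappa : X -> R) f g :=
  [/\ H1 f, g \in 'L2[mV] &
      forall v, H1 v -> form_L H kappa f v = (inner mV g v)%:E].

(* The Friedrichs extension is the restriction of the adjoint of
   I - sum_k partial_WV 2 k, defined on Cinfty_WV, to the vectors of its domain
   which belong to the energetic space H1. *)
Definition I_minus_Delta f g :=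
  [/\ H1 f, g \in 'L2[mV] &
      forall v, Cinfty_WV v ->
        inner mV f (fun x => v x - \sum_(k < d) partial_WV 2 k v x)
          = inner mV g v].

Definition eigenbasis (A : (X -> R) -> (X -> R) -> Prop)
    (e : nat -> X -> R) (gamma : nat -> R) :=
  orthonormal_basis mV e /\
  forall j, A (e j) (fun x => gamma j * e j x).

Section spectral_calculus.
Variables (e : nat -> X -> R) (gamma : nat -> R).

Definition is_power r f g :=
  [/\ f \in 'L2[mV], g \in 'L2[mV] &
      forall j, inner mV g (e j) = gamma j `^ r * inner mV f (e j)].

Definition power r f : X -> R := xget (fun=> 0) [set g | is_power r f g].

Definition Hdot_norm_ge0 r v : \bar R :=
  ((\sum_(0 <= j <oo) (gamma j `^ r * inner mV v (e j) ^+ 2)%:E) `^ 2^-1)%E.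

(* For r < 0, an element v of L^2(dV) is identified with the linear functional
   phi |-> inner v phi on the space of order - r. *)
Definition Hdot_norm r v : \bar R :=
  if 0 <= r then Hdot_norm_ge0 r v
  else ereal_sup [set `|inner mV v phi|%:E | phi in
         [set phi | phi \in 'L2[mV] /\ (Hdot_norm_ge0 (- r) phi <= 1)%E]].

Definition Hdot r v := v \in 'L2[mV] /\ (Hdot_norm r v < +oo)%E.

End spectral_calculus.

End spaces_and_operators.

Section gaussian.
Context {dO : measure_display} {Omega : measurableType dO} {R : realType}.
Variable P : probability Omega R.

(* normal_prob 0 0 is not a Dirac mass. *)
Definition centered_gaussian (Y : Omega -> R) :=
  measurable_fun setT Y /\
  exists2 sigma : R, 0 <= sigma & forall A, measurable A ->
    P (Y @^-1` A) = if sigma == 0 then dirac (0 : R) A else normal_prob 0 sigma A.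

Section hilbert_valued.
Context {dX : measure_display} {X : measurableType dX}.
Variable mu : {measure set X -> \bar R}.

Definition isonormal (B : (X -> R) -> Omega -> R) :=
  (forall n (h : 'I_n -> X -> R) (a : 'I_n -> R),
     (forall i, h i \in 'L2[mu]) ->
     centered_gaussian (fun w => \sum_(i < n) a i * B (h i) w)) /\
  (forall g h, g \in 'L2[mu] -> h \in 'L2[mu] ->
     ('E_P[fun w => (B g w * B h w)%R] = (inner mu g h)%:E)%E).

(* Weak and strong measurability agree since L^2(mu) is separable. *)
Definition L2_random_variable (u : Omega -> X -> R) :=
  [/\ forall w, u w \in 'L2[mu],
      forall h, h \in 'L2[mu] -> measurable_fun setT (fun w => inner mu (u w) h) &
      (\int[P]_w norm2 mu (u w) ^+ 2 < +oo)%E].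

Definition noise_image (B : (X -> R) -> Omega -> R) (nu : nat -> X -> R)
    (T : (X -> R) -> X -> R) (u : Omega -> X -> R) :=
  L2_random_variable u /\
  (\int[P]_w norm2 mu
     (fun x => (u w x - \sum_(i < n) B (nu i) w * T (nu i) x)%R) ^+ 2
   @[n --> \oo] --> 0)%E.

End hilbert_valued.

End gaussian.

(* Main.v *)
(* Everything rests on a Weyl-type lower bound gamma_j >= c j^(2/d), which makes
   sum_j gamma_j^(-s) finite for s > d/2.

   Cut the k-th circle into 2m intervals on which either the increments of W_k
   and the mass of dV_k are at most C/m, or which are reduced to a point.  By
   the fundamental theorem for D_W^- and the Cauchy-Schwarz inequality, a smooth
   f has (f(y) - f(x))^2 <= (W_k(y) - W_k(x)) int |D_W^- f|^2 dW_k along such an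
   interval, so that f differs from its averages over the (2m)^d product cells
   by at most C m^(-2) times its energy, in squared norm.  This passes to the
   limit for the eigenfunctions e_j, whose energy is bounded by gamma_j.  Summing
   over j < N and applying Bessel's inequality to the cells gives
   N <= (2m)^d + C m^(-2) sum_(j < N) gamma_j, whence the bound.

   The solution is the L^2(dV)-valued series sum_j gamma_j^(-beta) B(e_j) e_j,
   which converges almost surely because sum_j gamma_j^(-2 beta) is finite.  For
   an arbitrary limit u of the truncations along (nu_i), comparing them with the
   expansion of B phi along (B nu_i) gives <u, L^beta phi> = B phi almost surely;
   uniqueness, Gaussianity, covariance and regularity all follow from this. *)

Require Import Defs.
From HB Require Import structures.
From mathcomp Require Import all_boot all_order all_algebra.
From mathcomp Require Import all_classical all_reals all_analysis.
From mathcomp Require Import measurable_realfun.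
From mathcomp Require Import ring lra.

Set Implicit Arguments.
Unset Strict Implicit.
Unset Printing Implicit Defensive.

Import Order.TTheory GRing.Theory Num.Theory.
Import numFieldNormedType.Exports.

Local Open Scope classical_set_scope.
Local Open Scope ring_scope.

(** * Square-integrable functions *)

(** The functions W_k and V_k may jump on dense sets, and nothing relates the two measures they
    define, so arcs of small length control neither of them. The circles are cut along the values of
    W_k + V_k instead. An atom of dV_k too large for its level ends that level and gets a cell of
    its own, on which f does not vary in that coordinate. In every other cell the increment of W_k
    and the mass of dV_k contribute one factor C/m each: this is the origin of m^(-2), and of the
    exponent 2/d once N is at least twice the number of cells.

    The increment estimate along a line is proved with extended reals, since a slice of a
    square-integrable derivative need not be square-integrable on that particular line.

    On the probabilistic side everything is read on coordinates: <u, e_j> has variance gamma_j^(-2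
    beta), so that for r >= 0 the expected squared norm of order r is the sum of gamma_j^(r - 2
    beta). The loss of d/2 + epsilon in regularity is the same summability threshold as in the Weyl
    bound. *)

Lemma nneseries_EFin_le {R : realType} (a : nat -> R) (C : R) :
  (forall j, 0 <= a j) -> (forall n, \sum_(i < n) a i <= C) ->
  (\sum_(0 <= j <oo) (a j)%:E <= C%:E)%E.
Proof.
move=> a0 aC; apply: lime_le.
  by apply: is_cvg_nneseries => n _ _; rewrite lee_fin.
by apply: nearW => n; rewrite big_mkord sumEFin lee_fin.
Qed.

Lemma nneseries_EFin_ge {R : realType} (a : nat -> R) n :
  (forall j, 0 <= a j) ->
  ((\sum_(i < n) a i)%:E <= \sum_(0 <= j <oo) (a j)%:E)%E.
Proof.
move=> a0; rewrite -sumEFin -(big_mkord xpredT (fun i => (a i)%:E)).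
by apply: nneseries_lim_ge => k _ _; rewrite lee_fin.
Qed.

Lemma nneseries_EFin_cvg {R : realType} (a : nat -> R) (l : R) :
  (forall j, 0 <= a j) -> series a @ \oo --> l ->
  (\sum_(0 <= j <oo) (a j)%:E)%E = l%:E.
Proof.
move=> a0 al; apply/cvg_lim => //.
rewrite [X in X @ _ --> _](_ : _ = EFin \o series a).
  by apply: cvg_EFin => //; exact: nearW.
by apply/funext => n; rewrite /= sumEFin.
Qed.

Lemma nneseries_EFin_lty {R : realType} (a : nat -> R) :
  (forall j, 0 <= a j) -> (\sum_(0 <= j <oo) (a j)%:E < +oo)%E ->
  exists C : R, forall n, \sum_(i < n) a i <= C.
Proof.
move=> a0 afin; exists (fine (\sum_(0 <= j <oo) (a j)%:E)%E) => n.
rewrite -lee_fin fineK; first exact: nneseries_EFin_ge.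
by rewrite ge0_fin_numE//; apply: nneseries_ge0 => k _ _; rewrite lee_fin.
Qed.

(* The library's [ge0_le_integral] also asks [f] and [g] to be measurable. *)
Lemma ge0_le_integral_nomeas d {X : measurableType d} {R : realType}
    (mu : {measure set X -> \bar R}) (f g : X -> \bar R) :
  (forall x, 0 <= f x)%E -> (forall x, f x <= g x)%E ->
  (\int[mu]_x f x <= \int[mu]_x g x)%E.
Proof.
move=> f0 fg; have g0 x : (0 <= g x)%E by exact: le_trans (fg x).
rewrite !ge0_integralTE//; apply: le_ereal_sup => _ [h hf <-].
by exists h => // x; exact: le_trans (hf x) (fg x).
Qed.

Lemma poweR2_expe {R : realType} (x : \bar R) :
  (0 <= x)%E -> (x `^ 2 = x ^+ 2)%E.
Proof.
case: x => [x|_|//].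
  by rewrite lee_fin => x0; rewrite poweR_EFin powR_mulrn// EFin_expe.
by rewrite poweRyr ?pnatr_eq0// expe2 mulyy.
Qed.

Section square_integrable.
Context {d : measure_display} {X : measurableType d} {R : realType}.
Variable mu : {measure set X -> \bar R}.
Implicit Types f g h : X -> R.

Lemma norm2_sqr f : (norm2 mu f ^+ 2 = \int[mu]_x ((f x) ^+ 2)%:E)%E.
Proof.
rewrite /norm2 -poweR2_expe ?Lnorm_ge0// poweR_Lnorm ?pnatr_eq0//.
by apply: eq_integral => x _; rewrite /= powR_mulrn// real_normK ?num_real.
Qed.

Lemma L2P f : f \in 'L2[mu] <->
  measurable_fun setT f /\ (\int[mu]_x ((f x) ^+ 2)%:E < +oo)%E.
Proof.
rewrite inE; split.
  move=> /andP[/[!inE]/= mf]; rewrite /finite_norm => nf; split => //.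
  rewrite -norm2_sqr /norm2.
  by rewrite -poweR2_expe ?Lnorm_ge0// poweR_lty.
move=> [mf If]; apply/andP; rewrite !inE /finite_norm/=; split => //.
rewrite ltNge leye_eq; apply/negP => /eqP nf.
by move: If; rewrite -norm2_sqr /norm2 nf.
Qed.

Lemma L2_measurable f : f \in 'L2[mu] -> measurable_fun setT f.
Proof. by move/L2P => []. Qed.

Lemma L2_integrableM f g : f \in 'L2[mu] -> g \in 'L2[mu] ->
  mu.-integrable setT (EFin \o (fun x => f x * g x)).
Proof. by move=> f2 g2; apply/Lfun1_integrable; exact: Lfun2_mul_Lfun1. Qed.

Lemma L2_inner f : f \in 'L2[mu] ->
  (\int[mu]_x ((f x) ^+ 2)%:E = (inner mu f f)%:E)%E.
Proof.
move=> f2; rewrite /inner /Rintegral fineK.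
  by apply: eq_integral => x _; rewrite expr2.
by apply: integrable_fin_num => //; exact: L2_integrableM.
Qed.

Lemma norm2_inner f : f \in 'L2[mu] -> (norm2 mu f ^+ 2 = (inner mu f f)%:E)%E.
Proof. by move=> f2; rewrite norm2_sqr L2_inner. Qed.

Lemma L2_0 : (fun=> 0) \in 'L2[mu].
Proof.
apply/L2P; split; first exact: measurable_cst.
by under eq_integral do rewrite expr0n/=; rewrite integral0.
Qed.

Lemma L2_scale a f : f \in 'L2[mu] -> (fun x => a * f x) \in 'L2[mu].
Proof.
move=> /[dup] /L2_measurable mf f2; apply/L2P; split.
  exact: measurable_funM.
under eq_integral do rewrite exprMn EFinM.
rewrite ge0_integralZl//.
- by rewrite L2_inner// -EFinM ltry.
- by apply/measurable_EFinP; exact: measurable_funX.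
- by move=> x _; rewrite lee_fin sqr_ge0.
- by rewrite lee_fin sqr_ge0.
Qed.

Lemma L2_add f g : f \in 'L2[mu] -> g \in 'L2[mu] ->
  (fun x => f x + g x) \in 'L2[mu].
Proof.
move=> /[dup] /L2_measurable mf f2 /[dup] /L2_measurable mg g2.
apply/L2P; split; first exact: measurable_funD.
apply: (@le_lt_trans _ _ (\int[mu]_x ((2 * (f x) ^+ 2)%:E + (2 * (g x) ^+ 2)%:E))%E).
  apply: ge0_le_integral_nomeas => x; first by rewrite lee_fin sqr_ge0.
  rewrite -EFinD lee_fin -subr_ge0.
  rewrite (_ : _ - _ = (f x - g x) ^+ 2); first exact: sqr_ge0.
  by ring.
have I h : h \in 'L2[mu] -> (\int[mu]_x (2 * (h x) ^+ 2)%:E < +oo)%E.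
  move=> /[dup] /L2_measurable mh h2; under eq_integral do rewrite EFinM.
  rewrite ge0_integralZl// ?L2_inner// -?EFinM ?ltry//.
  - by apply/measurable_EFinP; exact: measurable_funX.
  - by move=> x _; rewrite lee_fin sqr_ge0.
rewrite ge0_integralD//; first by rewrite lte_add_pinfty// I.
- by move=> x _; rewrite lee_fin mulr_ge0// sqr_ge0.
- by apply/measurable_EFinP; apply: measurable_funM => //; exact: measurable_funX.
- by move=> x _; rewrite lee_fin mulr_ge0// sqr_ge0.
- by apply/measurable_EFinP; apply: measurable_funM => //; exact: measurable_funX.
Qed.

Lemma L2_opp f : f \in 'L2[mu] -> (fun x => - f x) \in 'L2[mu].
Proof.
move=> f2; rewrite [X in X \in _](_ : _ = fun x => (-1) * f x).
  exact: L2_scale.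
by apply/funext => x; rewrite mulN1r.
Qed.

Lemma L2_sub f g : f \in 'L2[mu] -> g \in 'L2[mu] ->
  (fun x => f x - g x) \in 'L2[mu].
Proof. by move=> f2 g2; apply: L2_add => //; exact: L2_opp. Qed.

Lemma L2_sum (I : Type) (r : seq I) (P : pred I) (F : I -> X -> R) :
  (forall i, P i -> F i \in 'L2[mu]) ->
  (fun x => \sum_(i <- r | P i) F i x) \in 'L2[mu].
Proof.
move=> F2; elim: r => [|i r IH].
  by under eq_fun do rewrite big_nil; exact: L2_0.
under eq_fun do rewrite big_cons.
by case: (boolP (P i)) => // Pi; apply: L2_add => //; exact: F2.
Qed.

Lemma innerC f g : inner mu f g = inner mu g f.
Proof. by apply: eq_Rintegral => x _; rewrite mulrC. Qed.

Lemma innerDl f g h : f \in 'L2[mu] -> g \in 'L2[mu] -> h \in 'L2[mu] ->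
  inner mu (fun x => f x + g x) h = inner mu f h + inner mu g h.
Proof.
move=> f2 g2 h2; rewrite /inner; under eq_Rintegral do rewrite mulrDl.
by rewrite RintegralD//; exact: L2_integrableM.
Qed.

Lemma innerZl a f h : f \in 'L2[mu] -> h \in 'L2[mu] ->
  inner mu (fun x => a * f x) h = a * inner mu f h.
Proof.
move=> f2 h2; rewrite /inner; under eq_Rintegral do rewrite -mulrA.
by rewrite RintegralZl//; exact: L2_integrableM.
Qed.

Lemma innerZr a f h : f \in 'L2[mu] -> h \in 'L2[mu] ->
  inner mu h (fun x => a * f x) = a * inner mu h f.
Proof. by move=> f2 h2; rewrite innerC innerZl// innerC. Qed.

Lemma innerDr f g h : f \in 'L2[mu] -> g \in 'L2[mu] -> h \in 'L2[mu] ->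
  inner mu h (fun x => f x + g x) = inner mu h f + inner mu h g.
Proof. by move=> f2 g2 h2; rewrite innerC innerDl// !(innerC h). Qed.

Lemma innerBl f g h : f \in 'L2[mu] -> g \in 'L2[mu] -> h \in 'L2[mu] ->
  inner mu (fun x => f x - g x) h = inner mu f h - inner mu g h.
Proof.
move=> f2 g2 h2; rewrite /inner; under eq_Rintegral do rewrite mulrBl.
by rewrite RintegralB//; exact: L2_integrableM.
Qed.

Lemma innerBr f g h : f \in 'L2[mu] -> g \in 'L2[mu] -> h \in 'L2[mu] ->
  inner mu h (fun x => f x - g x) = inner mu h f - inner mu h g.
Proof. by move=> f2 g2 h2; rewrite innerC innerBl// !(innerC h). Qed.

Lemma inner0l h : inner mu (fun=> 0) h = 0.
Proof.
rewrite /inner /Rintegral; under eq_integral do rewrite mul0r.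
by rewrite integral0.
Qed.

Lemma inner_suml n (F : 'I_n -> X -> R) h : (forall i, F i \in 'L2[mu]) ->
  h \in 'L2[mu] ->
  inner mu (fun x => \sum_(i < n) F i x) h = \sum_(i < n) inner mu (F i) h.
Proof.
move=> F2 h2; elim: n F F2 => [|n IH] F F2.
  by rewrite big_ord0; under eq_fun do rewrite big_ord0; exact: inner0l.
under eq_fun do rewrite big_ord_recr /=.
rewrite innerDl ?IH ?big_ord_recr//; exact: L2_sum.
Qed.

Lemma inner_ge0 f : 0 <= inner mu f f.
Proof. by apply: Rintegral_ge0 => x _ /=; rewrite -expr2 sqr_ge0. Qed.

Lemma inner_sqrD f g : f \in 'L2[mu] -> g \in 'L2[mu] ->
  inner mu (fun x => f x + g x) (fun x => f x + g x) =
  inner mu f f + 2 * inner mu f g + inner mu g g.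
Proof.
move=> f2 g2; have fg2 := L2_add f2 g2.
by rewrite innerDl// !innerDr// (innerC g f); ring.
Qed.

Lemma inner_sqrB f g : f \in 'L2[mu] -> g \in 'L2[mu] ->
  inner mu (fun x => f x - g x) (fun x => f x - g x) =
  inner mu f f - 2 * inner mu f g + inner mu g g.
Proof.
move=> f2 g2; have fg2 := L2_sub f2 g2.
by rewrite innerBl// !innerBr// (innerC g f); ring.
Qed.

Lemma inner_sqrD_le f g : f \in 'L2[mu] -> g \in 'L2[mu] ->
  inner mu (fun x => f x + g x) (fun x => f x + g x) <=
  2 * inner mu f f + 2 * inner mu g g.
Proof.
move=> f2 g2; have := inner_ge0 (fun x => f x - g x).
by rewrite inner_sqrB// inner_sqrD//; lra.
Qed.

Lemma inner_sqr_triangle f g h :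
  f \in 'L2[mu] -> g \in 'L2[mu] -> h \in 'L2[mu] ->
  inner mu (fun x => f x - h x) (fun x => f x - h x) <=
  2 * inner mu (fun x => f x - g x) (fun x => f x - g x) +
  2 * inner mu (fun x => g x - h x) (fun x => g x - h x).
Proof.
move=> f2 g2 h2.
rewrite [X in inner mu X X <= _](_ : _ = fun x => (f x - g x) + (g x - h x)).
  by apply: inner_sqrD_le; exact: L2_sub.
by apply/funext => x; ring.
Qed.

Lemma cauchy_schwarz f g : f \in 'L2[mu] -> g \in 'L2[mu] ->
  inner mu f g ^+ 2 <= inner mu f f * inner mu g g.
Proof.
move=> f2 g2; set a := inner mu f f; set b := inner mu f g.
set c := inner mu g g.
have H t : 0 <= a - 2 * (t * b) + t ^+ 2 * c.
  have := inner_ge0 (fun x => f x - t * g x).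
  rewrite inner_sqrB ?L2_scale//.
  by rewrite !innerZr ?L2_scale// innerZl// (mulrA t t) -expr2.
have [c0|c0] := eqVneq c 0.
  rewrite c0 mulr0; have [->|b0] := eqVneq b 0; first by rewrite expr0n.
  (* With [c] zero the quadratic polynomial is affine in [t], and this [t] gives it the value -1. *)
  have := H ((a + 1) / b / 2); rewrite c0 mulr0 addr0.
  rewrite (_ : 2 * _ = a + 1); last by field.
  by lra.
have c_gt0 : 0 < c by rewrite lt_def c0 inner_ge0.
have := H (b / c).
rewrite (_ : _ + _ = (a * c - b ^+ 2) / c); last by field.
by rewrite pmulr_lge0 ?invr_gt0// subr_ge0.
Qed.

Lemma inner_sqr_eq0 f : f \in 'L2[mu] -> inner mu f f = 0 ->
  {ae mu, forall x, f x = 0}.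
Proof.
move=> f2 f0; have := L2_inner f2; rewrite f0 => I0.
have : (\int[mu]_x `|(f x ^+ 2)%:E| = 0)%E.
  rewrite -[RHS]I0; apply: eq_integral => x _.
  by rewrite gee0_abs// lee_fin sqr_ge0.
have mf := L2_measurable f2.
have mf2 : measurable_fun setT (EFin \o (fun x => f x ^+ 2)).
  by apply/measurable_EFinP; exact: measurable_funX.
move/(ae_eq_integral_abs mu measurableT mf2).
apply: filterS => x /(_ I)/= [] /eqP.
by rewrite sqrf_eq0 => /eqP.
Qed.

Lemma inner_ae_eql f g h : f \in 'L2[mu] -> g \in 'L2[mu] -> h \in 'L2[mu] ->
  inner mu (fun x => f x - g x) (fun x => f x - g x) = 0 ->
  inner mu f h = inner mu g h.
Proof.
move=> f2 g2 h2 fg; apply/eqP; rewrite -subr_eq0 -innerBl//.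
have := cauchy_schwarz (L2_sub f2 g2) h2.
rewrite fg mul0r => H; rewrite -sqrf_eq0; apply/eqP/le_anti.
by rewrite H sqr_ge0.
Qed.

End square_integrable.

(** * Completeness of L^2 *)

Section completeness.
Context {d : measure_display} {X : measurableType d} {R : realType}.
Variable mu : {measure set X -> \bar R}.
Implicit Types f g h : X -> R.

(** Squared distances keep square roots out of the estimates; [inner_sqr_triangle] then plays the
    part of the triangle inequality. *)
Definition sqdist f g : R := inner mu (fun x => f x - g x) (fun x => f x - g x).

Lemma sqdist_ge0 f g : 0 <= sqdist f g.
Proof. exact: inner_ge0. Qed.

Lemma sqdistC f g : sqdist f g = sqdist g f.
Proof. by apply: eq_Rintegral => x _ /=; ring. Qed.

Lemma sqdist_integral f g : f \in 'L2[mu] -> g \in 'L2[mu] ->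
  (\int[mu]_x ((f x - g x) ^+ 2)%:E = (sqdist f g)%:E)%E.
Proof. by move=> f2 g2; rewrite L2_inner//; exact: L2_sub. Qed.

Lemma measurable_sqr_sub f g : measurable_fun setT f -> measurable_fun setT g ->
  measurable_fun setT (fun x => ((f x - g x) ^+ 2)%:E).
Proof.
move=> mf mg; apply/measurable_EFinP; apply: measurable_funX.
exact: measurable_funB.
Qed.

(** For every real t, |t| <= 2^k t^2 + 2^(-k), so the weighted squares dominate the increments,
    which are absolutely summable. The 2 in the bound [C + 2] is the sum of the 2^(-k). *)
Lemma telescope_cvg (u : nat -> R) (C : R) :
  (forall n, \sum_(k < n) 2 ^+ k * (u k.+1 - u k) ^+ 2 <= C) -> cvgn u.
Proof.
move=> uC; suff: cvgn (series (telescope u)).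
  move=> /cvg_ex[l ul]; apply/cvg_ex; exists (u 0%N + l).
  rewrite [X in X @ _ --> _](_ : u = fun n => u 0%N + series (telescope u) n).
    by apply: cvgD => //; exact: cvg_cst.
  by apply/funext => n; exact: eq_sum_telescope.
apply: normed_cvg; apply: nondecreasing_is_cvgn.
  by apply: nondecreasing_series => n _ _; exact: normr_ge0.
exists (C + 2) => _ [n _ <-]; rewrite /= seriesEord/=.
apply: (@le_trans _ _ (\sum_(k < n) (2 ^+ k * (u k.+1 - u k) ^+ 2 + 2^-1 ^+ k))).
  apply: ler_sum => k _; rewrite /telescope/=; set a := _ - _.
  rewrite -(real_normK (num_real a)); set b := `|a|.
  have p0 : (0 : R) < 2 ^+ k by rewrite exprn_gt0.
  rewrite -subr_ge0 exprVn; set p := 2 ^+ k in p0 *.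
  have -> : p * b ^+ 2 + p^-1 - b = (p * ((b - (2 * p)^-1) ^+ 2 + 3 / 4 * p^-1 ^+ 2)).
    by field; rewrite gt_eqF.
  by rewrite mulr_ge0 ?(ltW p0)// addr_ge0 ?sqr_ge0// mulr_ge0 ?sqr_ge0//; lra.
rewrite big_split/= lerD//; first exact: uC.
have := @geometric_seriesE R 1 2^-1; rewrite seriesEord.
have -> : ((2^-1 : R) != 1) by rewrite lt_eqF// invf_lt1// ltr1n.
move=> /(_ isT)/(congr1 (@^~ n))/=.
under eq_bigr do rewrite mul1r.
rewrite mul1r => H; rewrite [leLHS](_ : _ = (1 - 2^-1 ^+ n) / (1 - 2^-1)); last exact: H.
rewrite ler_pdivrMr; last by lra.
have : (0 : R) <= 2^-1 ^+ n by rewrite exprn_ge0.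
by lra.
Qed.

(* A subsequence with [|F (p k.+1) - F (p k)|^2 <= 4^-k] converges almost
   everywhere, since [2^k |F (p k.+1) - F (p k)|^2] has a finite sum almost
   everywhere; its limit is the limit in L^2 by Fatou's lemma. *)
Lemma L2_complete (F : nat -> X -> R) : (forall n, F n \in 'L2[mu]) ->
  (forall eps, 0 < eps -> exists N : nat, forall m n : nat,
    (N <= m)%N -> (N <= n)%N -> sqdist (F m) (F n) <= eps) ->
  exists2 G, G \in 'L2[mu] & sqdist (F n) G @[n --> \oo] --> 0.
Proof.
move=> F2 Fc.
have /choice[N hN] k : exists N : nat, forall m n : nat,
    (N <= m)%N -> (N <= n)%N -> sqdist (F m) (F n) <= 2^-1 ^+ k * 2^-1 ^+ k.
  by apply: Fc; rewrite mulr_gt0// exprn_gt0.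
pose p k := (\sum_(i < k.+1) N i)%N.
have pS k : (p k <= p k.+1)%N by rewrite /p (big_ord_recr k.+1)/= leq_addr.
have Np k : (N k <= p k)%N by rewrite /p big_ord_recr/= leq_addl.
(* Adding [k] makes the indices tend to infinity even if the thresholds [N k] are all zero. *)
pose p' k := (p k + k)%N.
have p'S k : (p' k <= p' k.+1)%N by rewrite /p' leq_add.
have Np' k : (N k <= p' k)%N by rewrite (leq_trans (Np k))// leq_addr.
have kp' k : (k <= p' k)%N by rewrite leq_addl.
have mF n : measurable_fun setT (F n) by exact: L2_measurable (F2 n).
pose h x := (\sum_(0 <= k <oo) (2 ^+ k * (F (p' k.+1) x - F (p' k) x) ^+ 2)%:E)%E.
have mterm k : measurable_fun setT
    (fun x => (2 ^+ k * (F (p' k.+1) x - F (p' k) x) ^+ 2)%:E).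
  apply/measurable_EFinP; apply: measurable_funM => //.
  by apply: measurable_funX; exact: measurable_funB.
have term0 k x : (0 <= (2 ^+ k * (F (p' k.+1) x - F (p' k) x) ^+ 2)%:E)%E.
  by rewrite lee_fin mulr_ge0// ?sqr_ge0// exprn_ge0.
have mh : measurable_fun setT h by apply: ge0_emeasurable_sum.
have Ih : (\int[mu]_x h x < +oo)%E.
  rewrite integral_nneseries//.
  apply: (@le_lt_trans _ _ (\sum_(0 <= k <oo) (2^-1 ^+ k)%:E)%E).
    apply: lee_nneseries => [k _ _|k _]; first by apply: integral_ge0.
    under eq_integral do rewrite EFinM.
    rewrite ge0_integralZl//.
    - rewrite sqdist_integral// -EFinM lee_fin.
      rewrite mulrC -ler_pdivlMr ?exprn_gt0// -exprVn; apply: hN => //.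
      exact: leq_trans (p'S k).
    - exact: measurable_sqr_sub.
    - by move=> x _; rewrite lee_fin sqr_ge0.
  rewrite (@nneseries_EFin_cvg _ _ 2) ?ltry//.
  have := @cvg_geometric_series R 1 2^-1.
  rewrite (_ : 1 / (1 - 2^-1) = 2); last by field.
  rewrite ger0_norm// => /(_ _)/=; rewrite invf_lt1// ltr1n.
  move=> /(_ isT); rewrite (_ : geometric 1 2^-1 = fun k => 2^-1 ^+ k)//.
  by apply/funext => k; rewrite /= mul1r.
have h0 x : (0 <= h x)%E by apply: nneseries_ge0.
pose A := [set x | (h x < +oo)%E].
have mA : measurable A.
  rewrite -[A]setTI; exact: emeasurable_fun_infty_o.
have aeA : {ae mu, forall x, A x}.
  have : mu.-integrable setT h.
    apply/integrableP; split => //; rewrite (le_lt_trans _ Ih)//.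
    by apply: ge0_le_integral_nomeas => x //; rewrite gee0_abs.
  move=> /(integrable_ae measurableT); apply: filterS => x /(_ I).
  by rewrite /A/= -ge0_fin_numE.
(* Cutting off outside [A] makes the subsequence converge at every point, hence a limit that is
   measurable on the whole space. *)
pose F' k x := F (p' k) x * \1_A x.
have cvgF' x : cvgn (F'^~ x).
  rewrite /F'; have [xA|xA] := pselect (A x); last first.
    by rewrite indicE memNset//; under eq_fun do rewrite mulr0; exact: is_cvg_cst.
  rewrite indicE mem_set//; under eq_fun do rewrite mulr1.
  have [C hC] := @nneseries_EFin_lty _ _ (fun k => term0 k x) xA.
  exact: telescope_cvg hC.
pose G x := limn (F'^~ x).
have mF' k : measurable_fun setT (F' k).
  by apply: measurable_funM => //; exact: measurable_indic.
have mG : measurable_fun setT G.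
  by apply: (@measurable_fun_cvg _ _ _ setT F') => // x _; exact: cvgF'.
have key m N0 eps : (forall n, (N0 <= n)%N -> sqdist (F m) (F n) <= eps) ->
    (\int[mu]_x ((F m x - G x) ^+ 2)%:E <= eps%:E)%E.
  move=> H.
  have -> : (\int[mu]_x ((F m x - G x) ^+ 2)%:E =
      \int[mu]_x limn_einf (fun k => ((F m x - F' k x) ^+ 2)%:E))%E.
    apply: eq_integral => x _; apply/esym.
    have /cvg_limn_einf_sup [-> _]// : ((F m x - F' k x) ^+ 2)%:E @[k --> \oo] -->
       ((F m x - G x) ^+ 2)%:E.
    apply: cvg_EFin; first exact: nearW.
    rewrite /comp/=; under eq_fun do rewrite expr2.
    by rewrite expr2; apply: cvgM; (apply: cvgB; [exact: cvg_cst|exact: cvgF']).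
  apply: le_trans (fatou _ _ _ _) _ => //.
  - by move=> k; exact: measurable_sqr_sub.
  - by move=> k x _; rewrite lee_fin sqr_ge0.
  rewrite limn_einf_lim; apply: lime_le; first exact: is_cvg_einfs.
  apply: nearW => n; apply: ereal_inf_le.
  exists (\int[mu]_x ((F m x - F' (n + N0)%N x) ^+ 2)%:E)%E.
    by exists (n + N0)%N => //=; exact: leq_addr.
  rewrite [leLHS](_ : _ = (sqdist (F m) (F (p' (n + N0)%N)))%:E).
    by rewrite lee_fin; apply: H; rewrite (leq_trans _ (kp' _))// leq_addl.
  rewrite -sqdist_integral//; apply: ge0_ae_eq_integral => //.
  - exact: measurable_sqr_sub.
  - exact: measurable_sqr_sub.
  - by move=> x _; rewrite lee_fin sqr_ge0.
  - by move=> x _; rewrite lee_fin sqr_ge0.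
  - apply: filterS aeA => x xA _.
    by rewrite /F' indicE mem_set// mulr1.
have FG2 : exists m, (fun x => F m x - G x) \in 'L2[mu].
  have [N0 hN0] := Fc 1 ltr01; exists N0; apply/L2P; split.
    exact: measurable_funB.
  apply: le_lt_trans (ltry 1); apply: (key _ N0) => n Nn; exact: hN0.
have G2 : G \in 'L2[mu].
  have [m hm] := FG2.
  rewrite (_ : G = fun x => F m x - (F m x - G x)); first exact: L2_sub.
  by apply/funext => x; ring.
exists G => //; apply/cvgrPdist_le => eps e0.
have [N0 hN0] := Fc eps e0; exists N0 => // m /= Nm.
rewrite sub0r normrN ger0_norm ?sqdist_ge0//.
rewrite -lee_fin -sqdist_integral//; apply: (key _ N0) => n Nn; exact: hN0.
Qed.

End completeness.

(** * Bessel's inequality, the Riesz-Fischer theorem and Parseval's identity *)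

Section orthonormal_families.
Context {d : measure_display} {X : measurableType d} {R : realType}.
Variable mu : {measure set X -> \bar R}.
Implicit Types f g h : X -> R.

Lemma cvg_innerl (F : nat -> X -> R) f h : (forall n, F n \in 'L2[mu]) ->
  f \in 'L2[mu] -> h \in 'L2[mu] -> sqdist mu (F n) f @[n --> \oo] --> 0 ->
  inner mu (F n) h @[n --> \oo] --> inner mu f h.
Proof.
move=> F2 f2 h2 Ff.
have sq0 : (inner mu (F n) h - inner mu f h) ^+ 2 @[n --> \oo] --> 0.
  apply: (@squeeze_cvgr _ _ _ _ (fun=> 0) (fun n => sqdist mu (F n) f * inner mu h h)).
  - apply: nearW => n; rewrite sqr_ge0/= -innerBl// cauchy_schwarz//.
    exact: L2_sub.
  - exact: cvg_cst.
  - by rewrite -(mul0r (inner mu h h)); apply: cvgMr_tmp.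
have abs0 : `|inner mu (F n) h - inner mu f h| @[n --> \oo] --> 0.
  have := cvg_comp _ _ sq0 (@sqrt_continuous R 0); rewrite sqrtr0.
  by apply: cvg_trans; apply: near_eq_cvg; apply: nearW => n /=; rewrite sqrtr_sqr.
by apply/subr_cvg0; exact: norm_cvg0.
Qed.

Lemma cvg_inner_sqr (F : nat -> X -> R) f : (forall n, F n \in 'L2[mu]) ->
  f \in 'L2[mu] -> sqdist mu (F n) f @[n --> \oo] --> 0 ->
  inner mu (F n) (F n) @[n --> \oo] --> inner mu f f.
Proof.
move=> F2 f2 Ff.
rewrite (_ : (fun n => _) = fun n =>
    sqdist mu (F n) f + (2 * inner mu (F n) f - inner mu f f)); last first.
  by apply/funext => n; rewrite /sqdist inner_sqrB//; ring.
rewrite [X in _ --> X](_ : _ = 0 + (2 * inner mu f f - inner mu f f)); last by ring.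
apply: cvgD => //; apply: cvgB; last exact: cvg_cst.
by apply: cvgMl_tmp; exact: cvg_innerl.
Qed.

Section orthonormal.
Variable e : nat -> X -> R.
Hypothesis e2 : forall i, e i \in 'L2[mu].
Hypothesis eo : forall i j, inner mu (e i) (e j) = (i == j)%:R.

Definition partial_sum (a : nat -> R) n x := \sum_(i < n) a i * e i x.

Lemma L2_partial_sum a n : partial_sum a n \in 'L2[mu].
Proof. by apply: L2_sum => i _; exact: L2_scale. Qed.

Lemma inner_partial_suml a n h : h \in 'L2[mu] ->
  inner mu (partial_sum a n) h = \sum_(i < n) a i * inner mu (e i) h.
Proof.
move=> h2; rewrite /partial_sum inner_suml//; last by move=> i; exact: L2_scale.
by apply: eq_bigr => i _; rewrite innerZl.
Qed.

Lemma inner_partial_sum_basis a n j :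
  inner mu (partial_sum a n) (e j) = if (j < n)%N then a j else 0.
Proof.
rewrite inner_partial_suml//; under eq_bigr do rewrite eo.
case: ltnP => jn.
  rewrite (bigD1 (Ordinal jn))//= eqxx mulr1 big1 ?addr0// => i /eqP ij.
  by have [ij'|] := eqVneq (i : nat) j; [exfalso; apply: ij; exact/val_inj|rewrite mulr0].
rewrite big1// => i _.
by have [ij|] := eqVneq (i : nat) j; [move: jn; rewrite -ij leqNgt ltn_ord|rewrite mulr0].
Qed.

Lemma inner_partial_sum2 a b m n : (m <= n)%N ->
  inner mu (partial_sum a m) (partial_sum b n) = \sum_(i < m) a i * b i.
Proof.
move=> mn; rewrite inner_partial_suml ?L2_partial_sum//.
apply: eq_bigr => i _.
by rewrite innerC inner_partial_sum_basis (leq_trans (ltn_ord i) mn).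
Qed.

Lemma sqdist_partial_sum f n : f \in 'L2[mu] ->
  sqdist mu f (partial_sum (fun i => inner mu f (e i)) n) =
  inner mu f f - \sum_(i < n) inner mu f (e i) ^+ 2.
Proof.
move=> f2; rewrite /sqdist inner_sqrB ?L2_partial_sum// inner_partial_sum2//.
rewrite innerC inner_partial_suml//.
under [X in 2 * X]eq_bigr do rewrite (innerC _ (e _)).
under [in RHS]eq_bigr do rewrite expr2.
by ring.
Qed.

Lemma bessel f n : f \in 'L2[mu] ->
  \sum_(i < n) inner mu f (e i) ^+ 2 <= inner mu f f.
Proof.
by move=> f2; have := sqdist_ge0 mu f (partial_sum (fun i => inner mu f (e i)) n);
  rewrite sqdist_partial_sum// subr_ge0.
Qed.

(** The squared distance between two partial sums is a difference of partial sums of the [a i ^+ 2],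
    so boundedness of the latter makes the former a Cauchy sequence. *)
Lemma riesz_fischer (a : nat -> R) (C : R) :
  (forall n, \sum_(i < n) a i ^+ 2 <= C) ->
  exists f, [/\ f \in 'L2[mu], forall j, inner mu f (e j) = a j &
    sqdist mu (partial_sum a n) f @[n --> \oo] --> 0].
Proof.
move=> aC; pose s n := \sum_(i < n) a i ^+ 2.
have s_cvg : cvgn s.
  apply: nondecreasing_is_cvgn.
    apply/nondecreasing_seqP => n; rewrite /s big_ord_recr/= lerDl.
    exact: sqr_ge0.
  by exists C => _ [n _ <-]; exact: aC.
have sqd m n : (m <= n)%N ->
    sqdist mu (partial_sum a m) (partial_sum a n) = s n - s m.
  move=> mn; rewrite /sqdist inner_sqrB ?L2_partial_sum//.
  rewrite !inner_partial_sum2// /s.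
  by under eq_bigr do rewrite -expr2;
    under [X in _ + X]eq_bigr do rewrite -expr2; ring.
have [|f f2 Sf] := L2_complete (L2_partial_sum a).
  move=> eps e0.
  have /cvgrPdist_le/(_ (eps / 2) (divr_gt0 e0 (ltr0Sn _ 1)))[N _ NP] := s_cvg.
  exists N => m n Nm Nn.
  have := NP _ Nm; have := NP _ Nn; rewrite !ler_norml => /andP[? ?] /andP[? ?].
  have [mn|/ltnW nm] := leqP m n; first by rewrite sqd//; lra.
  by rewrite sqdistC sqd//; lra.
exists f; split => // j.
have := cvg_innerl (L2_partial_sum a) f2 (e2 j) Sf.
move=> /cvg_unique; apply => //; apply: cvg_near_cst; exists j.+1 => // n /= jn.
by rewrite inner_partial_sum_basis jn.
Qed.

End orthonormal.

Section basis.
Variable e : nat -> X -> R.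
Hypothesis e_basis : orthonormal_basis mu e.

Let e2 i : e i \in 'L2[mu]. Proof. by have [+ _ _] := e_basis. Qed.
Let eo i j : inner mu (e i) (e j) = (i == j)%:R.
Proof. by have [_ + _] := e_basis. Qed.

(** Functions are not identified up to null sets, so equality in L^2 is expressed by a vanishing
    distance. *)
Lemma basis_sqdist_eq0 f g : f \in 'L2[mu] -> g \in 'L2[mu] ->
  (forall j, inner mu f (e j) = inner mu g (e j)) -> sqdist mu f g = 0.
Proof.
move=> f2 g2 fg; have [_ _ /(_ _ (L2_sub f2 g2)) H] := e_basis.
have ae0 : {ae mu, forall x, f x - g x = 0}.
  by apply: H => i; rewrite innerBl// fg subrr.
apply/EFin_inj; rewrite -sqdist_integral//.
rewrite (@ge0_ae_eq_integral _ _ _ _ _ _ (cst 0%E))// ?integral0//.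
- exact: measurable_sqr_sub (L2_measurable f2) (L2_measurable g2).
- by move=> x _; rewrite lee_fin sqr_ge0.
- by apply: filterS ae0 => x -> _; rewrite expr0n.
Qed.

(** The partial sums converge to some [g] with the same coefficients as [f] by Riesz-Fischer;
    completeness of the basis puts [g] at distance zero from [f]. *)
Lemma parseval_sqdist f : f \in 'L2[mu] ->
  sqdist mu (partial_sum e (fun i => inner mu f (e i)) n) f @[n --> \oo] --> 0.
Proof.
move=> f2; pose a i := inner mu f (e i).
have [g [g2 ga Sg]] := @riesz_fischer _ e2 eo a _ (fun n => bessel e2 eo n f2).
have fg : sqdist mu g f = 0 by apply: basis_sqdist_eq0.
rewrite [X in X @ _ --> _](_ : _ = fun n => sqdist mu (partial_sum e a n) g)//.
apply/funext => n; rewrite /sqdist !inner_sqrB ?(L2_partial_sum e2)//.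
have L2S := L2_partial_sum e2 a n.
have fg' h : h \in 'L2[mu] -> inner mu h f = inner mu h g.
  by move=> h2; rewrite !(innerC mu h) (inner_ae_eql g2 f2 h2 fg).
by rewrite !fg'// (innerC mu f g) fg'.
Qed.

Lemma parseval f g : f \in 'L2[mu] -> g \in 'L2[mu] ->
  series (fun i => inner mu f (e i) * inner mu g (e i)) @ \oo --> inner mu f g.
Proof.
move=> f2 g2; have := cvg_innerl (L2_partial_sum e2 _) f2 g2 (parseval_sqdist f2).
apply: cvg_trans; apply: near_eq_cvg; apply: nearW => n.
rewrite inner_partial_suml// seriesEord/=; apply: eq_bigr => i _.
by rewrite (innerC _ g).
Qed.

Lemma parseval_sqr f : f \in 'L2[mu] ->
  (\sum_(0 <= i <oo) (inner mu f (e i) ^+ 2)%:E)%E = (inner mu f f)%:E.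
Proof.
move=> f2; apply: nneseries_EFin_cvg; first by move=> j; exact: sqr_ge0.
by have := parseval f2 f2; under eq_fun do rewrite -expr2.
Qed.

End basis.

End orthonormal_families.

(** * One-dimensional estimates *)

Section increments.
Context {R : realType}.
Variables (W : W_function R) (f g : R -> R).
Hypothesis f_right : forall x, f @ x^'+ --> f x.
Hypothesis f_deriv : forall x, diff_quot W f x @ (0 : R)^'- --> g x.
Hypothesis g_left : forall x, g @ x^'- --> g x.
Hypothesis mg : measurable_fun setT g.

Let I (s t : R) : \bar R := (\int[dW W]_(x in `]s, t]) `|g x|%:E)%E.

Let I_ge0 s t : (0 <= I s t)%E.
Proof. by apply: integral_ge0 => x _; rewrite lee_fin. Qed.

Let mabs (D : set R) : measurable_fun D (fun x => `|g x|%:E).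
Proof.
apply/measurable_EFinP; apply: measurable_funTS.
by apply: measurableT_comp => //; exact: measurable_normr.
Qed.

Let I_split s t u : s <= t -> t <= u -> I s u = (I s t + I t u)%E.
Proof.
move=> st tu; rewrite /I -ge0_integral_setU//=.
- congr integral; apply/seteqP; split => x /=; rewrite !in_itv/=.
    by move=> /andP[-> ->]; case: (leP x t) => _; [left|right].
  move=> [] /andP[a b]; apply/andP; split => //.
  + exact: le_trans tu.
  + exact: le_lt_trans a.
- by apply/disj_setPS => x /= []; rewrite !in_itv/= => /andP[_ a] /andP[b _]; lra.
Qed.

Lemma near_left (x : R) (P : set R) : (\forall y \near x^'-, P y) ->
  exists2 r, 0 < r & forall y, x - r < y -> y < x -> P y.
Proof.
move=> [r /= r0 rP]; exists r => // y y1 y2; apply: rP => //=.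
by rewrite gtr0_norm ?subr_gt0//; lra.
Qed.

Lemma near_right (x : R) (P : set R) : (\forall y \near x^'+, P y) ->
  exists2 r, 0 < r & forall y, x < y -> y < x + r -> P y.
Proof.
move=> [r /= r0 rP]; exists r => // y y1 y2; apply: rP => //=.
by rewrite ltr0_norm ?subr_lt0//; lra.
Qed.

(** Just to the left of [x], the difference quotient and [g] are both within [eps / 2] of [g x]. The
    increment of [f] is then at most [|g x| + eps / 2] times that of [W], while [|g|] is at least
    [|g x| - eps / 2] on ]s, x]; when this last number is not positive, the term in [eps] is
    enough. *)
Let left_step (x eps : R) : 0 < x -> x < 1 -> 0 < eps ->
  exists2 r, 0 < r & forall s, 0 <= s -> x - r < s -> s < x ->
    (`|f x - f s|%:E <= I s x + (eps * (W x - W s))%:E)%E.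
Proof.
move=> x0 x1 e0; have e20 : 0 < eps / 2 by rewrite divr_gt0.
have [r1 r10 h1] := near_left ((@cvgrPdist_le _ _ _ _ _ _ _).1 (@f_deriv x) _ e20).
have [r2 r20 h2] := near_left ((@cvgrPdist_le _ _ _ _ _ _ _).1 (@g_left x) _ e20).
exists (Num.min r1 r2); first by rewrite lt_min r10.
move=> s s0 xs sx.
have Wsx : 0 < W x - W s by rewrite subr_gt0; exact: W_increasing.
have sr1 : 0 - r1 < s - x by move: xs; rewrite /Num.min; case: ifP => // ?; lra.
have sr2 : x - r2 < s by move: xs; rewrite /Num.min; case: ifP => // ?; lra.
have := h1 (s - x) sr1; rewrite subr_lt0 => /(_ sx).
rewrite /diff_quot subrKC => hd.
have fs : `|f x - f s| <= (`|g x| + eps / 2) * (W x - W s).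
  rewrite -ler_pdivrMr// -[X in _ / X](gtr0_norm Wsx) -normf_div.
  rewrite [X in `|X|](_ : _ = (f s - f x) / (W s - W x)).
    have := ler_normB (g x) (g x - (f s - f x) / (W s - W x)).
    by rewrite opprB addrC subrK => /le_trans; apply; rewrite lerD2l.
  by field; rewrite -oppr_eq0 opprB !(gt_eqF Wsx).
apply: (@le_trans _ _ ((`|g x| - eps / 2) * (W x - W s) + eps * (W x - W s))%:E).
  by rewrite lee_fin (le_trans fs)// -mulrDl ler_pM2r//; lra.
rewrite EFinD leeD2r//.
have [gx|gx] := leP `|g x| (eps / 2).
  apply: le_trans (I_ge0 _ _); rewrite lee_fin pmulr_lle0//; lra.
rewrite /I EFinM -dW_oc// ?(ltW sx)// -(integral_cst (dW W)); last exact: measurable_itv.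
apply: ge0_le_integral => //.
- by move=> y _; rewrite lee_fin; lra.
- move=> y /=; rewrite in_itv/= => /andP[sy]; rewrite le_eqVlt => /orP[/eqP->|yx].
    by rewrite lee_fin; lra.
  have := h2 y (lt_trans sr2 sy) yx; rewrite lee_fin.
  have := ler_distD 0 (g x) (g y); rewrite subr0 sub0r normrN.
  by have := lerB_dist (g x) (g y); lra.
Qed.

(* The infimum of the points s for which the estimate holds on ]s, b] up to
   [eps * (W b - W s)] satisfies it by right continuity of [f], and cannot
   exceed [a] because [left_step] moves it further to the left. *)
Lemma increment_le (a b : R) : 0 <= a -> a <= b -> b < 1 ->
  (`|f b - f a|%:E <= \int[dW W]_(x in `]a, b]) `|g x|%:E)%E.
Proof.
move=> a0 ab b1; rewrite -/(I a b).
have [Ifin|Ioo] := boolP (I a b \is a fin_num); last first.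
  by move: Ioo; rewrite ge0_fin_numE// -leNgt leye_eq => /eqP ->; rewrite leey.
apply/lee_addgt0Pr => eps' e'0.
have M0 : 0 < W b - W a + 1 by rewrite ltr_wpDl// subr_ge0 W_nondecreasing.
(* The errors add up to [eps * (W b - W a)], which stays below [eps']; the [+ 1] covers the case of
   a zero increment. *)
pose eps := eps' / (W b - W a + 1).
have e0 : 0 < eps by rewrite divr_gt0.
apply: (@le_trans _ _ (I a b + (eps * (W b - W a))%:E)%E); last first.
  rewrite leeD2l// lee_fin /eps mulrAC ler_pdivrMr// ler_pM2l//; lra.
pose P s := (`|f b - f s|%:E <= I s b + (eps * (W b - W s))%:E)%E.
pose S := [set s | [/\ a <= s, s <= b & P s]].
have bS : S b.
  split => //; rewrite /P subrr normr0 adde_ge0//.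
  by rewrite subrr mulr0.
have S_lb : lbound S a by move=> s [].
have hS : has_inf S by split; [exists b | exists a].
pose t := inf S.
have at_ : a <= t by apply: lb_le_inf => //; exists b.
have tb : t <= b by apply: ge_inf => //; exists a.
have St : S t.
  split => //; rewrite /P.
  apply/lee_addgt0Pr => eta eta0.
  have [r r0 hr] := near_right ((@cvgrPdist_le _ _ _ _ _ _ _).1 (@f_right t) _ eta0).
  have [s [as_ sb Ps] st] := inf_adherent r0 hS.
  have ts : t <= s by apply: ge_inf => //; exists a.
  have fts : `|f t - f s| <= eta.
    move: ts; rewrite le_eqVlt => /orP[/eqP <-|ts]; last exact: hr.
    by rewrite subrr normr0 ltW.
  apply: (@le_trans _ _ (`|f b - f s|%:E + eta%:E)%E).
    rewrite -EFinD lee_fin (le_trans (ler_distD (f s) _ _))// lerD2l.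
    by rewrite distrC.
  rewrite leeD2r// (le_trans Ps)// leeD//.
    by rewrite (I_split ts sb) leeDr.
  by rewrite lee_fin ler_pM2l// lerD2l lerN2 W_nondecreasing.
move: at_; rewrite le_eqVlt => /orP[/eqP ->|at_]; first by case: St.
exfalso.
have t0 : 0 < t by lra.
have [r r0 hr] := left_step t0 (le_lt_trans tb b1) e0.
pose s := Num.max a (t - r / 2).
have as_ : a <= s by rewrite le_max lexx.
have st : s < t by rewrite gt_max at_/=; lra.
have rs : t - r < s by rewrite lt_max; apply/orP; right; lra.
have s0 : 0 <= s by exact: le_trans as_.
have Ss : S s.
  split => //; first by rewrite (le_trans (ltW st)).
  rewrite /P (I_split (ltW st) tb).
  apply: (@le_trans _ _ (`|f b - f t|%:E + `|f t - f s|%:E)%E).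
    by rewrite -EFinD lee_fin; exact: ler_distD.
  have [_ _ Pt] := St.
  apply: le_trans (leeD Pt (hr s s0 rs st)) _.
  rewrite addeACA -EFinD -mulrDr (_ : W b - W t + (W t - W s) = W b - W s); last by ring.
  by rewrite leeD2r// addeC.
have : t <= s by apply: ge_inf => //; exists a.
by rewrite leNgt st.
Qed.

(** Cauchy-Schwarz, derived from Young's inequality because the integral of [g ^+ 2] may be
    infinite. *)
Lemma sqr_increment_le (a b : R) : 0 <= a -> a <= b -> b < 1 ->
  (((f b - f a) ^+ 2)%:E <=
   (W b - W a)%:E * \int[dW W]_(x in `]a, b]) ((g x) ^+ 2)%:E)%E.
Proof.
move=> a0 ab b1; set J := integral _ _ _.
have J0 : (0 <= J)%E by apply: integral_ge0 => x _; rewrite lee_fin sqr_ge0.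
have W0 : 0 <= W b - W a by rewrite subr_ge0 W_nondecreasing.
move: (ab); rewrite le_eqVlt => /orP[/eqP <-|ab'].
  by rewrite !subrr expr0n/= mul0e.
have W1 : 0 < W b - W a by rewrite subr_gt0 W_increasing.
have [A0|A0] := eqVneq (f b - f a) 0.
  by rewrite A0 expr0n/= mule_ge0.
have A1 : 0 < `|f b - f a| by rewrite normr_gt0.
rewrite -real_normK ?num_real//; set A := `|f b - f a| in A1 *.
(* In [|g| <= l / 2 * g ^+ 2 + 1 / (2 * l)] this weight makes the constant term integrate to
   [A / 2], half of the quantity to be bounded. *)
pose l := (W b - W a) / A.
have l0 : 0 < l by rewrite divr_gt0.
have : (A%:E <= (l / 2)%:E * J + (A / 2)%:E)%E.
  apply: le_trans (increment_le a0 ab b1) _.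
  have -> : ((A / 2)%:E = \int[dW W]_(x in `]a, b]) (cst (1 / (2 * l))%:E x))%E.
    rewrite (integral_cst (dW W)); last exact: measurable_itv.
    rewrite [X in (_ * X)%E](dW_oc W a0 ab b1) -EFinM; congr EFin.
    by rewrite /l; field; rewrite !gt_eqF.
  have mg2 : measurable_fun `]a, b]%classic (fun x => ((g x) ^+ 2)%:E).
    by apply/measurable_EFinP; apply: measurable_funX; exact: measurable_funTS.
  rewrite -ge0_integralZl//; last 2 first.
  - by move=> x _; rewrite lee_fin sqr_ge0.
  - by rewrite lee_fin ltW// divr_gt0.
  rewrite -ge0_integralD//.
  - apply: ge0_le_integral => //.
    + by apply: emeasurable_funD => //; exact: measurable_funeM.
    + move=> x _; rewrite -EFinM -EFinD lee_fin -(real_normK (num_real (g x))).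
      set b' := `|g x|; rewrite -subr_ge0.
      have -> : l / 2 * b' ^+ 2 + 1 / (2 * l) - b' = l / 2 * (b' - l^-1) ^+ 2.
        by field; rewrite gt_eqF.
      by rewrite mulr_ge0 ?sqr_ge0// ltW// divr_gt0.
  - by move=> x _; rewrite -EFinM lee_fin mulr_ge0 ?sqr_ge0// ltW// divr_gt0.
  - exact: measurable_funeM.
  - by move=> x _; rewrite lee_fin ltW// divr_gt0// mulr_gt0.
case: J J0 => [J J0|_|//]; last by move=> _; rewrite gt0_muley ?lte_fin// leey.
rewrite -!EFinM -EFinD !lee_fin /l => H.
have : A / 2 <= (W b - W a) / A / 2 * J by lra.
rewrite (_ : _ * J = (W b - W a) * J / A / 2); last by field; rewrite gt_eqF.
by rewrite ler_pM2r// ler_pdivlMr.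
Qed.

End increments.

(** * A partition of the circle adapted to W and V *)

Section interval_partition.
Context {R : realType}.
Variables (W : W_function R) (V : V_function R).

Lemma W_ge0 x : 0 <= x -> 0 <= W x.
Proof. by move=> x0; rewrite -(W_at0 W) W_nondecreasing. Qed.

Lemma V_nondecreasing x y : x <= y -> V x <= V y.
Proof. exact: (ltW_homo (@V_increasing _ V)). Qed.

Lemma V_ge0 x : 0 <= x -> 0 <= V x.
Proof. by move=> x0; rewrite -(V_at0 V) V_nondecreasing. Qed.

(** Let [b] be the supremum of [J]. Points of [I] have a successor in [J], so [I] lies strictly
    below [b] and an atom of [V] at [b] is not counted; left continuity of [V] extends the bound on
    increments up to [b]. If [I] contains its infimum [a], it is covered by [a, b[. Otherwise the
    atom at [a] must be left out as well, and ]a, b[ is exhausted by the intervals [F n], each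
    contained in some [s, b[ with [s] in [I]. *)
Lemma dV_le (I J : set R) (delta : R) : measurable I ->
  I `<=` J -> (forall x, J x -> 0 <= x < 1) ->
  (forall x, I x -> exists2 y, J y & x < y) ->
  (forall s t, J s -> J t -> s <= t -> V t - V s <= delta) -> 0 <= delta ->
  (dV V I <= delta%:E)%E.
Proof.
move=> mI IJ J01 Inext Jd d0.
have [->|I0] := eqVneq I set0; first by rewrite measure0 lee_fin.
have /set0P[x0 Ix0] := I0.
have J0 : J !=set0 by exists x0; exact: IJ.
have Jb : has_sup J.
  by split => //; exists 1 => x /J01 /andP[_ /ltW].
pose b := sup J.
have Jle x : J x -> x <= b by move=> Jx; apply: ub_le_sup => //; case: Jb.
have b1 : b <= 1 by apply: ge_sup => // x /J01 /andP[_ /ltW].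
have Ilt x : I x -> x < b.
  by move=> /Inext[y Jy xy]; rewrite (lt_le_trans xy)// Jle.
have Isb s : I s -> V b - V s <= delta.
  move=> Is; have [Jbb|nJb] := pselect (J b).
    by apply: Jd => //; [exact: IJ|exact/ltW/Ilt].
  apply/ler_addgt0Pr => eps e0.
  have [+ _] := V_caglad V b => /cvgrPdist_le /(_ _ e0) /near_left[r r0 hr].
  have [t Jt tb] := sup_adherent r0 Jb.
  have tltb : t < b.
    by rewrite lt_neqAle Jle// andbT; apply/eqP => tb'; apply: nJb; rewrite -tb'.
  have := hr t tb tltb => /(le_trans (ler_norm _)) h1.
  have [st|ts] := leP s t.
    by have := Jd s t (IJ _ Is) Jt st; lra.
  have := V_nondecreasing (ltW ts); have := ler_norm (V b - V t); lra.
have mco s t : measurable (`[s, t[%classic : set R) by exact: measurable_itv.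
have Iab s : I s -> (dV V `[s, b[%classic <= delta%:E)%E.
  move=> Is; have /J01/andP[s0 _] := IJ _ Is.
  by rewrite dV_co//; [rewrite lee_fin Isb|exact/ltW/Ilt].
have Iinf : has_inf I.
  by split; [exists x0|exists 0 => x /IJ/J01/andP[]].
pose a := inf I.
have Ige x : I x -> a <= x by move=> Ix; apply: ge_inf => //; case: Iinf.
have [Ia|nIa] := pselect (I a).
  apply: le_trans (Iab a Ia); apply: le_measure; rewrite ?inE//.
  by move=> x Ix; rewrite /= in_itv/= Ige// Ilt.
pose F (n : nat) : set R := `[a + n.+1%:R^-1, b[%classic.
have F_le n : (dV V (F n) <= delta%:E)%E.
  have n0 : 0 < n.+1%:R^-1 :> R by rewrite invr_gt0.
  have [s Is sa] := inf_adherent n0 Iinf.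
  apply: le_trans (Iab s Is); apply: le_measure; rewrite ?inE//; first exact: mco.
  by move=> x; rewrite /F/= !in_itv/= => /andP[h ->]; rewrite andbT (le_trans (ltW sa)).
have F_cvg : dV V (F n) @[n --> \oo] --> dV V (\bigcup_n F n).
  apply: nondecreasing_cvg_mu.
  - by move=> n; exact: mco.
  - by apply: bigcup_measurable => n _; exact: mco.
  - move=> n m nm; apply/subsetPset => x; rewrite /F/= !in_itv/= => /andP[h ->].
    rewrite andbT (le_trans _ h)// lerD2l lef_pV2 ?posrE//.
    by rewrite ler_nat.
apply: (@le_trans _ _ (dV V (\bigcup_n F n))).
  apply: le_measure; rewrite ?inE//.
    by apply: bigcup_measurable => n _; exact: mco.
  move=> x Ix; have ax : a < x.
    by rewrite lt_neqAle Ige// andbT; apply/eqP => ax; apply: nIa; rewrite ax.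
  have xa : 0 < x - a by rewrite subr_gt0.
  have [r] : exists n : nat, n.+1%:R^-1 < x - a.
    exists (Num.truncn (x - a)^-1); rewrite invf_plt ?posrE//.
    exact: truncnS_gt.
  by move=> hr; exists r => //; rewrite /F/= in_itv/= Ilt// andbT -lerBrDl ltW.
rewrite -(cvg_lim _ F_cvg)//; apply: lime_le; first by apply/cvg_ex; eexists; exact: F_cvg.
exact: nearW.
Qed.

Variable m' : nat.
Let m := m'.+1.
Let M := W 1 + V 1.

(** The values of [W + V] on [0, 1[ are rescaled to [0, m[ and rounded down. On a level set both
    functions vary little, being nondecreasing; a large jump only leaves some levels empty. *)
Definition label x : nat := Num.truncn (m%:R * (W x + V x) / M).

Let M0 : 0 < M.
Proof.
have := @W_increasing _ W 0 1 ltr01; have := @V_increasing _ V 0 1 ltr01.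
by rewrite W_at0 V_at0 /M; lra.
Qed.

Let arg_ge0 x : 0 <= x -> 0 <= m%:R * (W x + V x) / M.
Proof.
move=> x0; apply: divr_ge0; last exact: ltW.
by rewrite mulr_ge0// addr_ge0 ?W_ge0 ?V_ge0.
Qed.

Lemma label_lt x : 0 <= x < 1 -> (label x < m)%N.
Proof.
move=> /andP[x0 x1]; rewrite /label truncn_lt_nat ?arg_ge0//.
rewrite ltr_pdivrMr// ltr_pM2l ?ltr0n//.
by rewrite ltrD// ?W_increasing ?V_increasing.
Qed.

Lemma label_homo x y : x <= y -> (label x <= label y)%N.
Proof.
move=> xy; apply: le_truncn; rewrite ler_pM2r ?invr_gt0// ler_pM2l ?ltr0n//.
by rewrite lerD// ?W_nondecreasing ?V_nondecreasing.
Qed.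

Lemma label_eq_close s t : 0 <= s -> s <= t -> label s = label t ->
  W t - W s + (V t - V s) <= M / m%:R.
Proof.
move=> s0 st lst.
have := truncn_itv (arg_ge0 s0) => /andP[h1 _].
have := truncn_itv (arg_ge0 (le_trans s0 st)) => /andP[_ h2].
have m0 : 0 < m%:R :> R by rewrite ltr0n.
rewrite ler_pdivlMr//.
have : m%:R * (W t + V t) / M < m%:R * (W s + V s) / M + 1.
  by rewrite (lt_le_trans h2)// -[X in X <= _]natr1 lerD2r; move: h1; rewrite -/(label s) lst.
rewrite -(ltr_pM2r M0) mulrDl !divfK ?gt_eqF//; lra.
Qed.

Definition pre_piece (l : nat) : set R := [set x | 0 <= x < 1 /\ label x = l].

(* The maximum of a level set of [label], if any, is isolated: an atom of [V]
   at that point is not controlled by the increments of [V]. *)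
Definition piece_of x : 'I_m * bool :=
  (inord (label x), `[< exists2 y, pre_piece (label x) y & x < y >]).

Definition piece c : set R := [set x | 0 <= x < 1 /\ piece_of x = c].

Let pieceP c x : piece c x ->
  [/\ 0 <= x < 1, label x = c.1 & (exists2 y, pre_piece c.1 y & x < y) <-> c.2].
Proof.
move=> [x01 <-] /=; have lx := label_lt x01.
split => //; first by rewrite inordK.
by rewrite inordK//; split => /asboolP.
Qed.

(** A level set is an interval. It remains one when its maximum is taken away, and the maximum forms
    an interval by itself. *)
Lemma piece_interval c : is_interval (piece c).
Proof.
move=> x z /[dup] px /pieceP[/andP[x0 x1] lx cx] /pieceP[/andP[z0 z1] lz cz] y.
move=> /andP[xy yz].
have ly : label y = c.1.
  by apply/eqP; rewrite eqn_leq -{1}lz -lx !label_homo.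
have y01 : 0 <= y < 1 by rewrite (le_trans x0)// (le_lt_trans yz).
have [c2|c2] := boolP c.2.
  split => //; case: c cx cz lx ly lz px c2 => l b /= cx cz lx ly lz px b1.
  rewrite /piece_of ly; congr pair.
    by apply: val_inj; rewrite /= inordK.
  rewrite b1; apply/asboolP; have [u Hu zu] := cz.2 b1.
  by exists u => //; exact: le_lt_trans zu.
suff -> : y = x by [].
apply/eqP; rewrite eq_le xy andbT leNgt; apply: contra c2 => xy'; apply/cx.1.
by exists y.
Qed.

Lemma measurable_piece c : measurable (piece c).
Proof. by apply: is_interval_measurable; exact: piece_interval. Qed.

(** On an isolated maximum [w] is zero, and the mass of the point, however large, is multiplied by
    zero. On the other pieces the increment and the mass are each at most [M / m%:R]. *)
Lemma piece_small c : exists2 w : R, 0 <= w &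
  (forall s t, piece c s -> piece c t -> s <= t -> W t - W s <= w) /\
  (w%:E * dV V (piece c) <= ((M / m%:R) ^+ 2)%:E)%E.
Proof.
have delta0 : 0 <= M / m%:R by rewrite divr_ge0 ?ltW.
have [c2|c2] := boolP c.2; last first.
  exists 0 => //; split; last by rewrite mul0e lee_fin sqr_ge0.
  move=> s t ps pt st; have [_ _ cs] := pieceP ps; have [t01 lt _] := pieceP pt.
  suff -> : t = s by rewrite subrr.
  apply/eqP; rewrite eq_le st andbT leNgt; apply: contra c2 => st'.
  by apply/cs.1; exists t.
have close s t : pre_piece c.1 s -> pre_piece c.1 t -> s <= t ->
    W t - W s + (V t - V s) <= M / m%:R.
  move=> [/andP[s0 _] ls] [_ lt] st; apply: label_eq_close => //.
  by rewrite ls lt.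
exists (M / m%:R) => //; split.
  move=> s t /pieceP[s01 ls _] /pieceP[t01 lt _] st.
  have := close s t (conj s01 ls) (conj t01 lt) st.
  by have := V_nondecreasing st; lra.
rewrite expr2 (EFinM (M / _) (M / _)) lee_wpmul2l ?lee_fin//.
apply: (@dV_le _ (pre_piece c.1)) => //.
- exact: measurable_piece.
- by move=> x /pieceP[].
- by move=> x [].
- by move=> x /pieceP[_ _ cx]; exact: cx.2.
- move=> s t ps pt st; have := close s t ps pt st.
  by have := W_nondecreasing W st; lra.
Qed.

End interval_partition.

(** * Poincare inequality on boxes *)

Section tonelli_on_sets.
Local Open Scope ereal_scope.
Context {d1 d2 : measure_display} {T1 : measurableType d1}
  {T2 : measurableType d2} {R : realType}.
Variables (m1 : {finite_measure set T1 -> \bar R})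
  (m2 : {finite_measure set T2 -> \bar R}).
Variables (A : set T1) (B : set T2) (f : T1 * T2 -> \bar R).
Hypotheses (mA : measurable A) (mB : measurable B).
Hypotheses (mf : measurable_fun setT f) (f0 : forall p, 0 <= f p).

Let fA := f \_ (A `*` [set: T2]).
Let fB := f \_ ([set: T1] `*` B).

Let mfB : measurable_fun setT fB.
Proof.
apply/(measurable_restrictT _ _).1; last exact: measurable_funTS.
exact: measurableX.
Qed.

Let mfA : measurable_fun setT fA.
Proof.
apply/(measurable_restrictT _ _).1; last exact: measurable_funTS.
exact: measurableX.
Qed.

Let fA0 p : 0 <= fA p. Proof. by rewrite /fA/= /patch; case: ifP. Qed.
Let fB0 p : 0 <= fB p. Proof. by rewrite /fB/= /patch; case: ifP. Qed.

Lemma measurable_integral_snd :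
  measurable_fun setT (fun x => \int[m2]_(y in B) f (x, y)).
Proof.
rewrite (_ : (fun x => _) = fubini_F m2 fB).
  exact: measurable_fun_fubini_tonelli_F.
apply/funext => x; rewrite integral_mkcond; apply: eq_integral => y _.
rewrite /fB /patch; case: ifPn => yB; case: ifPn => //; rewrite !inE/= in yB *.
- by move=> /negP; rewrite inE/=; case.
- by rewrite notin_setE in yB; case.
Qed.

Lemma measurable_integral_fst :
  measurable_fun setT (fun y => \int[m1]_(x in A) f (x, y)).
Proof.
rewrite (_ : (fun x => _) = fubini_G m1 fA).
  exact: measurable_fun_fubini_tonelli_G.
apply/funext => y; rewrite integral_mkcond; apply: eq_integral => x _.
rewrite /fA /patch; case: ifPn => xA; case: ifPn => //; rewrite !inE/= in xA *.
- by move=> /negP; rewrite inE/=; case.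
- by rewrite notin_setE in xA; case.
Qed.

Lemma tonelli_set :
  \int[m1]_(x in A) \int[m2]_(y in B) f (x, y) =
  \int[m2]_(y in B) \int[m1]_(x in A) f (x, y).
Proof.
pose g := f \_ (A `*` B).
have mg : measurable_fun setT g.
  apply/(measurable_restrictT _ _).1; last exact: measurable_funTS.
  exact: measurableX.
have g0 p : 0 <= g p by rewrite /g/= /patch; case: ifP.
transitivity (\int[m1]_x \int[m2]_y g (x, y)).
  rewrite integral_mkcond; apply: eq_integral => x _; rewrite /patch.
  case: ifPn => xA; last first.
    rewrite integral0_eq// => y _; rewrite /g /patch ifN// notin_setE/=.
    by move=> [] /mem_set; rewrite (negbTE xA).
  rewrite integral_mkcond; apply: eq_integral => y _; rewrite /g /patch.
  case: ifPn => yB.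
    by rewrite ifT// inE/=; split; exact: set_mem.
  by rewrite ifN// notin_setE/= => -[_ /mem_set]; rewrite (negbTE yB).
rewrite fubini_tonelli//; apply/esym.
rewrite integral_mkcond; apply: eq_integral => y _; rewrite /patch.
case: ifPn => yB; last first.
  rewrite integral0_eq// => x _; rewrite /g /patch ifN// notin_setE/=.
  by move=> [] _ /mem_set; rewrite (negbTE yB).
rewrite integral_mkcond; apply: eq_integral => x _; rewrite /g /patch.
case: ifPn => xA.
  by rewrite ifT// inE/=; split; exact: set_mem.
by rewrite ifN// notin_setE/= => -[/mem_set]; rewrite (negbTE xA).
Qed.

End tonelli_on_sets.

Lemma ge0_le_integral_set_nomeas d {X : measurableType d} {R : realType}
    (mu : {measure set X -> \bar R}) (D : set X) (f g : X -> \bar R) :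
  (forall x, D x -> 0 <= f x)%E -> (forall x, D x -> f x <= g x)%E ->
  (\int[mu]_(x in D) f x <= \int[mu]_(x in D) g x)%E.
Proof.
move=> f0 fg; rewrite integral_mkcond [leRHS]integral_mkcond.
apply: ge0_le_integral_nomeas => x; rewrite /patch.
  by case: ifPn => // /set_mem; exact: f0.
by case: ifPn => // /set_mem; exact: fg.
Qed.

Section boxes.
Context {R : realType}.

Definition box n (A : 'I_n -> set R) : set (n.-tuple R) :=
  [set x | forall i, A i (tnth x i)].

Lemma measurable_box n (A : 'I_n -> set R) : (forall i, measurable (A i)) ->
  measurable (box A).
Proof.
move=> mA; rewrite (_ : box A =
    \bigcap_(i in [set: 'I_n]) ((fun x => tnth x i) @^-1` A i)); last first.
  by apply/seteqP; split=> x /= Ax i => [_|]; exact: Ax.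
apply: fin_bigcap_measurable => // i _.
by rewrite -[X in measurable X]setTI; exact: measurable_tnth.
Qed.

Lemma box_tcons n (A : 'I_n.+1 -> set R) a x :
  box A (tcons (a, x)) <-> A ord0 a /\ box (fun i => A (lift ord0 i)) x.
Proof.
split=> [Aax|[Aa Ax] i].
  by split=> [|i]; [exact: (Aax ord0)|have := Aax (lift ord0 i); rewrite tnthS].
by case: (unliftP ord0 i) => [j ->|->]; rewrite ?tnthS//; exact: Ax.
Qed.

Lemma upd_tcons0 n (a t : R) (x : n.-tuple R) :
  upd (tcons (a, x)) ord0 t = tcons (t, x).
Proof.
apply: eq_from_tnth => i; rewrite /upd tnth_mktuple.
by case: (unliftP ord0 i) => [j ->|->]//=; rewrite !tnthS.
Qed.

Lemma upd_tcons_lift n (a t : R) (x : n.-tuple R) k :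
  upd (tcons (a, x)) (lift ord0 k) t = tcons (a, upd x k t).
Proof.
apply: eq_from_tnth => i; rewrite /upd tnth_mktuple.
case: (unliftP ord0 i) => [j ->|->]//=.
by rewrite !tnthS tnth_mktuple (inj_eq lift_inj).
Qed.

Lemma integral_cons_box n (m1 : {finite_measure set R -> \bar R})
    (m2 : {finite_measure set (n.-tuple R) -> \bar R})
    (A : 'I_n.+1 -> set R) (F : n.+1.-tuple R -> \bar R) :
  (forall i, measurable (A i)) ->
  measurable_fun setT F -> (forall x, 0 <= F x)%E ->
  (\int[cons_measure m1 m2]_(x in box A) F x =
   \int[m1]_(a in A ord0) \int[m2]_(x in box (fun i => A (lift ord0 i)))
      F (tcons (a, x)))%E.
Proof.
move=> mA mF F0; rewrite integral_mkcond.
have mG : measurable_fun setT (F \_ (box A)).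
  apply/(measurable_restrictT _ _).1; last exact: measurable_funTS.
  exact: measurable_box.
have G0 x : (0 <= (F \_ (box A)) x)%E by rewrite /patch; case: ifP.
rewrite (ge0_integral_pushforward (@measurable_tcons R n))//=.
rewrite preimage_setT fubini_tonelli1//=; last first.
  by apply: measurableT_comp => //; exact: measurable_tcons.
rewrite [RHS]integral_mkcond; apply: eq_integral => a _.
rewrite /fubini_F/= /patch; case: ifPn => aA; last first.
  rewrite integral0_eq// => x _; rewrite ifN// notin_setE => /box_tcons[/mem_set].
  by rewrite (negbTE aA).
rewrite [RHS]integral_mkcond; apply: eq_integral => x _; rewrite /patch.
case: ifPn => xA.
  by rewrite ifT//; move/set_mem/box_tcons: xA => [_ /mem_set].
rewrite ifN//; apply: contra xA => /set_mem xA; rewrite inE.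
by apply/box_tcons; split => //; exact: set_mem.
Qed.

Lemma mixed_measureS n (mu nu : 'I_n.+1 -> {finite_measure set R -> \bar R}) k :
  mixed_measure nu mu (lift ord0 k) =
  cons_measure (mu ord0) (mixed_measure (fun i => nu (lift ord0 i))
    (fun i => mu (lift ord0 i)) k) :> (set _ -> \bar R).
Proof.
rewrite /mixed_measure /=; congr (cons_measure _ (prod_measure _)).
Qed.

End boxes.

Section box_poincare.
Context {R : realType}.

Local Lemma measurable_tconsr n (a : R) :
  measurable_fun setT (fun x : n.-tuple R => tcons (a, x)).
Proof.
by apply: (@measurable_cons _ _ _ _ (cst a) n id);
  [exact: measurable_cst|exact: measurable_id].
Qed.

Local Lemma ge0_integral_affine d (T : measurableType d)
    (mu : {finite_measure set T -> \bar R}) (D : set T) (k : R) (u : \bar R)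
    (f : T -> \bar R) : measurable D -> measurable_fun setT f ->
  (forall x, 0 <= f x)%E -> (0 <= u)%E -> 0 <= k ->
  (\int[mu]_(x in D) (u + k%:E * f x) =
   (fine (mu D))%:E * u + k%:E * \int[mu]_(x in D) f x)%E.
Proof.
move=> mD mf f0 u0 k0.
have mf' := @measurable_funTS _ _ _ _ D _ mf.
rewrite ge0_integralD//; last 2 first.
- by move=> x _; rewrite mule_ge0// lee_fin.
- exact: measurable_funeM.
rewrite ge0_integralZl// fineK ?fin_num_measure// [X in _ = (X + _)%E]muleC.
by have -> : (\int[mu]_(x in D) u = u * mu D)%E by exact: integral_cst.
Qed.

(** By induction on the dimension: the path from (a, x) to (b, y) goes through (b, x), and (s + t)^2
    <= 2 s^2 + 2 t^2 costs a factor 2 per coordinate, whence [2 ^+ n]. The first move is bounded by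
    the hypothesis on [F], the second by the induction hypothesis for the slice at [b]. The
    oscillation factor [w k] and the mass of [A k] are bounded only through their product, as this
    is all that a piece reduced to a point provides. *)
Lemma box_poincare n (mu nu : 'I_n -> {finite_measure set R -> \bar R})
    (A : 'I_n -> set R) (F : n.-tuple R -> R) (g : 'I_n -> n.-tuple R -> R)
    (w : 'I_n -> R) (c : R) :
  (forall i, measurable (A i)) -> measurable_fun setT F ->
  (forall k, measurable_fun setT (g k)) -> 0 <= c -> (forall k, 0 <= w k) ->
  (forall k, (w k)%:E * mu k (A k) <= c%:E)%E ->
  (forall k x s t, A k s -> A k t ->
    ((F (upd x k s) - F (upd x k t)) ^+ 2)%:E <=
    (w k)%:E * \int[nu k]_(r in A k) (g k (upd x k r) ^+ 2)%:E)%E ->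
  (\int[prod_measure mu]_(x in box A) \int[prod_measure mu]_(y in box A)
      ((F x - F y) ^+ 2)%:E <=
   (2 ^+ n * c * fine (prod_measure mu (box A)))%:E *
   \sum_(k < n) \int[mixed_measure nu mu k]_(x in box A) (g k x ^+ 2)%:E)%E.
Proof.
elim: n => [|n IH] in mu nu A F g w *.
  move=> mA mF mg c0 w0 wc Fg; rewrite big_ord0 mule0.
  rewrite integral0_eq// => x _; rewrite integral0_eq// => y _.
  by rewrite (tuple0 x) (tuple0 y) subrr expr0n.
move=> mA mF mg c0 w0 wc Fg.
pose A' i := A (lift ord0 i); pose mu' i := mu (lift ord0 i).
pose nu' i := nu (lift ord0 i).
pose m2 := prod_measure mu'; pose Q := box A'.
have mQ : measurable Q by apply: measurable_box => i; exact: mA.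
pose p := fine (mu ord0 (A ord0)); pose q := fine (m2 Q).
have p0 : 0 <= p by exact: fine_ge0.
have q0 : 0 <= q by exact: fine_ge0.
pose J k := (\int[mixed_measure nu mu k]_(x in box A) (g k x ^+ 2)%:E)%E.
have J0 k : (0 <= J k)%E by apply: integral_ge0 => x _; rewrite lee_fin sqr_ge0.
have mgsq k : measurable_fun setT (fun x => (g k x ^+ 2)%:E).
  by apply/measurable_EFinP; exact: measurable_funX.
have pq : fine (prod_measure mu (box A)) = p * q.
  rewrite /p /q -fineM ?fin_num_measure//.
  rewrite /m2 /Q /box !prod_measureE//; last by move=> i; exact: mA.
  by rewrite big_ord_recl.
pose Phi z := (\int[prod_measure mu]_(y in box A) ((F z - F y) ^+ 2)%:E)%E.
have mFF : measurable_fun setT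
    (fun z : n.+1.-tuple R * n.+1.-tuple R => ((F z.1 - F z.2) ^+ 2)%:E).
  apply/measurable_EFinP; apply: measurable_funX; apply: measurable_funB.
    exact: measurableT_comp.
  exact: measurableT_comp.
have mPhi : measurable_fun setT Phi.
  apply: (@measurable_integral_snd _ _ _ _ _ _ _
    (fun z => ((F z.1 - F z.2) ^+ 2)%:E)) => //.
  - exact: measurable_box.
  - by move=> z; rewrite lee_fin sqr_ge0.
have Phi0 z : (0 <= Phi z)%E by apply: integral_ge0 => y _; rewrite lee_fin sqr_ge0.
(* [K (b, x) y] is the squared increment from (b, x) to (b, y), [L] its integral over [y], and [M]
   the integral of [L] over [b]; [G x] below is the energy in the first coordinate along the line
   through [x]. *)
pose K (bx : R * n.-tuple R) y := ((F (tcons bx) - F (tcons (bx.1, y))) ^+ 2)%:E.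
have mK : measurable_fun setT (fun z => K z.1 z.2).
  apply/measurable_EFinP; apply: measurable_funX; apply: measurable_funB.
    apply: measurableT_comp => //; apply: measurableT_comp => //.
    exact: measurable_tcons.
  apply: measurableT_comp => //; apply: measurable_cons.
    exact: (measurableT_comp measurable_fst measurable_fst).
  exact: measurable_snd.
have K0 z y : (0 <= K z y)%E by rewrite lee_fin sqr_ge0.
pose L bx := (\int[m2]_(y in Q) K bx y)%E.
have mL : measurable_fun setT L.
  by apply: (@measurable_integral_snd _ _ _ _ _ _ _ (fun z => K z.1 z.2)).
have L0 z : (0 <= L z)%E by apply: integral_ge0.
pose M x := (\int[mu ord0]_(b in A ord0) L (b, x))%E.
have mM : measurable_fun setT M by apply: measurable_integral_fst.
have M0 x : (0 <= M x)%E by apply: integral_ge0.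
pose G x := (\int[nu ord0]_(r in A ord0) (g ord0 (tcons (r, x)) ^+ 2)%:E)%E.
have mg0 : measurable_fun setT (fun z => (g ord0 (tcons z) ^+ 2)%:E).
  apply/measurable_EFinP; apply: measurable_funX; apply: measurableT_comp => //.
  exact: measurable_tcons.
have mG : measurable_fun setT G.
  apply: (@measurable_integral_fst _ _ _ _ _ _ _ (fun z => (g ord0 (tcons z) ^+ 2)%:E)) => //.
  by move=> z; rewrite lee_fin sqr_ge0.
have G0 x : (0 <= G x)%E by apply: integral_ge0 => r _; rewrite lee_fin sqr_ge0.
have Phi_le a x : A ord0 a ->
    (Phi (tcons (a, x)) <= (2 * w ord0 * q * p)%:E * G x + 2%:E * M x)%E.
  move=> Aa; rewrite /Phi integral_cons_box//; last 2 first.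
  - apply/measurable_EFinP; apply: measurable_funX; apply: measurable_funB => //.
  - by move=> z; rewrite lee_fin sqr_ge0.
  pose u := ((2 * w ord0)%:E * G x)%E.
  have u0 : (0 <= u)%E by rewrite mule_ge0// lee_fin mulr_ge0.
  apply: (@le_trans _ _ (\int[mu ord0]_(b in A ord0) (q%:E * u + 2%:E * L (b, x)))%E).
    apply: ge0_le_integral_set_nomeas => b Ab.
      by apply: integral_ge0 => y _; rewrite lee_fin sqr_ge0.
    rewrite -ge0_integral_affine//.
      apply: ge0_le_integral_set_nomeas => y Qy; first by rewrite lee_fin sqr_ge0.
      have := Fg ord0 (tcons (a, x)) a b Aa Ab; rewrite !upd_tcons0.
      under eq_integral do rewrite upd_tcons0.
      rewrite -/(G x) => H.
      rewrite /u (EFinM 2 (w ord0)) -muleA.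
      apply: (@le_trans _ _ (2%:E * ((F (tcons (a, x)) - F (tcons (b, x))) ^+ 2)%:E +
        2%:E * K (b, x) y)%E).
        rewrite /K/= -!EFinM -EFinD lee_fin -subr_ge0.
        set fa := F _; set fb := F (tcons (b, x)); set fy := F _.
        rewrite (_ : _ - _ = (fa - fb - (fb - fy)) ^+ 2) ?sqr_ge0//; ring.
      by rewrite leeD2r// lee_pmul2l.
    apply: (@measurableT_comp _ _ _ _ _ _ (fun z => K z.1 z.2) _ (fun y => ((b, x), y))) => //.
    exact: pair1_measurable.
  have mLx : measurable_fun setT (fun b => L (b, x)).
    exact: (@measurableT_comp _ _ _ _ _ _ L _ (fun b => (b, x))).
  have qu0 : (0 <= q%:E * u)%E by rewrite mule_ge0// lee_fin.
  rewrite (ge0_integral_affine (mu ord0) (mA ord0) mLx _ qu0)//.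
  rewrite -/p /u !muleA -!EFinM.
  by rewrite (_ : p * q * (2 * w ord0) = 2 * w ord0 * q * p)//; ring.
(* Once the integrals over [x] and [b] are exchanged, the inner one is, for fixed [b], the double
   integral of the induction hypothesis. *)
have xM : (\int[m2]_(x in Q) M x <=
    (2 ^+ n * c * q)%:E * \sum_(k < n) J (lift ord0 k))%E.
  rewrite /M -(tonelli_set (mu ord0) m2 (mA ord0) mQ mL L0).
  pose Jb k b := (\int[mixed_measure nu' mu' k]_(x in Q)
    (g (lift ord0 k) (tcons (b, x)) ^+ 2)%:E)%E.
  have Jb0 k b : (0 <= Jb k b)%E by apply: integral_ge0 => r _; rewrite lee_fin sqr_ge0.
  have mJb k : measurable_fun setT (Jb k).
    apply: (@measurable_integral_snd _ _ _ _ _ _ _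
      (fun z => (g (lift ord0 k) (tcons z) ^+ 2)%:E)) => //.
      apply/measurable_EFinP; apply: measurable_funX; apply: measurableT_comp => //.
      exact: measurable_tcons.
    by move=> z; rewrite lee_fin sqr_ge0.
  have JE k : J (lift ord0 k) = (\int[mu ord0]_(b in A ord0) Jb k b)%E.
    rewrite /J mixed_measureS integral_cons_box//.
    by move=> z; rewrite lee_fin sqr_ge0.
  apply: (@le_trans _ _ (\int[mu ord0]_(b in A ord0)
      ((2 ^+ n * c * q)%:E * \sum_(k < n) Jb k b))%E).
    apply: ge0_le_integral_set_nomeas => b Ab; first by apply: integral_ge0.
    apply: (IH mu' nu' A' (fun x => F (tcons (b, x)))
      (fun k x => g (lift ord0 k) (tcons (b, x))) (fun k => w (lift ord0 k))) => //.
    - by move=> i; exact: mA.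
    - by apply: measurableT_comp => //; exact: measurable_tconsr.
    - by move=> k; apply: measurableT_comp => //; exact: measurable_tconsr.
    - move=> k x s t As At; have := Fg (lift ord0 k) (tcons (b, x)) s t As At.
      rewrite !upd_tcons_lift; under eq_integral do rewrite upd_tcons_lift.
      by [].
  rewrite ge0_integralZl//.
  - rewrite ge0_integral_sum//; last by move=> k; exact: measurable_funTS.
    by under eq_bigr do rewrite -JE.
  - by apply: emeasurable_sum => k; exact: measurable_funTS.
  - by move=> b _; apply: sume_ge0.
  - by rewrite lee_fin !mulr_ge0// exprn_ge0.
have xG : (\int[m2]_(x in Q) G x = J ord0)%E.
  rewrite /J integral_cons_box//; last by move=> z; rewrite lee_fin sqr_ge0.
  rewrite (tonelli_set (nu ord0) m2 (mA ord0) mQ mg0)// => z; by rewrite lee_fin sqr_ge0.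
have wp : w ord0 * p <= c.
  by have := wc ord0; rewrite -[X in (_ * X)%E](@fineK _ (mu ord0 (A ord0)))
    ?fin_num_measure// -EFinM lee_fin.
rewrite -/(Phi _) integral_cons_box//.
apply: (@le_trans _ _ (p%:E * ((2 * w ord0 * q * p)%:E * J ord0 +
    2%:E * \int[m2]_(x in Q) M x))%E).
  apply: (@le_trans _ _ (\int[mu ord0]_(a in A ord0)
     (cst ((2 * w ord0 * q * p)%:E * J ord0 +
      2%:E * \int[m2]_(x in Q) M x) a))%E); last first.
    rewrite (integral_cst (mu ord0) (mA ord0)) [leLHS]muleC /p fineK//.
    by rewrite fin_num_measure.
  apply: ge0_le_integral_set_nomeas => a Aa.
    by apply: integral_ge0 => x _; exact: (Phi0 (tcons (a, x))).
  apply: (@le_trans _ _ (\int[m2]_(x in Q) ((2 * w ord0 * q * p)%:E * G x + 2%:E * M x))%E).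
    apply: ge0_le_integral_set_nomeas => x Qx; last exact: Phi_le.
    exact: (Phi0 (tcons (a, x))).
  have mQG := @measurable_funTS _ _ _ _ Q _ mG.
  have mQM := @measurable_funTS _ _ _ _ Q _ mM.
  rewrite ge0_integralD//.
  - by rewrite !ge0_integralZl// ?xG// lee_fin !mulr_ge0.
  - by move=> x _; rewrite mule_ge0// lee_fin !mulr_ge0.
  - exact: measurable_funeM.
  - by move=> x _; rewrite mule_ge0// lee_fin !mulr_ge0.
  - exact: measurable_funeM.
have IM0 : (0 <= \int[m2]_(x in Q) M x)%E by apply: integral_ge0.
have SJ0 : (0 <= \sum_(k < n) J (lift ord0 k))%E by apply: sume_ge0.
rewrite pq big_ord_recl [leRHS]ge0_muleDr; [|exact: J0|exact: SJ0].
rewrite [leLHS]ge0_muleDr; last 2 first.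
- by rewrite mule_ge0// lee_fin !mulr_ge0.
- by rewrite mule_ge0.
rewrite leeD//.
  rewrite muleA -EFinM lee_wpmul2r// lee_fin.
  rewrite (_ : p * (2 * w ord0 * q * p) = (2 * (w ord0 * p)) * (p * q)); last by ring.
  rewrite ler_wpM2r ?mulr_ge0// ler_pM// ?mulr_ge0//.
  by rewrite exprS -[X in X <= _]mulr1 ler_pM2l// exprn_ege1// ler1n.
rewrite muleA -EFinM.
apply: (@le_trans _ _ ((p * 2)%:E * ((2 ^+ n * c * q)%:E * \sum_(k < n) J (lift ord0 k)))%E).
  by rewrite lee_wpmul2l// lee_fin mulr_ge0.
by rewrite muleA -EFinM exprS (_ : p * 2 * (2 ^+ n * c * q) = 2 * 2 ^+ n * c * (p * q))//; ring.
Qed.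

End box_poincare.

(** * Growth of the eigenvalues *)

Section smooth_increments.
Context {R : realType} {d : nat}.
Variables (W : 'I_d -> W_function R) (V : 'I_d -> V_function R).
Local Notation X := (d.-tuple R).
Implicit Types (f phi : X -> R) (k : 'I_d).

Lemma upd_upd (x : X) k s t : upd (upd x k s) k t = upd x k t.
Proof. by apply: eq_from_tnth => i; rewrite !tnth_mktuple; case: eqP. Qed.

Lemma tnth_upd (x : X) k t : tnth (upd x k t) k = t.
Proof. by rewrite tnth_mktuple eqxx. Qed.

Lemma measurable_upd (x : X) k : measurable_fun setT (upd x k).
Proof.
apply/measurable_fun_tnthP => i.
rewrite (_ : _ \o _ = if i == k then id else cst (tnth x i)).
  by case: (i == k); [exact: measurable_id|exact: measurable_cst].
by apply/funext => t /=; rewrite tnth_mktuple; case: (i == k).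
Qed.

Lemma partial_WV_addc c f k : partial_WV W V 1 k (fun x => c + f x) =
  partial_WV W V 1 k f.
Proof.
apply/funext => x; rewrite /partial_WV/= /partial.
rewrite (_ : diff_quot _ _ _ = diff_quot (W k) (slice f k x) (tnth x k))//.
by apply/funext => h; rewrite /diff_quot /slice opprD addrACA subrr add0r.
Qed.

Lemma Cinfty_L2 phi : Cinfty_WV W V phi -> phi \in 'L2[mV V].
Proof.
move=> [c [f [[_ f2 _ _ _] ->]]].
by apply: (@L2_add _ _ _ _ (cst c)) => //; exact: Lfun_cst.
Qed.

Lemma Cinfty_partial_L2 phi k :
  Cinfty_WV W V phi -> partial_WV W V 1 k phi \in 'L2[mVW W V k].
Proof.
move=> [c [f [[_ _ _ _ /(_ k 0%N)[_ _ f2 _]] ->]]].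
by rewrite partial_WV_addc.
Qed.

Lemma Cinfty_partial_cvg phi k x : Cinfty_WV W V phi ->
  diff_quot (W k) (slice phi k x) (tnth x k) @ (0 : R)^'- -->
  partial_WV W V 1 k phi x.
Proof.
move=> [c [f [[_ _ _ _ /(_ k 0%N)[fc _ _ _]] ->]]].
rewrite partial_WV_addc.
rewrite (_ : diff_quot _ _ _ = diff_quot (W k) (slice f k x) (tnth x k)).
  exact: fc.
by apply/funext => h; rewrite /diff_quot /slice opprD addrACA subrr add0r.
Qed.

Lemma partial_WV_sub phi psi k : Cinfty_WV W V phi -> Cinfty_WV W V psi ->
  partial_WV W V 1 k (fun x => phi x - psi x) =
  (fun x => partial_WV W V 1 k phi x - partial_WV W V 1 k psi x).
Proof.
move=> hphi hpsi; apply/funext => x; apply/cvg_lim; [by []|exact: at_left_proper_filter|].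
rewrite /near_side/=.
apply: cvg_trans (cvgB (@Cinfty_partial_cvg phi k x hphi)
  (@Cinfty_partial_cvg psi k x hpsi)).
apply: near_eq_cvg; apply: nearW => h.
by rewrite /diff_quot /slice !fctE -mulrBl; congr (_ * _); ring.
Qed.

Lemma Cinfty_cadlag phi k x : Cinfty_WV W V phi -> cadlag (slice phi k x).
Proof.
move=> [c [f [[_ _ _ /(_ k x) fc _] ->]]] t; have [h1 h2] := fc t.
rewrite (_ : slice _ k x = (fun t => c + slice f k x t))//; split.
  by apply: cvgD => //; exact: cvg_cst.
move/cvg_ex: h2 => [l h2]; apply/cvg_ex; exists (c + l).
by apply: cvgD => //; exact: cvg_cst.
Qed.

Lemma Cinfty_partial_caglad phi k x : Cinfty_WV W V phi ->
  caglad (slice (partial_WV W V 1 k phi) k x).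
Proof.
move=> [c [f [[_ _ _ _ /(_ k 0%N)[_ /(_ x) fc _ _]] ->]]].
by rewrite partial_WV_addc.
Qed.

Lemma Cinfty_increment phi k x s t : Cinfty_WV W V phi ->
  0 <= s -> s <= t -> t < 1 ->
  (((phi (upd x k t) - phi (upd x k s)) ^+ 2)%:E <=
   (W k t - W k s)%:E * \int[dW (W k)]_(r in `]s, t])
     ((partial_WV W V 1 k phi (upd x k r)) ^+ 2)%:E)%E.
Proof.
move=> hphi s0 st t1.
apply: (@sqr_increment_le _ (W k) (slice phi k x)
  (slice (partial_WV W V 1 k phi) k x)) => //.
- by move=> y; have [] := @Cinfty_cadlag _ k x hphi y.
- move=> y; have := @Cinfty_partial_cvg _ k (upd x k y) hphi.
  rewrite tnth_upd (_ : slice phi k (upd x k y) = slice phi k x)//.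
  by apply/funext => u; rewrite /slice upd_upd.
- by move=> y; have [] := @Cinfty_partial_caglad _ k x hphi y.
- apply: measurableT_comp; last exact: measurable_upd.
  exact: L2_measurable (Cinfty_partial_L2 k hphi).
Qed.

Section boxes_of_pieces.
Variable m' : nat.
Let m := m'.+1.
Implicit Type c : {ffun 'I_d -> 'I_m * bool}.

Definition cell c : set X := box (fun k => piece (W k) (V k) (c k)).

Lemma measurable_cell c : measurable (cell c).
Proof. by apply: measurable_box => k; exact: measurable_piece. Qed.

(** A common bound for all coordinates, so that the cells share one constant. *)
Definition total_mass : R := \sum_(k < d) (W k 1 + V k 1).

Lemma total_mass_ge k : 0 <= W k 1 + V k 1 <= total_mass.
Proof.
have h j : 0 <= W j 1 + V j 1 by rewrite addr_ge0 ?W_ge0 ?V_ge0.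
by rewrite h /total_mass (bigD1 k)//= lerDl sumr_ge0.
Qed.

Lemma cell_poincare phi c : Cinfty_WV W V phi ->
  (\int[mV V]_(x in cell c) \int[mV V]_(y in cell c) ((phi x - phi y) ^+ 2)%:E <=
   (2 ^+ d * (total_mass / m%:R) ^+ 2 * fine (mV V (cell c)))%:E *
   \sum_(k < d) \int[mVW W V k]_(x in cell c)
      (partial_WV W V 1 k phi x ^+ 2)%:E)%E.
Proof.
move=> hphi.
have /choice[w hw] k : exists w : R, 0 <= w /\
    (forall s t, piece (W k) (V k) (c k) s -> piece (W k) (V k) (c k) t ->
       s <= t -> W k t - W k s <= w) /\
    (w%:E * dV (V k) (piece (W k) (V k) (c k)) <=
       ((total_mass / m%:R) ^+ 2)%:E)%E.
  have [w w0 [w1 w2]] := piece_small (W k) (V k) (c k).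
  exists w; split => //; split => //; apply: (le_trans w2).
  have /andP[t0 t1] := total_mass_ge k.
  rewrite lee_fin ler_sqr ?nnegrE ?divr_ge0//; last exact: le_trans t1.
  by rewrite ler_wpM2r// invr_ge0.
apply: (@box_poincare _ _ _ _ _ _ _ w) => //.
- by move=> k; exact: measurable_piece.
- exact: L2_measurable (Cinfty_L2 hphi).
- by move=> k; exact: L2_measurable (Cinfty_partial_L2 k hphi).
- exact: sqr_ge0.
- by move=> k; have [] := hw k.
- by move=> k; have [_ []] := hw k.
move=> k x.
have key s t : piece (W k) (V k) (c k) s -> piece (W k) (V k) (c k) t -> s <= t ->
    (((phi (upd x k t) - phi (upd x k s)) ^+ 2)%:E <=
    (w k)%:E * \int[dWs W k]_(r in piece (W k) (V k) (c k))
       (partial_WV W V 1 k phi (upd x k r) ^+ 2)%:E)%E.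
  move=> /[dup] ps [/andP[s0 _] _] /[dup] pt [/andP[_ t1] _] st.
  have [w0 [w1 _]] := hw k.
  apply: le_trans (Cinfty_increment k x hphi s0 st t1) _.
  have Wst : 0 <= W k t - W k s by rewrite subr_ge0 W_nondecreasing.
  have mG : measurable_fun setT
      (fun r => (partial_WV W V 1 k phi (upd x k r) ^+ 2)%:E).
    apply/measurable_EFinP; apply: measurable_funX; apply: measurableT_comp.
      exact: L2_measurable (Cinfty_partial_L2 k hphi).
    exact: measurable_upd.
  apply: lee_pmul; rewrite ?lee_fin//.
  - by apply: integral_ge0 => r _; rewrite lee_fin sqr_ge0.
  - exact: w1.
  - apply: ge0_subset_integral => //.
    + exact: measurable_piece.
    + exact: measurable_funTS.
    + by move=> r _; rewrite lee_fin sqr_ge0.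
    + move=> r; rewrite /= in_itv/= => /andP[sr rt].
      by apply: (piece_interval ps pt); rewrite (ltW sr).
move=> s t ps pt; have [st|/ltW ts] := leP s t.
  by rewrite -sqrrN opprB; exact: key.
exact: key.
Qed.

End boxes_of_pieces.

End smooth_increments.

(** * Variance identity and projection onto constants *)

Section averages_on_a_set.
Context {d : measure_display} {X : measurableType d} {R : realType}.
Variable mu : {finite_measure set X -> \bar R}.
Implicit Types (f : X -> R) (Q : set X).

Lemma L2_indic Q : measurable Q -> \1_Q \in 'L2[mu].
Proof.
move=> mQ; apply/L2P; split; first exact: measurable_indic.
rewrite (eq_integral (EFin \o \1_Q)); last first.
  by move=> x _ /=; rewrite indicE; case: (_ \in _); rewrite ?expr1n ?expr0n.
by rewrite integral_indic// setIT ltey_eq fin_num_measure.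
Qed.

Lemma inner_indic Q : measurable Q -> inner mu \1_Q \1_Q = fine (mu Q).
Proof.
move=> mQ; rewrite /inner /Rintegral; congr fine.
rewrite (eq_integral (EFin \o \1_Q)); last first.
  by move=> x _ /=; rewrite indicE; case: (_ \in _); rewrite ?mulr1 ?mulr0.
by rewrite integral_indic// setIT.
Qed.

Lemma L2_mul_indic f Q : measurable Q -> f \in 'L2[mu] ->
  (fun x => f x * \1_Q x) \in 'L2[mu].
Proof.
move=> mQ /[dup] /L2_measurable mf /L2P[_ f2]; apply/L2P; split.
  by apply: measurable_funM => //; exact: measurable_indic.
apply: le_lt_trans f2; apply: ge0_le_integral_nomeas => x.
  by rewrite lee_fin sqr_ge0.
rewrite lee_fin indicE; case: (_ \in _); rewrite ?mulr1// mulr0 expr0n/=.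
exact: sqr_ge0.
Qed.

Lemma integral_mul_indic (F : X -> R) Q :
  (\int[mu]_(x in Q) (F x)%:E = \int[mu]_x (F x * \1_Q x)%:E)%E.
Proof.
rewrite integral_mkcond; apply: eq_integral => x _; rewrite /patch indicE.
by case: (_ \in _); rewrite ?mulr1 ?mulr0.
Qed.

(** The variance identity, obtained by expanding the square and integrating in [y], then in [x].
    Replacing [f] by its product with [\1_Q] turns the integrals over [Q] into inner products. *)
Lemma double_integral_sqr_sub f Q : measurable Q -> f \in 'L2[mu] ->
  let fQ := fun x => f x * \1_Q x in
  (\int[mu]_(x in Q) \int[mu]_(y in Q) ((f x - f y) ^+ 2)%:E =
   (2 * (fine (mu Q) * inner mu fQ fQ - inner mu f \1_Q ^+ 2))%:E)%E.
Proof.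
move=> mQ f2 fQ; have fQ2 : fQ \in 'L2[mu] by exact: L2_mul_indic.
have i2 := L2_indic mQ.
set q := fine (mu Q); set b := inner mu f \1_Q; set a := inner mu fQ fQ.
have fQi : inner mu fQ \1_Q = b.
  apply: eq_Rintegral => x _; rewrite /fQ indicE.
  by case: (_ \in _); rewrite ?mulr1 ?mulr0.
have inner_y x : Q x -> (\int[mu]_(y in Q) ((f x - f y) ^+ 2)%:E =
    (q * fQ x ^+ 2 - 2 * b * fQ x + a)%:E)%E.
  move=> Qx; have fx : fQ x = f x by rewrite /fQ indicE mem_set// mulr1.
  rewrite integral_mul_indic fx.
  transitivity (\int[mu]_y ((f x * \1_Q y - fQ y) ^+ 2)%:E)%E.
    apply: eq_integral => y _; congr EFin; rewrite /fQ indicE.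
    by case: (_ \in _); rewrite ?mulr1// !mulr0 subrr expr0n.
  rewrite sqdist_integral//; last exact: L2_scale.
  rewrite /sqdist inner_sqrB//; last exact: L2_scale.
  rewrite innerZl ?L2_scale// innerZr// inner_indic// innerZl//.
  by rewrite (innerC mu \1_Q) fQi; congr EFin; rewrite -/q -/a; ring.
transitivity (\int[mu]_(x in Q) (q * fQ x ^+ 2 - 2 * b * fQ x + a)%:E)%E.
  by apply: eq_integral => x /set_mem; exact: inner_y.
rewrite integral_mul_indic.
transitivity (\int[mu]_x ((q * fQ x - 2 * b * \1_Q x) * fQ x +
   (a * \1_Q x) * \1_Q x)%:E)%E.
  apply: eq_integral => x _; congr EFin; rewrite /fQ indicE.
  by case: (_ \in _) => /=; ring.
have u2 : (fun x => q * fQ x - 2 * b * \1_Q x) \in 'L2[mu].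
  by apply: L2_sub; exact: L2_scale.
rewrite integralD_EFin//; last 2 first.
- exact: L2_integrableM.
- by apply: L2_integrableM => //; exact: L2_scale.
have E u v : u \in 'L2[mu] -> v \in 'L2[mu] ->
    (\int[mu]_x (EFin \o (fun x => u x * v x)%R) x = (inner mu u v)%:E)%E.
  move=> u2' v2'; rewrite /inner /Rintegral fineK//.
  by apply: integrable_fin_num => //; exact: L2_integrableM.
rewrite !E ?L2_scale// innerBl ?L2_scale// !innerZl//.
rewrite (innerC mu \1_Q) fQi inner_indic// -EFinD -/q -/a; congr EFin.
by ring.
Qed.

(** The unit vector that spans the constants on [Q]. It is zero on a null set, the inverse of 0
    being 0, so its norm is only bounded by 1. *)
Definition normalized_indic Q : X -> R := fun x => (Num.sqrt (fine (mu Q)))^-1 * \1_Q x.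

Lemma normalized_indic_L2 Q : measurable Q -> normalized_indic Q \in 'L2[mu].
Proof. by move=> mQ; apply: L2_scale; exact: L2_indic. Qed.

Lemma inner_normalized_indic Q : measurable Q ->
  inner mu (normalized_indic Q) (normalized_indic Q) <= 1.
Proof.
move=> mQ; have i2 := L2_indic mQ.
rewrite innerZl ?L2_scale// innerZr// inner_indic//.
set q := fine (mu Q); have q0 : 0 <= q by exact: fine_ge0.
have [->|qn0] := eqVneq q 0; first by rewrite sqrtr0 !mulr0.
rewrite mulrA -expr2 exprVn sqr_sqrtr// mulVf//.
Qed.

(** The variance identity divided by the mass of [Q]: its negative term is the squared projection of
    [f] onto the constants. For a null [Q] the left side vanishes. *)
Lemma set_poincare f Q (S : R) : measurable Q -> f \in 'L2[mu] ->
  (\int[mu]_(x in Q) \int[mu]_(y in Q) ((f x - f y) ^+ 2)%:E <=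
     (fine (mu Q) * S)%:E)%E -> 0 <= S ->
  inner mu (fun x => f x * \1_Q x) (fun x => f x * \1_Q x) <=
  inner mu f (normalized_indic Q) ^+ 2 + S.
Proof.
move=> mQ f2; rewrite double_integral_sqr_sub// lee_fin.
have i2 := L2_indic mQ; have fQ2 := L2_mul_indic mQ f2.
rewrite innerZr//; set q := fine (mu Q); set b := inner mu f \1_Q.
set fQ := fun x => f x * \1_Q x; set a := inner mu fQ fQ => H S0.
have q0 : 0 <= q by exact: fine_ge0.
have [q00|qn0] := eqVneq q 0.
  have muQ0 : mu Q = 0%E by rewrite -(@fineK _ (mu Q)) ?fin_num_measure// -/q q00.
  have -> : a = 0.
    apply/EFin_inj; rewrite -L2_inner//.
    transitivity (\int[mu]_(x in Q) (f x ^+ 2)%:E)%E.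
      rewrite [RHS]integral_mul_indic; apply: eq_integral => x _; congr EFin.
      by rewrite /fQ indicE; case: (_ \in _); rewrite ?mulr1// !mulr0 expr0n.
    apply: null_set_integral => //; apply/measurable_EFinP.
    by apply: measurable_funX; apply: measurable_funTS; exact: L2_measurable f2.
  by rewrite addr_ge0// sqr_ge0.
have qp : 0 < q by rewrite lt_def qn0.
rewrite exprMn exprVn sqr_sqrtr//.
rewrite -(ler_pM2l qp) mulrDr mulrA divff// mul1r.
have := sqr_ge0 b; have : 0 <= q * S by rewrite mulr_ge0.
lra.
Qed.

End averages_on_a_set.

(** * Poincare inequality on the torus for smooth functions *)

Section cinfty_poincare.
Context {R : realType} {d : nat}.
Variables (W : 'I_d -> W_function R) (V : 'I_d -> V_function R).
Local Notation X := (d.-tuple R).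
Variable m' : nat.
Let m := m'.+1.
Let C := {ffun 'I_d -> 'I_m * bool}.

Lemma sum_indic_cell x : (forall k, 0 <= tnth x k < 1) ->
  \sum_(c : C) \1_(cell W V c) x = 1 :> R.
Proof.
move=> x01; pose c : C := [ffun k => piece_of (W k) (V k) m' (tnth x k)].
rewrite (bigD1 c)//= [X in X + _](_ : _ = 1); last first.
  by rewrite indicE mem_set// => k; split; [exact: x01|rewrite ffunE].
rewrite big1 ?addr0// => c' /eqP cc'; rewrite indicE memNset// => xc'.
by apply: cc'; apply/ffunP => k; rewrite ffunE; have [_ ->] := xc' k.
Qed.

Lemma sum_indic_cell_le x : \sum_(c : C) \1_(cell W V c) x <= 1 :> R.
Proof.
have [x01|x01] := pselect (forall k, 0 <= tnth x k < 1).
  by rewrite sum_indic_cell.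
rewrite big1// => c _; rewrite indicE memNset// => xc; apply: x01 => k.
by have [] := xc k.
Qed.

Lemma integral_cells_ge (mu : {measure set X -> \bar R}) (F : X -> R) :
  measurable_fun setT F -> (forall x, 0 <= F x) ->
  (\sum_(c : C) \int[mu]_(x in cell W V c) (F x)%:E <= \int[mu]_x (F x)%:E)%E.
Proof.
move=> mF F0; under eq_bigr do rewrite integral_mkcond.
rewrite -ge0_integral_sum//.
- apply: ge0_le_integral_nomeas => x.
    by apply: sume_ge0 => c _; rewrite /patch; case: ifP; rewrite ?lee_fin.
  rewrite (eq_bigr (fun c => (F x * \1_(cell W V c) x)%:E)); last first.
    move=> c _; rewrite /patch indicE.
    by case: (_ \in _); rewrite ?mulr1 ?mulr0.
  by rewrite sumEFin lee_fin -mulr_sumr ler_piMr// sum_indic_cell_le.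
- move=> c; apply/(measurable_restrictT _ _).1; first exact: measurable_cell.
  by apply: measurable_funTS; exact/measurable_EFinP.
- by move=> c x _; rewrite /patch; case: ifP; rewrite ?lee_fin.
Qed.

Lemma mV_cube : mV V (~` box (fun=> `[0, 1[%classic)) = 0%E.
Proof.
have mI : measurable (`[0, 1[%classic : set R) by exact: measurable_itv.
have mB : measurable (box (fun _ : 'I_d => `[0, 1[%classic : set R)).
  by apply: measurable_box.
have fB : mV V (box (fun=> `[0, 1[%classic)) \is a fin_num by exact: fin_num_measure.
have E : mV V setT = mV V (box (fun=> `[0, 1[%classic)).
  have -> : [set: X] = box (fun=> [set: R]) by apply/seteqP.
  rewrite /mV.
  have -> : prod_measure (dVs V) (box (fun=> [set: R])) =
      (\prod_(i < d) dVs V i setT)%E by exact: prod_measureE.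
  have -> : prod_measure (dVs V) (box (fun=> `[0, 1[%classic)) =
      (\prod_(i < d) dVs V i `[0%R, 1%R[%classic)%E by exact: prod_measureE.
  apply: eq_bigr => i _.
  by rewrite /dVs/= /dV setTI setIid.
set B := box _ in mB fB E *.
have H : (mV V setT = mV V B + mV V (~` B))%E.
  rewrite -(setUv B); exact: (measureU (mV V) mB (measurableC mB) (setICr _)).
move: fB H; rewrite E {E}; move: (mV V B) (mV V (~` B)) => a b.
move: a b => [r||] [s||]// _; rewrite -EFinD => -[rs].
by congr EFin; lra.
Qed.

(** [set_poincare] is summed over the cells. They cover the unit cube, which has full measure for
    [mV], so the left sides add up exactly to the squared norm; for the energies, disjointness of
    the cells gives the inequality required. *)
Lemma cinfty_poincare phi : Cinfty_WV W V phi ->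
  inner (mV V) phi phi <=
  \sum_(c : C) inner (mV V) phi (normalized_indic (mV V) (cell W V c)) ^+ 2 +
  2 ^+ d * (total_mass W V / m%:R) ^+ 2 *
    \sum_(k < d) inner (mVW W V k) (partial_WV W V 1 k phi) (partial_WV W V 1 k phi).
Proof.
move=> hphi; have phi2 := Cinfty_L2 hphi.
have G2 k := Cinfty_partial_L2 k hphi.
pose K := 2 ^+ d * (total_mass W V / m%:R) ^+ 2.
have K0 : 0 <= K by rewrite mulr_ge0 ?sqr_ge0// exprn_ge0.
pose phic (c : C) x := phi x * \1_(cell W V c) x.
have phic2 (c : C) : phic c \in 'L2[mV V].
  by apply: L2_mul_indic => //; exact: measurable_cell.
pose S (c : C) k := (\int[mVW W V k]_(x in cell W V c)
      (partial_WV W V 1 k phi x ^+ 2)%:E)%E.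
have mG k : measurable_fun setT (fun x => partial_WV W V 1 k phi x ^+ 2).
  by apply: measurable_funX; exact: L2_measurable (G2 k).
have S0 c k : (0 <= S c k)%E.
  by apply: integral_ge0 => x _; rewrite lee_fin sqr_ge0.
have Sfin c k : S c k \is a fin_num.
  rewrite ge0_fin_numE//; have /L2P[_] := G2 k; apply: le_lt_trans.
  apply: ge0_subset_integral => //; first exact: measurable_cell.
    exact/measurable_EFinP.
  by move=> x _; rewrite lee_fin sqr_ge0.
have sumS k : \sum_(c : C) fine (S c k) <=
    inner (mVW W V k) (partial_WV W V 1 k phi) (partial_WV W V 1 k phi).
  rewrite -lee_fin -L2_inner// -sumEFin.
  under eq_bigr do rewrite fineK//.
  by apply: integral_cells_ge => // x; exact: sqr_ge0.
have cellp (c : C) : inner (mV V) (phic c) (phic c) <=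
    inner (mV V) phi (normalized_indic (mV V) (cell W V c)) ^+ 2 +
    K * \sum_(k < d) fine (S c k).
  apply: set_poincare => //; first exact: measurable_cell.
    apply: le_trans (cell_poincare c hphi) _.
    rewrite -/K -/m; under eq_bigr do rewrite -/(S c _) -[S c _]fineK//.
    by rewrite sumEFin -EFinM lee_fin mulrCA mulrA.
  by rewrite mulr_ge0// sumr_ge0// => k _; exact: fine_ge0.
have -> : inner (mV V) phi phi = \sum_(c : C) inner (mV V) (phic c) (phic c).
  apply/EFin_inj; rewrite -sumEFin -L2_inner//.
  under eq_bigr do rewrite -L2_inner//.
  rewrite -ge0_integral_sum//; last 2 first.
  - move=> c; apply/measurable_EFinP; apply: measurable_funX.
    exact: L2_measurable (phic2 c).
  - by move=> c x _; rewrite lee_fin sqr_ge0.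
  apply: ge0_ae_eq_integral => //.
  - by apply/measurable_EFinP; apply: measurable_funX; exact: L2_measurable phi2.
  - apply: emeasurable_sum => c; apply/measurable_EFinP; apply: measurable_funX.
    exact: L2_measurable (phic2 c).
  - by move=> x _; rewrite lee_fin sqr_ge0.
  - by move=> x _; apply: sume_ge0 => c _; rewrite lee_fin sqr_ge0.
  exists (~` box (fun=> `[0, 1[%classic)); split.
  - apply: measurableC; apply: measurable_box => i; exact: measurable_itv.
  - exact: mV_cube.
  - apply: subsetC => x xB _; rewrite sumEFin; congr EFin.
    rewrite (eq_bigr (fun c => phi x ^+ 2 * \1_(cell W V c) x)); last first.
      move=> c _; rewrite /phic indicE.
      by case: (_ \in _); rewrite ?mulr1// !mulr0 expr0n.
    by rewrite -mulr_sumr sum_indic_cell ?mulr1.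
apply: le_trans (ler_sum _ (fun c _ => cellp c)) _.
rewrite big_split/= lerD2l -mulr_sumr ler_wpM2l// exchange_big/=.
by apply: ler_sum => k _; exact: sumS.
Qed.

End cinfty_poincare.

(** * Extension to the energetic space *)

Section norm2_convergence.
Context {d : measure_display} {X : measurableType d} {R : realType}.
Variable mu : {measure set X -> \bar R}.
Implicit Types f g h : X -> R.

Lemma norm2E f : f \in 'L2[mu] -> norm2 mu f = (Num.sqrt (inner mu f f))%:E.
Proof.
move=> f2; have := norm2_inner f2.
have : (0 <= norm2 mu f)%E by exact: Lnorm_ge0.
case: (norm2 mu f) => [r| |]//.
rewrite lee_fin => r0; rewrite -EFin_expe => -[<-].
by rewrite sqrtr_sqr ger0_norm.
Qed.

Lemma norm2_cvg0 (F : nat -> X -> R) f : (forall n, F n \in 'L2[mu]) ->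
  f \in 'L2[mu] ->
  norm2 mu (fun x => F n x - f x) @[n --> \oo] --> 0%E <->
  sqdist mu (F n) f @[n --> \oo] --> 0.
Proof.
move=> F2 f2.
have -> : (fun n => norm2 mu (fun x => F n x - f x)) =
    EFin \o (fun n => Num.sqrt (sqdist mu (F n) f)).
  by apply/funext => n /=; rewrite norm2E//; exact: L2_sub.
split=> [/fine_cvgP[_ H]|H].
  have {}H : Num.sqrt (sqdist mu (F n) f) @[n --> \oo] --> 0 by exact: H.
  rewrite [X in _ --> X](_ : 0 = 0 * 0); last by rewrite mulr0.
  apply: cvg_trans (cvgM H H); apply: near_eq_cvg.
  by apply: nearW => n /=; rewrite -expr2 sqr_sqrtr// sqdist_ge0.
apply: cvg_EFin; first exact: nearW.
have := cvg_comp _ _ H (@sqrt_continuous R 0); rewrite sqrtr0.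
by [].
Qed.

End norm2_convergence.

Section energy_space.
Context {R : realType} {d : nat}.
Variables (W : 'I_d -> W_function R) (V : 'I_d -> V_function R).
Local Notation X := (d.-tuple R).
Implicit Types (f g : X -> R) (k : 'I_d).

(** Along an energy-Cauchy sequence each partial derivative is Cauchy in its own L^2 space and has a
    limit by completeness; the choice in [gradient] therefore never takes its default value on
    [H1]. *)
Lemma H1_gradient f : H1 W V f -> is_gradient W V f (gradient W V f).
Proof.
move=> [f2 [phi hphi]]; rewrite /gradient.
suff [G hG] : exists G, is_gradient W V f G by exact: (xgetPex _ (ex_intro _ G hG)).
have [phiC phic phif] := hphi.
have P2 n k : partial_WV W V 1 k (phi n) \in 'L2[mVW W V k].
  exact: Cinfty_partial_L2.
have /choice[G hG] k : exists G, G \in 'L2[mVW W V k] /\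
    sqdist (mVW W V k) (partial_WV W V 1 k (phi n)) G @[n --> \oo] --> 0.
  have [|G G2 PG] := L2_complete (P2^~ k); last by exists G.
  move=> eps e0; have [N hN] := phic eps e0; exists N => m n Nm Nn.
  have := hN m n Nm Nn; rewrite /energy_norm_sq.
  have nn j (f' : X -> R) : (0 <= norm2 (mVW W V j) f' ^+ 2)%E.
    by rewrite norm2_sqr; apply: integral_ge0 => x _; rewrite lee_fin sqr_ge0.
  rewrite (bigD1 k)//= => H; apply: ltW; rewrite -lte_fin; apply: le_lt_trans H.
  have -> : ((sqdist (mVW W V k) (partial_WV W V 1 k (phi m)) (partial_WV W V 1 k (phi n)))%:E
     = norm2 (mVW W V k) (partial_WV W V 1 k (fun x => phi m x - phi n x)%R) ^+ 2)%E.
    by rewrite partial_WV_sub// norm2_inner//; exact: L2_sub.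
  rewrite addeCA leeDl// adde_ge0//; first by rewrite mule_ge0 ?Lnorm_ge0.
  by apply: sume_ge0 => j _; exact: nn.
exists G, phi => // k; have [G2 PG] := hG k; split => //.
by apply/norm2_cvg0.
Qed.

(** The smooth inequality passes to the limit along the very sequence that defines [G], so it holds
    for any [G] related to [f] by [is_gradient]. *)
Lemma gradient_poincare m' f G : f \in 'L2[mV V] -> is_gradient W V f G ->
  inner (mV V) f f <=
  \sum_(c : {ffun 'I_d -> 'I_m'.+1 * bool})
     inner (mV V) f (normalized_indic (mV V) (cell W V c)) ^+ 2 +
  2 ^+ d * (total_mass W V / m'.+1%:R) ^+ 2 *
    \sum_(k < d) inner (mVW W V k) (G k) (G k).
Proof.
move=> f2 [phi [phiC _ phif] hG].
have phi2 n : phi n \in 'L2[mV V] by exact: Cinfty_L2.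
have P2 n k : partial_WV W V 1 k (phi n) \in 'L2[mVW W V k].
  exact: Cinfty_partial_L2.
have {}phif := (norm2_cvg0 phi2 f2).1 phif.
have PG k : inner (mVW W V k) (partial_WV W V 1 k (phi n))
    (partial_WV W V 1 k (phi n)) @[n --> \oo] --> inner (mVW W V k) (G k) (G k).
  have [G2 PG] := hG k; apply: cvg_inner_sqr => //.
  exact: (norm2_cvg0 (P2^~ k) G2).1.
apply: (@ler_cvg_to _ \oo _ _ (fun n => inner (mV V) (phi n) (phi n))
  (fun n => \sum_(c : {ffun 'I_d -> 'I_m'.+1 * bool})
     inner (mV V) (phi n) (normalized_indic (mV V) (cell W V c)) ^+ 2 +
    2 ^+ d * (total_mass W V / m'.+1%:R) ^+ 2 *
    \sum_(k < d) inner (mVW W V k) (partial_WV W V 1 k (phi n))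
      (partial_WV W V 1 k (phi n)))).
- exact: cvg_inner_sqr.
- apply: cvgD.
    apply: cvg_big => [|c _]; first exact: add_continuous.
    rewrite expr2; under eq_fun do rewrite expr2.
    have nc2 : normalized_indic (mV V) (cell W V c) \in 'L2[mV V].
      by apply: normalized_indic_L2; exact: measurable_cell.
    by apply: cvgM; exact: cvg_innerl.
  by apply: cvgMl_tmp; apply: cvg_big => [|k _]; [exact: add_continuous|exact: PG].
- by apply: nearW => n; apply: cinfty_poincare.
Qed.

End energy_space.

(** * Lower bounds and summability of the eigenvalues *)

Section eigenvalues.
Context {R : realType} {d : nat}.
Variables (W : 'I_d -> W_function R) (V : 'I_d -> V_function R).
Local Notation X := (d.-tuple R).
Variables (H : 'I_d -> X -> R) (H0 : R) (kappa : X -> R) (c0 : R).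
Hypotheses (H0_gt0 : 0 < H0) (H_ge : forall k x, H0 <= H k x).
Hypotheses (c0_gt0 : 0 < c0) (kappa_ge : forall x, c0 <= `|kappa x|).
Variables (e : nat -> X -> R) (gamma : nat -> R).
Hypothesis e_eigen : eigenbasis V (L_op W V H kappa) e gamma.

Let e_basis : orthonormal_basis (mV V) e. Proof. by case: e_eigen. Qed.
Let e2 j : e j \in 'L2[mV V]. Proof. by case: e_basis. Qed.
Let eo i j : inner (mV V) (e i) (e j) = (i == j)%:R. Proof. by case: e_basis. Qed.

Let grad j k := gradient W V (e j) k.

Lemma eigen_is_gradient j : is_gradient W V (e j) (gradient W V (e j)).
Proof. by apply: H1_gradient; case: e_eigen => _ /(_ j)[]. Qed.

Let grad2 j k : grad j k \in 'L2[mVW W V k].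
Proof. by have [phi _ /(_ k)[]] := eigen_is_gradient j. Qed.

(** The eigenvalue equation is tested on [e j] itself; [kappa] and the [H k] are then replaced by
    their lower bounds. *)
Lemma eigenvalue_energy j :
  c0 ^+ 2 + H0 * \sum_(k < d) inner (mVW W V k) (grad j k) (grad j k) <= gamma j.
Proof.
case: e_eigen => _ /(_ j)[Hj _ /(_ _ Hj)].
rewrite innerZl// eo eqxx mulr1 => formE.
rewrite -lee_fin -formE EFinD /form_L leeD//.
  apply: (@le_trans _ _ (\int[mV V]_x ((c0 ^+ 2)%:E * (e j x ^+ 2)%:E))%E).
    rewrite ge0_integralZl//.
    - by rewrite L2_inner// eo eqxx -EFinM mulr1.
    - by apply/measurable_EFinP; apply: measurable_funX; exact: L2_measurable (e2 j).
    - by move=> x _; rewrite lee_fin sqr_ge0.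
    - by rewrite lee_fin sqr_ge0.
  apply: ge0_le_integral_nomeas => x; rewrite -EFinM lee_fin.
    by rewrite mulr_ge0// sqr_ge0.
  rewrite -mulrA -expr2 ler_wpM2r ?sqr_ge0//.
  by rewrite -[kappa x ^+ 2]real_normK ?num_real// ler_sqr ?nnegrE// ltW.
rewrite mulr_sumr -sumEFin; apply: lee_sum => k _.
apply: (@le_trans _ _ (\int[mVW W V k]_x (H0%:E * (grad j k x ^+ 2)%:E))%E).
  rewrite ge0_integralZl//.
  - by rewrite L2_inner// -EFinM.
  - by apply/measurable_EFinP; apply: measurable_funX; exact: L2_measurable (grad2 j k).
  - by move=> x _; rewrite lee_fin sqr_ge0.
  - by rewrite lee_fin ltW.
apply: ge0_le_integral_nomeas => x; rewrite -EFinM lee_fin.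
  by rewrite mulr_ge0 ?sqr_ge0// ltW.
by rewrite -mulrA -expr2 ler_wpM2r ?sqr_ge0.
Qed.

Lemma eigenvalue_ge j : c0 ^+ 2 <= gamma j.
Proof.
apply: le_trans (eigenvalue_energy j); rewrite lerDl mulr_ge0 ?(ltW H0_gt0)//.
by apply: sumr_ge0 => k _; exact: inner_ge0.
Qed.

Lemma eigenvalue_gt0 j : 0 < gamma j.
Proof. by apply: lt_le_trans (eigenvalue_ge j); rewrite exprn_gt0. Qed.

Let K := 2 ^+ d * total_mass W V ^+ 2 / H0.

(* Bounding each [e j] separately and using Bessel's inequality for the cells
   avoids linear combinations of the [e j], hence the closability of the
   gradient. *)
Lemma eigenvalue_count (m' N : nat) :
  N%:R <= ((m'.+1 * 2) ^ d)%:R + K / m'.+1%:R ^+ 2 * \sum_(j < N) gamma j.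
Proof.
pose C : finType := {ffun 'I_d -> 'I_m'.+1 * bool}.
pose q (c : C) := normalized_indic (mV V) (cell W V c).
have q2 c : q c \in 'L2[mV V].
  by apply: normalized_indic_L2; exact: measurable_cell.
have grad_le j : \sum_(k < d) inner (mVW W V k) (grad j k) (grad j k) <= gamma j / H0.
  rewrite ler_pdivlMr// mulrC; apply: le_trans (eigenvalue_energy j).
  by rewrite lerDr sqr_ge0.
have step j : 1 <= \sum_(c : C) inner (mV V) (e j) (q c) ^+ 2 +
    K / m'.+1%:R ^+ 2 * gamma j.
  have := gradient_poincare m' (e2 j) (eigen_is_gradient j).
  rewrite eo eqxx => /le_trans; apply; rewrite lerD2l.
  rewrite (_ : K / _ * _ = 2 ^+ d * (total_mass W V / m'.+1%:R) ^+ 2 * (gamma j / H0)).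
    rewrite ler_wpM2l//; last exact: grad_le.
    by rewrite mulr_ge0 ?sqr_ge0// exprn_ge0.
  by rewrite /K; field; rewrite gt_eqF//= pnatr_eq0.
have -> : N%:R = \sum_(j < N) (1 : R) by rewrite sumr_const card_ord.
apply: le_trans (ler_sum _ (fun (j : 'I_N) _ => step j)) _.
rewrite big_split/= -mulr_sumr lerD2r exchange_big/=.
apply: (@le_trans _ _ (\sum_(c : C) (1 : R))).
  apply: ler_sum => c _; apply: (@le_trans _ _ (inner (mV V) (q c) (q c))).
    under eq_bigr do rewrite innerC.
    exact: bessel.
  by apply: inner_normalized_indic; exact: measurable_cell.
by rewrite sumr_const card_ffun card_prod !card_ord card_bool.
Qed.

Hypothesis gamma_nd : {homo gamma : i j / (i <= j)%N >-> i <= j}.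

(** The count is applied with m = 2^p, hence 2^((p + 1) d) cells. The assumption says that j + 1 is
    at least twice this number, so the cells account for at most half of j + 1; as [gamma] is
    nondecreasing, its sum up to [j] is at most (j + 1) [gamma j], and 4^p <= 2 K [gamma j] follows.
    The constant uses [K + 1] since [K] is only shown to be nonnegative. *)
Lemma eigenvalue_growth : exists2 a : R, 0 < a & forall p j : nat,
  (2 ^ (d.+1 + p * d) <= j.+1)%N -> a * 4 ^+ p <= gamma j.
Proof.
have K0 : 0 <= K.
  by rewrite divr_ge0 ?(ltW H0_gt0)// mulr_ge0 ?sqr_ge0// exprn_ge0.
exists (2 * (K + 1))^-1; first by rewrite invr_gt0 mulr_gt0// ltr_wpDl.
move=> p j pj; have p20 : (0 < 2 ^ p)%N by rewrite expn_gt0.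
have := eigenvalue_count (2 ^ p).-1 j.+1; rewrite prednK//.
have sum_le : \sum_(i < j.+1) gamma i <= j.+1%:R * gamma j.
  apply: (@le_trans _ _ (\sum_(i < j.+1) gamma j)).
    by apply: ler_sum => i _; apply: gamma_nd; rewrite -ltnS.
  by rewrite sumr_const card_ord mulr_natl.
set M : R := (((2 ^ p * 2) ^ d)%N)%:R.
have M_le : 2 * M <= j.+1%:R.
  rewrite /M -natrM ler_nat; apply: leq_trans pj.
  by rewrite -expnSr -expnM -expnS leq_exp2l// addSn ltnS mulSn.
have c40 : 0 <= K / (2 ^ p)%:R ^+ 2 by rewrite divr_ge0// sqr_ge0.
move=> hN; have {hN}hN : j.+1%:R <= M + K / (2 ^ p)%:R ^+ 2 * (j.+1%:R * gamma j).
  by apply: le_trans hN _; rewrite lerD2l ler_wpM2l.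
have E4 : (2 ^ p)%:R ^+ 2 = 4 ^+ p :> R.
  by rewrite natrX -exprM mulnC exprM; congr (_ ^+ _); rewrite -natrX.
rewrite E4 in hN.
have j0 : 0 < j.+1%:R :> R by rewrite ltr0n.
have p40 : 0 < 4 ^+ p :> R by rewrite exprn_gt0.
have g0 := eigenvalue_gt0 j.
have : j.+1%:R * 2^-1 <= j.+1%:R * (K / 4 ^+ p * gamma j) by lra.
rewrite ler_pM2l// => h; rewrite mulrC ler_pdivrMr; last by lra.
have : 4 ^+ p <= 2 * K * gamma j.
  rewrite mulrAC ler_pdivlMr// in h; rewrite -[X in X <= _]mul1r; lra.
move=> /le_trans; apply; rewrite mulrC ler_wpM2l//; lra.
Qed.

(** Cut the indices at the [N p]. The block from [N p] to [N p.+1] has at most [N p.+1] terms, a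
    constant times 2^(d p), each bounded by a constant times 4^(- s p). The blocks are thus
    dominated by a geometric series of ratio [q], and [q < 1] says exactly that [s] exceeds d/2. *)
Lemma eigenvalue_summable (s : R) : (0 < d)%N -> d%:R / 2 < s ->
  exists C : R, forall n, \sum_(j < n) gamma j `^ (- s) <= C.
Proof.
move=> d0 ds; have [a a0 ha] := eigenvalue_growth.
have s0 : 0 < s by apply: le_lt_trans ds; rewrite divr_ge0.
pose N p := (2 ^ (d.+1 + p * d))%N.
pose q : R := 2 ^+ d * 4 `^ (- s).
have q0 : 0 < q by rewrite mulr_gt0 ?exprn_gt0// powR_gt0.
have q1 : q < 1.
  rewrite /q (_ : 4 = 2 `^ 2%:R :> R); last by rewrite powR_mulrn// -natrX.
  rewrite -powRrM -powR_mulrn// -powRD; last by apply/implyP.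
  rewrite (_ : d%:R + 2%:R * - s = - (2 * s - d%:R)); last by ring.
  rewrite powRN invf_lt1 ?powR_gt0//.
  have : 1 `^ (2 * s - d%:R) < 2 `^ (2 * s - d%:R) :> R.
    by apply: gt0_ltr_powR; rewrite ?nnegrE ?ltr1n//; lra.
  by rewrite powR1.
pose C1 : R := 2 ^+ (d.+1 + d) * a `^ (- s).
have C10 : 0 <= C1 by rewrite mulr_ge0 ?exprn_ge0// powR_ge0.
have nneg j : 0 <= gamma j `^ (- s) by exact: powR_ge0.
have term p j : (N p <= j.+1)%N -> gamma j `^ (- s) <= a `^ (- s) * (4 `^ (- s)) ^+ p.
  move=> /(ha p) h; rewrite -powR_mulrn ?powR_ge0// -powRrM.
  rewrite [_ * p%:R]mulrC powRrM -powRM ?(ltW a0) ?powR_ge0// powR_mulrn//.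
  rewrite !powRN lef_pV2 ?posrE ?powR_gt0 ?eigenvalue_gt0// ?mulr_gt0 ?exprn_gt0//.
  by rewrite ge0_ler_powR ?nnegrE ?(ltW s0) ?(ltW (eigenvalue_gt0 _))//
    ltW// mulr_gt0// exprn_gt0.
have block p : \sum_(j < N p) gamma j `^ (- s) <=
    \sum_(j < N 0%N) gamma j `^ (- s) + \sum_(i < p) C1 * q ^+ i.
  elim: p => [|p IH]; first by rewrite big_ord0 addr0.
  have NS : (N p <= N p.+1)%N by rewrite leq_exp2l// leq_add2l leq_mul2r leqnSn orbT.
  rewrite -(big_mkord xpredT (fun j => gamma j `^ (- s))).
  rewrite (big_cat_nat (leq0n _) NS)/= big_mkord.
  rewrite big_ord_recr/= addrA lerD//.
  apply: (@le_trans _ _ (\sum_(N p <= i < N p.+1) a `^ (- s) * (4 `^ (- s)) ^+ p)).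
    rewrite big_nat_cond [leRHS]big_nat_cond.
    by apply: ler_sum => i /andP[/andP[h _] _]; apply: term; exact: leqW.
  rewrite sumr_const_nat -[leLHS]mulr_natl.
  apply: (@le_trans _ _ ((N p.+1)%:R * (a `^ (- s) * (4 `^ (- s)) ^+ p))).
    by rewrite ler_wpM2r ?mulr_ge0 ?exprn_ge0 ?powR_ge0// ler_nat leq_subr.
  rewrite /C1 /q /N natrX mulSn addnA exprD exprMn -exprM (mulnC d p).
  by rewrite le_eqVlt; apply/orP; left; apply/eqP; ring.
exists (\sum_(j < N 0%N) gamma j `^ (- s) + C1 / (1 - q)) => n.
apply: (@le_trans _ _ (\sum_(j < N n) gamma j `^ (- s))).
  have nN : (n <= N n)%N.
    rewrite (leq_trans (ltnW (ltn_expl n (ltnSn 1))))// leq_exp2l//.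
    by rewrite (leq_trans _ (leq_addl _ _))// leq_pmulr.
  rewrite -(subnKC nN) big_split_ord/= lerDl.
  by apply: sumr_ge0 => i _; exact: nneg.
apply: le_trans (block n) _; rewrite lerD2l.
have := @geometric_le_lim _ n C1 q C10 q0; rewrite ger0_norm ?(ltW q0)// => /(_ q1).
by rewrite /series/= big_mkord.
Qed.

End eigenvalues.

(** * The solution driven by white noise *)

(* Tannery's theorem with the dominating sequence [a]. *)
Lemma dominated_nneseries_cvg0 {R : realType} (a : nat -> R)
    (r : nat -> nat -> R) (C : R) : (forall j, 0 <= a j) ->
  (forall n, \sum_(j < n) a j <= C) -> (forall j n, 0 <= r j n <= 1) ->
  (forall j, r j n @[n --> \oo] --> 0) ->
  (\sum_(0 <= j <oo) (a j * r j n)%:E)%E @[n --> \oo] --> 0%E.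
Proof.
move=> a0 aC r01 rj.
have r0 j n : 0 <= r j n by have /andP[] := r01 j n.
have r1 j n : r j n <= 1 by have /andP[] := r01 j n.
have ar0 j n : (0 <= (a j * r j n)%:E)%E by rewrite lee_fin mulr_ge0.
have tail : (\sum_(N <= j <oo) (a j)%:E)%E @[N --> \oo] --> 0%E.
  apply: nneseries_tail_cvg => [|k _]; last by rewrite lee_fin.
  by apply: le_lt_trans (ltry C); exact: nneseries_EFin_le.
have pos n : (0 <= \sum_(0 <= j <oo) (a j * r j n)%:E)%E by apply: nneseries_ge0.
have bnd n : (\sum_(0 <= j <oo) (a j * r j n)%:E <= C%:E)%E.
  apply: nneseries_EFin_le => [j|N]; first by rewrite mulr_ge0.
  apply: le_trans (aC N); apply: ler_sum => i _; by rewrite ler_piMr.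
have fin n : (\sum_(0 <= j <oo) (a j * r j n)%:E)%E \is a fin_num.
  by rewrite ge0_fin_numE//; apply: le_lt_trans (bnd n) (ltry _).
apply/fine_cvgP; split; first exact: nearW.
apply/cvgrPdist_le => eps e0.
have e20 : 0 < eps / 2 by rewrite divr_gt0.
have [J HJ] : exists J : nat, (\sum_(J <= j <oo) (a j)%:E <= (eps / 2)%:E)%E.
  have /fine_cvgP[[N1 _ fin1] /cvgrPdist_le /(_ _ e20)[N2 _ HN]] := tail.
  exists (maxn N1 N2); rewrite -[leLHS]fineK; last exact: fin1 (leq_maxl _ _).
  rewrite lee_fin; have /= := HN _ (leq_maxr N1 N2).
  by rewrite sub0r normrN => /(le_trans (ler_norm _)).
have head : \sum_(j < J) a j * r j n @[n --> \oo] --> 0.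
  rewrite [X in _ --> X](_ : 0 = \sum_(j < J) (a j * 0)); last first.
    by rewrite big1// => i _; rewrite mulr0.
  apply: cvg_big => [|j _]; first exact: add_continuous.
  exact: cvgMl_tmp.
have /cvgrPdist_le /(_ _ e20)[N _ HN] := head.
exists N => // n /= Nn; rewrite sub0r normrN ger0_norm ?fine_ge0//.
rewrite -lee_fin fineK// (nneseries_split 0 J)// add0n big_mkord.
rewrite [eps]splitr EFinD leeD//.
  rewrite sumEFin lee_fin; have := HN n Nn.
  by rewrite sub0r normrN => /(le_trans (ler_norm _)).
apply: le_trans HJ; apply: lee_nneseries => [j _ _|j _]; first exact: ar0.
by rewrite lee_fin ler_piMr.
Qed.

(** * Random elements of L^2 through their coordinates *)

Section random_elements.
Context {dO : measure_display} {Omega : measurableType dO} {R : realType}.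
Variable P : probability Omega R.
Context {dX : measure_display} {X : measurableType dX}.
Variable mu : {measure set X -> \bar R}.
Variable e : nat -> X -> R.
Hypothesis e_basis : orthonormal_basis mu e.

Let e2 j : e j \in 'L2[mu]. Proof. by case: e_basis. Qed.

Lemma norm2_sqr_parseval f : f \in 'L2[mu] ->
  (norm2 mu f ^+ 2 = \sum_(0 <= j <oo) (inner mu f (e j) ^+ 2)%:E)%E.
Proof. by move=> f2; rewrite norm2_inner// (parseval_sqr e_basis). Qed.

(** By Parseval the squared norm is a countable sum of squared coordinates, so weak measurability
    along the basis suffices. *)
Lemma measurable_norm2_sqr (U : Omega -> X -> R) :
  (forall w, U w \in 'L2[mu]) ->
  (forall j, measurable_fun setT (fun w => inner mu (U w) (e j))) ->
  measurable_fun setT (fun w => norm2 mu (U w) ^+ 2)%E.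
Proof.
move=> U2 mU.
rewrite (_ : (fun w => _) =
    (fun w => \sum_(0 <= j <oo) (inner mu (U w) (e j) ^+ 2)%:E)%E).
  apply: ge0_emeasurable_sum => [j w _ _|j _]; first by rewrite lee_fin sqr_ge0.
  by apply/measurable_EFinP; exact: measurable_funX.
by apply/funext => w; rewrite norm2_sqr_parseval.
Qed.

Lemma measurable_inner_basis (U : Omega -> X -> R) :
  (forall w, U w \in 'L2[mu]) ->
  (forall j, measurable_fun setT (fun w => inner mu (U w) (e j))) ->
  forall h, h \in 'L2[mu] -> measurable_fun setT (fun w => inner mu (U w) h).
Proof.
move=> U2 mU h h2; apply: (@measurable_fun_cvg _ _ _ _
  (fun n w => \sum_(j < n) inner mu (U w) (e j) * inner mu h (e j))).
  move=> n; apply: measurable_sum => j.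
  by apply: measurable_funM; [exact: mU|exact: measurable_cst].
move=> w _; have := parseval e_basis (U2 w) h2.
by rewrite seriesEord.
Qed.

End random_elements.

(** * Fractional powers in spectral coordinates *)

Section powers.
Context {R : realType} {d : nat}.
Variable V : 'I_d -> V_function R.
Local Notation X := (d.-tuple R).
Local Notation mu := (mV V).
Variables (e : nat -> X -> R) (gamma : nat -> R) (g0 : R).
Hypothesis e_basis : orthonormal_basis mu e.
Hypotheses (g0_gt0 : 0 < g0) (gamma_ge : forall j, g0 <= gamma j).
Implicit Types (f g h : X -> R).

Let e2 j : e j \in 'L2[mu]. Proof. by case: e_basis. Qed.
Let eo i j : inner mu (e i) (e j) = (i == j)%:R. Proof. by case: e_basis. Qed.

Let gamma0 j : 0 < gamma j.
Proof. exact: lt_le_trans (gamma_ge j). Qed.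

Lemma is_power_exists r f : r <= 0 -> f \in 'L2[mu] ->
  is_power V e gamma r f (power V e gamma r f).
Proof.
move=> r0 f2; rewrite /power.
suff [g hg] : exists g, is_power V e gamma r f g.
  exact: (xgetPex _ (ex_intro _ g hg)).
pose a j := gamma j `^ r * inner mu f (e j).
have [|g [g2 ga _]] := @riesz_fischer _ _ _ _ e e2 eo a
    ((g0 `^ r) ^+ 2 * inner mu f f); last by exists g.
move=> n; apply: (@le_trans _ _ (\sum_(j < n) (g0 `^ r) ^+ 2 * inner mu f (e j) ^+ 2)).
  apply: ler_sum => j _; rewrite exprMn ler_wpM2r ?sqr_ge0//.
  rewrite ler_sqr ?nnegrE ?powR_ge0// -[r]opprK !(powRN _ (- r)).
  rewrite lef_pV2 ?posrE ?powR_gt0// ge0_ler_powR ?nnegrE ?oppr_ge0//; exact: ltW.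
by rewrite -mulr_sumr ler_wpM2l ?sqr_ge0//; exact: bessel.
Qed.

(** Self-adjointness of the powers: in Parseval's series the factors of exponents r and - r cancel
    term by term. *)
Lemma is_power_inner r f g h k : is_power V e gamma r f g ->
  is_power V e gamma (- r) h k -> inner mu g k = inner mu f h.
Proof.
move=> [f2 g2 fg] [h2 k2 hk].
have H1 := parseval e_basis g2 k2; have H2 := parseval e_basis f2 h2.
apply: (cvg_unique _ H1); first exact: norm_hausdorff.
rewrite [X in series X](_ : _ = fun i => inner mu f (e i) * inner mu h (e i))//.
apply/funext => j; rewrite fg hk mulrACA -powRD ?subrr; last first.
  by apply/implyP => _; exact: lt0r_neq0.
by rewrite powRr0 mul1r.
Qed.

Lemma is_power_basis r j : is_power V e gamma (- r) (fun x => gamma j `^ r * e j x) (e j).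
Proof.
split; [exact: L2_scale|exact: e2|] => i; rewrite innerZl// eo.
have [->|ij] := eqVneq i j; rewrite ?mulr0 ?eqxx//.
  rewrite mulr1 -powRD ?addNr ?powRr0//.
  by apply/implyP => _; exact: lt0r_neq0.
Qed.

End powers.

(** * White noise as an isometry into L^2(P) *)

Section white_noise.
Context {dO : measure_display} {Omega : measurableType dO} {R : realType}.
Variable P : probability Omega R.
Context {dX : measure_display} {X : measurableType dX}.
Variable mu : {measure set X -> \bar R}.
Variables (B : (X -> R) -> Omega -> R).
Hypothesis B_noise : isonormal P mu B.
Implicit Types f g h : X -> R.

Lemma noise_gaussian h : h \in 'L2[mu] -> centered_gaussian P (B h).
Proof.
move=> h2; have [/(_ 1%N (fun=> h) (fun=> 1) (fun=> h2)) + _] := B_noise.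
by rewrite (_ : (fun w => _) = B h)//; apply/funext => w; rewrite big_ord1 mul1r.
Qed.

Lemma measurable_noise h : h \in 'L2[mu] -> measurable_fun setT (B h).
Proof. by move/noise_gaussian => []. Qed.

Lemma noise_L2 h : h \in 'L2[mu] -> B h \in 'L2[P].
Proof.
move=> h2; apply/L2P; split; first exact: measurable_noise.
have [_ /(_ h h h2 h2)] := B_noise; rewrite unlock => E.
by under eq_integral do rewrite expr2; rewrite E ltry.
Qed.

Lemma inner_noise g h : g \in 'L2[mu] -> h \in 'L2[mu] ->
  inner P (B g) (B h) = inner mu g h.
Proof.
move=> g2 h2; have [_ /(_ g h g2 h2)] := B_noise; rewrite unlock => E.
by rewrite /inner /Rintegral E.
Qed.

Variable nu : nat -> X -> R.
Hypothesis nu_basis : orthonormal_basis mu nu.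

Let nu2 j : nu j \in 'L2[mu]. Proof. by case: nu_basis. Qed.
Let nuo i j : inner mu (nu i) (nu j) = (i == j)%:R. Proof. by case: nu_basis. Qed.

Definition noise_expansion h n : Omega -> R :=
  partial_sum (fun i => B (nu i)) (fun i => inner mu h (nu i)) n.

Lemma noise_expansion_L2 h n : noise_expansion h n \in 'L2[P].
Proof. by apply: L2_partial_sum => i; exact: noise_L2. Qed.

(** Only covariances enter: the [B (nu i)] are orthonormal in L^2(P), and the coefficient of [B h]
    along [B (nu i)] is [inner mu h (nu i)]. This makes the expansion available although [B] is not
    given as a linear map. *)
Lemma sqdist_noise_expansion h n : h \in 'L2[mu] ->
  sqdist P (B h) (noise_expansion h n) =
  inner mu h h - \sum_(i < n) inner mu h (nu i) ^+ 2.
Proof.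
move=> h2; have BE i : inner P (B h) (B (nu i)) = inner mu h (nu i).
  exact: inner_noise.
rewrite /noise_expansion (_ : (fun i => inner mu h (nu i)) =
   (fun i => inner P (B h) (B (nu i)))); last by apply/funext => i; rewrite BE.
rewrite (@sqdist_partial_sum _ _ _ P (fun i => B (nu i)))//.
- by rewrite inner_noise//; under eq_bigr do rewrite BE.
- by move=> i; exact: noise_L2.
- by move=> i j; rewrite inner_noise.
- exact: noise_L2.
Qed.

Lemma sqdist_noise_expansion_cvg h : h \in 'L2[mu] ->
  sqdist P (B h) (noise_expansion h n) @[n --> \oo] --> 0.
Proof.
move=> h2; have SE n := sqdist_noise_expansion n h2.
suff : inner mu h h - \sum_(i < n) inner mu h (nu i) ^+ 2 @[n --> \oo] -->
    inner mu h h - inner mu h h.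
  by rewrite subrr; apply: cvg_trans; apply: near_eq_cvg; apply: nearW => n.
apply: cvgB; first exact: cvg_cst.
apply: cvg_trans (parseval nu_basis h2 h2); apply: near_eq_cvg.
apply: nearW => n; rewrite seriesEord/=.
by apply: eq_bigr => i _; rewrite expr2.
Qed.

End white_noise.

Lemma expe2_le {R : realType} (x y : \bar R) :
  (0 <= x -> x <= y -> x ^+ 2 <= y ^+ 2)%E.
Proof. by move=> x0 xy; rewrite !expe2; apply: lee_pmul. Qed.

Lemma centered_gaussian_ae {dO : measure_display} {Omega : measurableType dO}
    {R : realType} (P : probability Omega R) (Y Z : Omega -> R) :
  measurable_fun setT Z -> {ae P, forall w, Z w = Y w} ->
  centered_gaussian P Y -> centered_gaussian P Z.
Proof.
move=> mZ ZY [mY [sigma sigma0 hY]]; split => //; exists sigma => // A mA.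
rewrite -hY//.
have mYA : measurable (Y @^-1` A) by rewrite -[X in measurable X]setTI; exact: mY.
have mZA : measurable (Z @^-1` A) by rewrite -[X in measurable X]setTI; exact: mZ.
have PE D : measurable D -> P D = (\int[P]_w (\1_D w)%:E)%E.
  by move=> mD; rewrite integral_indic// setIT.
rewrite !PE//.
apply: ge0_ae_eq_integral => //.
- by apply/measurable_EFinP; exact: measurable_indic.
- by apply/measurable_EFinP; exact: measurable_indic.
- apply: filterS ZY => w ZYw _; rewrite !indicE.
  rewrite (_ : (w \in Z @^-1` A) = (w \in Y @^-1` A))//.
  by apply/idP/idP => /set_mem wA; apply/mem_set; move: wA; rewrite /preimage/= ZYw.
Qed.

(** * Properties, uniqueness and existence of the solution *)

Section solution.
Context {R : realType} {d : nat}.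
Variable V : 'I_d -> V_function R.
Local Notation X := (d.-tuple R).
Local Notation mu := (mV V).
Variables (e : nat -> X -> R) (gamma : nat -> R) (g0 : R).
Hypothesis e_basis : orthonormal_basis mu e.
Hypotheses (g0_gt0 : 0 < g0) (gamma_ge : forall j, g0 <= gamma j).
Context {dO : measure_display} {Omega : measurableType dO}.
Variable P : probability Omega R.
Variable B : (X -> R) -> Omega -> R.
Hypothesis B_noise : isonormal P mu B.
Variable nu : nat -> X -> R.
Hypothesis nu_basis : orthonormal_basis mu nu.
Variables (beta C : R).
Hypothesis beta_ge0 : 0 <= beta.
Hypothesis trace_class : forall n, \sum_(j < n) gamma j `^ (- (2 * beta)) <= C.
Implicit Types (f g h phi psi : X -> R).

Let e2 j : e j \in 'L2[mu]. Proof. by case: e_basis. Qed.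
Let eo i j : inner mu (e i) (e j) = (i == j)%:R. Proof. by case: e_basis. Qed.
Let nu2 j : nu j \in 'L2[mu]. Proof. by case: nu_basis. Qed.
Let nuo i j : inner mu (nu i) (nu j) = (i == j)%:R. Proof. by case: nu_basis. Qed.
Let gamma0 j : 0 < gamma j.
Proof. exact: lt_le_trans (gamma_ge j). Qed.

Let T := power V e gamma (- beta).
Let a j := gamma j `^ (- (2 * beta)).

Let a_ge0 j : 0 <= a j. Proof. exact: powR_ge0. Qed.

Let aE j : a j = gamma j `^ (- beta) ^+ 2.
Proof.
by rewrite /a -powR_mulrn ?powR_ge0// -powRrM; congr (_ `^ _); ring.
Qed.

Lemma inverse_power f : f \in 'L2[mu] -> is_power V e gamma (- beta) f (T f).
Proof.
by move=> f2; apply: (is_power_exists e_basis g0_gt0 gamma_ge) => //; rewrite oppr_le0.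
Qed.

Lemma inverse_power_L2 f : f \in 'L2[mu] -> T f \in 'L2[mu].
Proof. by case/inverse_power. Qed.

(** The Hilbert-Schmidt norm is compared with its value in the basis [e]. The coefficient of
    [T (nu i)] along [e j] is that of [nu i] times gamma_j^(- beta); after the finite sums over [i]
    and [j] are exchanged, Bessel's inequality for [e j] along [nu] leaves the partial sums of
    [a j]. *)
Lemma hilbert_schmidt :
  (\sum_(0 <= i <oo) norm2 mu (T (nu i)) ^+ 2 < +oo)%E.
Proof.
have Tnu2 i := inverse_power_L2 (nu2 i).
rewrite (eq_eseriesr (g := fun i => (inner mu (T (nu i)) (T (nu i)))%:E)); last first.
  by move=> i _; rewrite norm2_inner.
apply: (@le_lt_trans _ _ C%:E); last exact: ltry.
apply: nneseries_EFin_le => [j|n]; first exact: inner_ge0.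
have cvgS : \sum_(i < n) series (fun j => inner mu (T (nu i)) (e j) *
    inner mu (T (nu i)) (e j)) m @[m --> \oo] -->
    \sum_(i < n) inner mu (T (nu i)) (T (nu i)).
  apply: cvg_big => [|i _]; first exact: add_continuous.
  exact: parseval.
apply: (@ler_cvg_to _ \oo _ _ _ (fun=> C) _ _ cvgS); first exact: cvg_cst.
apply: nearW => m; apply: le_trans (trace_class m).
under eq_bigr do rewrite seriesEord/=.
rewrite exchange_big/=; apply: ler_sum => j _.
rewrite (eq_bigr (fun i : 'I_n => a j * inner mu (e j) (nu i) ^+ 2)); last first.
  move=> i _; have [_ _ ->] := inverse_power (nu2 i).
  by rewrite aE (innerC mu (e j)); ring.
rewrite -mulr_sumr ler_piMr//.
by have := bessel nu2 nuo n (e2 j); rewrite eo eqxx.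
Qed.

Let S n w : X -> R := fun x => \sum_(i < n) B (nu i) w * T (nu i) x.

Let S2 n w : S n w \in 'L2[mu].
Proof. by apply: L2_sum => i _; apply: L2_scale; exact: inverse_power_L2. Qed.

Let inner_S n w h : h \in 'L2[mu] ->
  inner mu (S n w) h = \sum_(i < n) B (nu i) w * inner mu (T (nu i)) h.
Proof.
move=> h2; rewrite inner_suml//; last first.
  by move=> i; apply: L2_scale; exact: inverse_power_L2.
by apply: eq_bigr => i _; rewrite innerZl//; exact: inverse_power_L2.
Qed.

Let measurable_inner_S n h : h \in 'L2[mu] ->
  measurable_fun setT (fun w => inner mu (S n w) h).
Proof.
move=> h2; rewrite (_ : (fun w => _) =
  fun w => \sum_(i < n) B (nu i) w * inner mu (T (nu i)) h); last first.
  by apply/funext => w; exact: inner_S.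
apply: measurable_sum => i; apply: measurable_funM; last exact: measurable_cst.
exact: (measurable_noise B_noise).
Qed.

(* For [psi = L^beta phi] the truncations of [<u, psi>] are those of [B phi]. *)
Let inner_S_power n w phi psi : is_power V e gamma beta phi psi ->
  inner mu (S n w) psi = noise_expansion mu B nu phi n w.
Proof.
move=> hp; have [phi2 psi2 _] := hp; rewrite inner_S//.
apply: eq_bigr => i _; rewrite mulrC; congr (_ * _).
rewrite (innerC mu phi).
apply: (is_power_inner e_basis g0_gt0 gamma_ge (inverse_power (nu2 i))).
by rewrite opprK.
Qed.

Let is_power_e j : is_power V e gamma beta (fun x => gamma j `^ (- beta) * e j x) (e j).
Proof.
by rewrite -[X in is_power _ _ _ X]opprK; exact: (is_power_basis e_basis g0_gt0 gamma_ge).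
Qed.

Section properties.
Variable u : Omega -> X -> R.
Hypothesis u_noise : noise_image P mu B nu T u.

Let u2 w : u w \in 'L2[mu]. Proof. by case: u_noise => [[]]. Qed.
Let mu_ h : h \in 'L2[mu] -> measurable_fun setT (fun w => inner mu (u w) h).
Proof. by case: u_noise => [[_ + _] _]; apply. Qed.

Let mu_sub n : measurable_fun setT
  (fun w => norm2 mu (fun x => (u w x - S n w x)%R) ^+ 2)%E.
Proof.
apply: (measurable_norm2_sqr e_basis) => [w|j]; first exact: L2_sub.
under eq_fun do rewrite innerBl//.
by apply: measurable_funB; [exact: mu_|exact: measurable_inner_S].
Qed.

Lemma inner_solution_L2 h : h \in 'L2[mu] -> (fun w => inner mu (u w) h) \in 'L2[P].
Proof.
move=> h2; apply/L2P; split; first exact: mu_.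
have [[_ _ ufin] _] := u_noise.
apply: (@le_lt_trans _ _ (\int[P]_w ((inner mu h h)%:E * norm2 mu (u w) ^+ 2))%E).
  apply: ge0_le_integral_nomeas => w; first by rewrite lee_fin sqr_ge0.
  by rewrite norm2_inner// -EFinM lee_fin mulrC cauchy_schwarz.
rewrite ge0_integralZl//.
- by rewrite lte_mul_pinfty// lee_fin inner_ge0.
- by apply: (measurable_norm2_sqr e_basis) => // j; exact: mu_.
- by move=> w _; rewrite norm2_inner// lee_fin inner_ge0.
- by rewrite lee_fin inner_ge0.
Qed.

(** Both sides are limits in L^2(P) of the same sequence [N n]: the left one by Cauchy-Schwarz
    applied to the convergence of the truncations, the right one by Parseval. *)
Lemma inner_solution phi psi : is_power V e gamma beta phi psi ->
  {ae P, forall w, inner mu (u w) psi = B phi w}.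
Proof.
move=> hp; have [phi2 psi2 _] := hp; have [_ u_cvg] := u_noise.
pose Y w := inner mu (u w) psi.
have Y2 : Y \in 'L2[P] by exact: inner_solution_L2.
have B2 : B phi \in 'L2[P] by exact: (noise_L2 B_noise).
pose N n := noise_expansion mu B nu phi n.
have N2 n : N n \in 'L2[P] by exact: (noise_expansion_L2 B_noise nu_basis).
have YN_le n : ((sqdist P Y (N n))%:E <= (inner mu psi psi)%:E *
    \int[P]_w norm2 mu (fun x => (u w x - S n w x)%R) ^+ 2)%E.
  rewrite -sqdist_integral//.
  rewrite -ge0_integralZl//; last 2 first.
  - by move=> w _; rewrite norm2_sqr; apply: integral_ge0 => x _; rewrite lee_fin sqr_ge0.
  - by rewrite lee_fin inner_ge0.
  apply: ge0_le_integral_nomeas => w; first by rewrite lee_fin sqr_ge0.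
  rewrite norm2_inner ?L2_sub// -EFinM lee_fin mulrC.
  rewrite /Y /N -(inner_S_power n w hp) -innerBl//.
  by apply: cauchy_schwarz => //; exact: L2_sub.
have YN : sqdist P Y (N n) @[n --> \oo] --> 0.
  have : ((inner mu psi psi)%:E *
      \int[P]_w norm2 mu (fun x => (u w x - S n w x)%R) ^+ 2)%E @[n --> \oo] --> 0%E.
    by rewrite -(mule0 (inner mu psi psi)%:E); apply: cvgeZl.
  move=> H; have : (sqdist P Y (N n))%:E @[n --> \oo] --> 0%E.
    apply: (squeeze_cvge _ (cvg_cst 0%E) H); apply: nearW => n.
    by rewrite lee_fin sqdist_ge0/=; exact: YN_le.
  by move=> /fine_cvgP[_].
have BN := sqdist_noise_expansion_cvg B_noise nu_basis phi2.
have YB : sqdist P Y (B phi) = 0.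
  apply/le_anti; rewrite sqdist_ge0 andbT.
  apply: (@ler_cvg_to _ \oo _ _ (fun=> sqdist P Y (B phi))
    (fun n => 2 * sqdist P Y (N n) + 2 * sqdist P (B phi) (N n))).
  - exact: cvg_cst.
  - rewrite (_ : 0 = 2 * 0 + 2 * 0); last by rewrite mulr0 addr0.
    by apply: cvgD; apply: cvgMl_tmp.
  - apply: nearW => n; rewrite (sqdistC P (B phi)).
    exact: inner_sqr_triangle.
apply: filterS (inner_sqr_eq0 (L2_sub Y2 B2) YB) => w /eqP.
by rewrite subr_eq0 => /eqP.
Qed.

(** Every [h] is the power [beta] of [T h], so all pairings of [u] are values of [B], from which
    Gaussianity and covariance are inherited. *)
Lemma inner_solution_inverse_power h : h \in 'L2[mu] ->
  {ae P, forall w, inner mu (u w) h = B (T h) w}.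
Proof.
move=> h2; apply: inner_solution; split => //; first exact: inverse_power_L2.
move=> j; have [_ _ ->] := inverse_power h2.
rewrite mulrA -powRD ?subrr ?powRr0 ?mul1r//.
by apply/implyP => _; exact: lt0r_neq0.
Qed.

Lemma solution_gaussian h : h \in 'L2[mu] ->
  centered_gaussian P (fun w => inner mu (u w) h).
Proof.
move=> h2; apply: (centered_gaussian_ae (mu_ h2) (inner_solution_inverse_power h2)).
exact/(noise_gaussian B_noise)/inverse_power_L2.
Qed.

(** The expectation is that of [B (T g)] times [B (T h)], namely [inner mu (T g) (T h)]; in
    coordinates the two factors gamma_j^(- beta) merge into one of exponent - 2 beta. *)
Lemma solution_covariance g h : g \in 'L2[mu] -> h \in 'L2[mu] ->
  ('E_P[fun w => (inner mu (u w) g * inner mu (u w) h)%R] =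
   (inner mu (power V e gamma (- (2 * beta)) g) h)%:E)%E.
Proof.
move=> g2 h2; rewrite unlock.
have [_ Lg2 Lg] : is_power V e gamma (- (2 * beta)) g
    (power V e gamma (- (2 * beta)) g).
  apply: (is_power_exists e_basis g0_gt0 gamma_ge) => //.
  by rewrite oppr_le0 mulr_ge0.
have -> : (\int[P]_w (inner mu (u w) g * inner mu (u w) h)%:E =
    (inner P (B (T g)) (B (T h)))%:E)%E.
  have L2u k : k \in 'L2[mu] -> (fun w => inner mu (u w) k) \in 'L2[P].
    exact: inner_solution_L2.
  have BT2 k : k \in 'L2[mu] -> B (T k) \in 'L2[P].
    by move=> k2; apply: (noise_L2 B_noise); exact: inverse_power_L2.
  rewrite /inner /Rintegral fineK; last first.
    by apply: integrable_fin_num => //; apply: L2_integrableM; exact: BT2.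
  apply: ae_eq_integral => //.
  - exact: measurable_int (L2_integrableM (L2u _ g2) (L2u _ h2)).
  - exact: measurable_int (L2_integrableM (BT2 _ g2) (BT2 _ h2)).
  - have := inner_solution_inverse_power h2.
    apply: filterS2 (inner_solution_inverse_power g2) => w hg hh _.
    by rewrite -[LHS]/((inner mu (u w) g * inner mu (u w) h)%:E) hg hh.
rewrite (inner_noise B_noise) ?inverse_power_L2//; congr EFin.
have [_ Tg2 Tg] := inverse_power g2; have [_ Th2 Th] := inverse_power h2.
have H1 := parseval e_basis Tg2 Th2; have H2 := parseval e_basis Lg2 h2.
apply: (cvg_unique _ H1); first exact: norm_hausdorff.
rewrite [X in series X](_ : _ = fun i =>
   inner mu (power V e gamma (- (2 * beta)) g) (e i) * inner mu h (e i))//.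
by apply/funext => j; rewrite Tg Th Lg -/(a j) aE; ring.
Qed.

Lemma inner_solution_basis_sqr j :
  (\int[P]_w (inner mu (u w) (e j) ^+ 2)%:E = (a j)%:E)%E.
Proof.
have ej2 := inner_solution_L2 (e2 j).
rewrite L2_inner//; congr EFin.
have := solution_covariance (e2 j) (e2 j); rewrite unlock => H.
rewrite /inner /Rintegral [X in fine X]H /=.
have [_ _ ->] : is_power V e gamma (- (2 * beta)) (e j)
    (power V e gamma (- (2 * beta)) (e j)).
  apply: (is_power_exists e_basis g0_gt0 gamma_ge) => //.
  by rewrite oppr_le0 mulr_ge0.
by rewrite eo eqxx mulr1.
Qed.

(** For [0 <= r] the expectation is computed term by term: each squared coordinate has mean [a j],
    which leaves the series of gamma_j^(r - 2 beta). For [r < 0] the norm is a dual norm, dominated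
    by a multiple of the L^2 norm because the eigenvalues stay above [g0]. *)
Lemma solution_Hdot_integrable r (Cr : R) :
  (forall n, \sum_(j < n) gamma j `^ (r - 2 * beta) <= Cr) ->
  {ae P, forall w, Hdot V e gamma r (u w)} /\
  (\int[P]_w Hdot_norm V e gamma r (u w) ^+ 2 < +oo)%E.
Proof.
move=> Cr_ge; have [[_ _ ufin] _] := u_noise.
have u_ge0 w : (0 <= norm2 mu (u w))%E by exact: Lnorm_ge0.
have mnorm : measurable_fun setT (fun w => norm2 mu (u w) ^+ 2)%E.
  by apply: (measurable_norm2_sqr e_basis) => // j; exact: mu_.
have [r0|r0] := leP 0 r.
  pose Z w := (\sum_(0 <= j <oo) (gamma j `^ r * inner mu (u w) (e j) ^+ 2)%:E)%E.
  have t0 j w : (0 <= (gamma j `^ r * inner mu (u w) (e j) ^+ 2)%:E)%E.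
    by rewrite lee_fin mulr_ge0 ?sqr_ge0 ?powR_ge0.
  have Z0 w : (0 <= Z w)%E by apply: nneseries_ge0.
  have mt j : measurable_fun setT
      (fun w => (gamma j `^ r * inner mu (u w) (e j) ^+ 2)%:E).
    apply/measurable_EFinP; apply: measurable_funM; first exact: measurable_cst.
    by apply: measurable_funX; exact: mu_.
  have mZ : measurable_fun setT Z by apply: ge0_emeasurable_sum.
  have ZE w : (Hdot_norm V e gamma r (u w) ^+ 2 = Z w)%E.
    rewrite /Hdot_norm r0 /Hdot_norm_ge0 -poweR2_expe ?poweR_ge0//.
    by rewrite -poweRrM mulVf ?pnatr_eq0// poweRe1//; exact: Z0.
  have IZ : (\int[P]_w Z w < +oo)%E.
    rewrite integral_nneseries//; apply: le_lt_trans (ltry Cr).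
    rewrite (eq_eseriesr (g := fun j => (gamma j `^ (r - 2 * beta))%:E)); last first.
      move=> j _; under eq_integral do rewrite EFinM.
      rewrite ge0_integralZl//.
      - rewrite inner_solution_basis_sqr -EFinM /a -powRD//.
        by apply/implyP => _; exact: lt0r_neq0.
      - by apply/measurable_EFinP; apply: measurable_funX; exact: mu_.
      - by move=> w _; rewrite lee_fin sqr_ge0.
      - by rewrite lee_fin powR_ge0.
    by apply: nneseries_EFin_le => // j; exact: powR_ge0.
  split; last by under eq_integral do rewrite ZE.
  have Zint : P.-integrable setT Z.
    apply/integrableP; split => //; rewrite (le_lt_trans _ IZ)//.
    by apply: ge0_le_integral_nomeas => w //; rewrite gee0_abs.
  apply: filterS (integrable_ae measurableT Zint) => w /(_ I) Zw.
  split => //; rewrite /Hdot_norm r0 /Hdot_norm_ge0 poweR_lty//.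
  by rewrite -/(Z w) -ge0_fin_numE.
pose M := Num.sqrt ((g0 `^ (- r))^-1).
have gr0 : 0 < g0 `^ (- r) by exact: powR_gt0.
have norm_le w : (Hdot_norm V e gamma r (u w) <= M%:E * norm2 mu (u w))%E.
  rewrite /Hdot_norm (lt_geF r0); apply: ge_ereal_sup => _ [phi [phi2 phi1] <-].
  rewrite norm2E// -EFinM lee_fin -sqrtr_sqr -sqrtrM ?invr_ge0 ?(ltW gr0)//.
  rewrite ler_wsqrtr// mulrC; apply: le_trans (cauchy_schwarz (u2 w) phi2) _.
  rewrite ler_wpM2l ?inner_ge0//.
  have {}phi1 : (\sum_(0 <= j <oo) (gamma j `^ (- r) * inner mu phi (e j) ^+ 2)%:E <= 1)%E.
    have p0 : (0 <= \sum_(0 <= j <oo) (gamma j `^ (- r) * inner mu phi (e j) ^+ 2)%:E)%E.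
      by apply: nneseries_ge0 => j _ _; rewrite lee_fin mulr_ge0 ?powR_ge0 ?sqr_ge0.
    have := expe2_le (poweR_ge0 _ _) phi1.
    rewrite -poweR2_expe ?poweR_ge0// -poweRrM mulVf ?pnatr_eq0// poweRe1//.
    by rewrite expe2 mul1e.
  rewrite -[leRHS]mul1r ler_pdivlMr// mulrC -lee_fin.
  apply: le_trans phi1; rewrite EFinM -(parseval_sqr e_basis phi2).
  rewrite -nneseriesZl//; last by move=> j _; rewrite lee_fin sqr_ge0.
  apply: lee_nneseries => [j _ _|j _]; first
    by rewrite -EFinM lee_fin mulr_ge0 ?sqr_ge0 ?(ltW gr0).
  rewrite -EFinM lee_fin ler_wpM2r ?sqr_ge0// ge0_ler_powR ?nnegrE ?(ltW g0_gt0)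
    ?(ltW (gamma0 _)) ?oppr_ge0//.
  exact: ltW.
have Hdot0 w : (0 <= Hdot_norm V e gamma r (u w))%E.
  rewrite /Hdot_norm (lt_geF r0); apply: ereal_sup_ubound.
  exists (fun=> 0); last by rewrite innerC inner0l normr0.
  split; first exact: L2_0.
  rewrite /Hdot_norm_ge0 eseries0 ?poweR0r ?invr_neq0 ?pnatr_eq0// => j _ _.
  by rewrite inner0l expr0n mulr0.
split.
  apply: aeW => w; split => //; apply: le_lt_trans (norm_le w) _.
  by rewrite norm2E// -EFinM ltry.
apply: (@le_lt_trans _ _ (\int[P]_w ((M ^+ 2)%:E * norm2 mu (u w) ^+ 2))%E).
  (* The dual norm is a supremum whose measurability is not established; monotonicity for
     nonnegative functions bounds its integral nevertheless. *)
  apply: ge0_le_integral_nomeas => w; first by rewrite expe2 mule_ge0.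
  apply: le_trans (expe2_le (Hdot0 w) (norm_le w)) _.
  by rewrite norm2E// !expe2 -!EFinM expr2 lee_fin mulrACA.
rewrite ge0_integralZl//.
- by rewrite lte_mul_pinfty// lee_fin sqr_ge0.
- by move=> w _; rewrite expe2 mule_ge0.
- by rewrite lee_fin sqr_ge0.
Qed.

End properties.

(** Each coordinate along [e j] is almost surely prescribed by [B], and the countably many
    exceptional sets are discarded together. *)
Lemma solution_unique u u' : noise_image P mu B nu T u -> noise_image P mu B nu T u' ->
  {ae P, forall w, {ae mu, forall x, u w x = u' w x}}.
Proof.
move=> hu hu'.
have H : {ae P, forall w, forall j, inner mu (u w) (e j) = inner mu (u' w) (e j)}.
  apply: ae_foralln => j.
  apply: filterS2 (inner_solution hu (is_power_e j)) (inner_solution hu' (is_power_e j)).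
  by move=> w -> ->.
apply: filterS H => w hw.
have [[u2 _ _] _] := hu; have [[u'2 _ _] _] := hu'.
have E := basis_sqdist_eq0 e_basis (u2 w) (u'2 w) hw.
apply: filterS (inner_sqr_eq0 (L2_sub (u2 w) (u'2 w)) E) => x /eqP.
by rewrite subr_eq0 => /eqP.
Qed.

Lemma solution_exists : exists u, noise_image P mu B nu T u.
Proof.
pose c j w := gamma j `^ (- beta) * B (e j) w.
have Be2 j : B (e j) \in 'L2[P] by exact: (noise_L2 B_noise).
have mB j : measurable_fun setT (B (e j)) by exact: L2_measurable (Be2 j).
have mc j : measurable_fun setT (c j).
  by apply: measurable_funM => //; exact: measurable_cst.
pose Z w := (\sum_(0 <= j <oo) (c j w ^+ 2)%:E)%E.
have Z0 w : (0 <= Z w)%E by apply: nneseries_ge0 => j _ _; rewrite lee_fin sqr_ge0.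
have mc2 j : measurable_fun setT (fun w => (c j w ^+ 2)%:E).
  by apply/measurable_EFinP; exact: measurable_funX.
have mZ : measurable_fun setT Z.
  by apply: ge0_emeasurable_sum => // j w _ _; rewrite lee_fin sqr_ge0.
have IZ : (\int[P]_w Z w < +oo)%E.
  rewrite integral_nneseries//; last by move=> j w _; rewrite lee_fin sqr_ge0.
  apply: le_lt_trans (ltry C).
  rewrite (eq_eseriesr (g := fun j => (a j)%:E)); last first.
    move=> j _; rewrite L2_inner; last exact: L2_scale.
    rewrite innerZl ?L2_scale// innerZr// (inner_noise B_noise)// eo eqxx mulr1.
    by rewrite aE expr2.
  exact: nneseries_EFin_le.
pose A := [set w | (Z w < +oo)%E].
have mA : measurable A by rewrite -[A]setTI; exact: emeasurable_fun_infty_o.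
have aeA : {ae P, forall w, A w}.
  have Zint : P.-integrable setT Z.
    apply/integrableP; split => //; rewrite (le_lt_trans _ IZ)//.
    by apply: ge0_le_integral_nomeas => w //; rewrite gee0_abs.
  apply: filterS (integrable_ae measurableT Zint) => w /(_ I) Zw.
  by rewrite /A/= -ge0_fin_numE.
(* The function is chosen separately for each [w], with zero coordinates outside [A]. Measurability
   comes from the coordinates, which are given explicitly, and not from the choice. *)
have /choice[u hu] w : exists f, f \in 'L2[mu] /\
    forall j, inner mu f (e j) = c j w * \1_A w.
  have [Aw|nAw] := pselect (A w); last first.
    exists (fun=> 0); split; first exact: L2_0.
    by move=> j; rewrite inner0l indicE memNset// mulr0.
  have [D hD] := nneseries_EFin_lty (fun j => sqr_ge0 (c j w)) Aw.
  have [f [f2 fc _]] := @riesz_fischer _ _ _ _ e e2 eo (c^~ w) D hD.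
  by exists f; split => // j; rewrite fc indicE mem_set// mulr1.
have u2 w : u w \in 'L2[mu] by have [] := hu w.
have uc w j : inner mu (u w) (e j) = c j w * \1_A w by have [_ ->] := hu w.
have mue j : measurable_fun setT (fun w => inner mu (u w) (e j)).
  under eq_fun do rewrite uc.
  by apply: measurable_funM => //; exact: measurable_indic.
exists u; split.
  split => //; first exact: (measurable_inner_basis e_basis).
  apply: le_lt_trans IZ; apply: ge0_le_integral_nomeas => w.
    by rewrite norm2_inner// lee_fin inner_ge0.
  rewrite (norm2_sqr_parseval e_basis)//; apply: lee_nneseries => [j _ _|j _].
    by rewrite lee_fin sqr_ge0.
  rewrite uc lee_fin exprMn ler_piMr ?sqr_ge0// indicE.
(* The mean squared error of the [n]-th truncation splits along the [e j] into the sum of the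
   [a j * r j n]. Each [r j n] lies between 0 and 1 and tends to 0 with [n], while the [a j] are
   summable. *)
pose r j n := sqdist P (B (e j)) (noise_expansion mu B nu (e j) n).
have rE j n : r j n = 1 - \sum_(i < n) inner mu (e j) (nu i) ^+ 2.
  by rewrite /r (sqdist_noise_expansion B_noise nu_basis)// eo eqxx.
have r01 j n : 0 <= r j n <= 1.
  rewrite sqdist_ge0 rE lerBlDr lerDl.
  by apply: sumr_ge0 => i _; exact: sqr_ge0.
have rj j : r j n @[n --> \oo] --> 0.
  exact: (sqdist_noise_expansion_cvg B_noise nu_basis).
have lim0 := dominated_nneseries_cvg0 a_ge0 trace_class r01 rj.
apply: cvg_trans lim0; apply: near_eq_cvg; apply: nearW => n.
have NE2 j : noise_expansion mu B nu (e j) n \in 'L2[P].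
  exact: (noise_expansion_L2 B_noise nu_basis).
pose dterm j w := gamma j `^ (- beta) * (B (e j) w - noise_expansion mu B nu (e j) n w).
have dterm2 j : dterm j \in 'L2[P] by apply: L2_scale; exact: L2_sub.
have mdt j : measurable_fun setT (fun w => (dterm j w ^+ 2)%:E).
  by apply/measurable_EFinP; apply: measurable_funX; exact: L2_measurable (dterm2 j).
have -> : (\sum_(0 <= j <oo) (a j * r j n)%:E =
    \int[P]_w \sum_(0 <= j <oo) (dterm j w ^+ 2)%:E)%E.
  rewrite integral_nneseries//; last by move=> j w _; rewrite lee_fin sqr_ge0.
  apply: eq_eseriesr => j _; rewrite L2_inner//.
  have BN2 := L2_sub (Be2 j) (NE2 j).
  rewrite innerZl ?L2_scale// innerZr// -/(sqdist _ _ _) -/(r j n).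
  by congr EFin; rewrite aE; ring.
rewrite [RHS](_ : _ =
  \int[P]_w norm2 mu (fun x => (u w x - S n w x)%R) ^+ 2)%E//.
apply: ge0_ae_eq_integral => //.
- apply: ge0_emeasurable_sum => // j w _ _; by rewrite lee_fin sqr_ge0.
- apply: (measurable_norm2_sqr e_basis) => [w|j]; first exact: L2_sub.
  under eq_fun do rewrite innerBl//.
  by apply: measurable_funB => //; exact: measurable_inner_S.
- by move=> w _; apply: nneseries_ge0 => j _ _; rewrite lee_fin sqr_ge0.
- by move=> w _; rewrite norm2_inner ?L2_sub// lee_fin inner_ge0.
apply: filterS aeA => w Aw _.
rewrite (norm2_sqr_parseval e_basis); last exact: L2_sub.
apply: eq_eseriesr => j _; congr (_%:E); congr (_ ^+ 2).
rewrite innerBl// uc indicE mem_set// mulr1 /dterm mulrBr; congr (_ - _).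
rewrite inner_S// /noise_expansion /partial_sum mulr_sumr; apply: eq_bigr => i _.
by have [_ _ ->] := inverse_power (nu2 i); rewrite (innerC mu (e j)); ring.
Qed.

End solution.

(** Apart from existence, the properties of the solution are stated for an arbitrary limit [u] of
    the truncations, hence do not depend on how one is constructed. The equation itself appears in
    weak form, as the pairing of [u] with the power [beta] of [phi]. *)
Theorem theorem2p8p18 (R : realType) (d : nat) (d_gt0 : (0 < d)%N)
  (W : 'I_d -> W_function R) (V : 'I_d -> V_function R)
  (H : 'I_d -> d.-tuple R -> R) (H0 : R) (kappa : d.-tuple R -> R)
  (H_smooth : forall k, Cinfty_VW W V (H k))
  (H0_gt0 : 0 < H0) (H_ge : forall k x, H0 <= H k x)
  (kappa_smooth : Cinfty_WV W V kappa)
  (kappa_away : exists2 c : R, 0 < c & forall x, c <= `|kappa x|)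
  (e : nat -> d.-tuple R -> R) (gamma : nat -> R)
  (e_eigen : eigenbasis V (L_op W V H kappa) e gamma)
  (gamma_nondecreasing : {homo gamma : i j / (i <= j)%N >-> i <= j})
  (dO : measure_display) (Omega : measurableType dO) (P : probability Omega R)
  (P_complete : measure_is_complete P)
  (B : (d.-tuple R -> R) -> Omega -> R) (B_noise : isonormal P (mV V) B)
  (nu : nat -> d.-tuple R -> R) (lambda : nat -> R)
  (nu_eigen : eigenbasis V (I_minus_Delta W V) nu lambda)
  (beta : R) (beta_gt : d%:R / 4 < beta) :
  let L_pow := power V e gamma in
  let is_L_pow := is_power V e gamma in
  let is_L_inv_beta_noise := noise_image P (mV V) B nu (L_pow (- beta)) in
  [/\ forall f, f \in 'L2[mV V] -> is_L_pow (- beta) f (L_pow (- beta) f),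
      (\sum_(0 <= i <oo) norm2 (mV V) (L_pow (- beta)%R (nu i)) ^+ 2 < +oo)%E,
      exists u, is_L_inv_beta_noise u &
      forall u, is_L_inv_beta_noise u ->
        [/\ forall u', is_L_inv_beta_noise u' ->
              {ae P, forall w, {ae mV V, forall x, u w x = u' w x}},
            forall phi psi, is_L_pow beta phi psi ->
              {ae P, forall w, inner (mV V) (u w) psi = B phi w},
            forall h, h \in 'L2[mV V] ->
              centered_gaussian P (fun w => inner (mV V) (u w) h),
            forall eps : R, 0 < eps ->
              let r := 2 * beta - d%:R / 2 - eps in
              {ae P, forall w, Hdot V e gamma r (u w)} /\
              (\int[P]_w Hdot_norm V e gamma r (u w) ^+ 2 < +oo)%E &
            forall g h, g \in 'L2[mV V] -> h \in 'L2[mV V] ->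
              is_L_pow (- (2 * beta)) g (L_pow (- (2 * beta)) g) /\
              ('E_P[fun w => (inner (mV V) (u w) g * inner (mV V) (u w) h)%R]
                = (inner (mV V) (L_pow (- (2 * beta))%R g) h)%:E)%E]].
Proof.
move=> L_pow is_L_pow is_L_inv_beta_noise.
have [c c0 kappa_ge] := kappa_away.
have e_basis : orthonormal_basis (mV V) e by case: e_eigen.
have nu_basis : orthonormal_basis (mV V) nu by case: nu_eigen.
have g0 : 0 < c ^+ 2 by rewrite exprn_gt0.
have gamma_ge j := eigenvalue_ge H0_gt0 H_ge c0 kappa_ge e_eigen j.
have summable s := eigenvalue_summable H0_gt0 H_ge c0 kappa_ge e_eigen
  gamma_nondecreasing (s := s) d_gt0.
have beta0 : 0 <= beta by apply: ltW; apply: le_lt_trans beta_gt; rewrite divr_ge0.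
have [|C trace] := summable (2 * beta); first lra.
split.
- by move=> f f2; exact: (inverse_power e_basis g0 gamma_ge).
- exact: (hilbert_schmidt e_basis g0 gamma_ge nu_basis beta0 trace).
- exact: (solution_exists e_basis g0 gamma_ge B_noise nu_basis beta0 trace).
move=> u hu; split.
- move=> u' hu'.
  exact: (solution_unique e_basis g0 gamma_ge B_noise nu_basis beta0 hu hu').
- move=> phi psi.
  exact: (inner_solution e_basis g0 gamma_ge B_noise nu_basis beta0 hu).
- move=> h.
  exact: (solution_gaussian e_basis g0 gamma_ge B_noise nu_basis beta0 hu).
- move=> eps eps0 r.
  (* For this [r] the exponent [r - 2 * beta] is the opposite of d/2 + eps, so [eps] is exactly the
     margin above the summability threshold. *)
  have [|Cr hCr] := summable (d%:R / 2 + eps); first lra.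
  apply: (solution_Hdot_integrable e_basis g0 gamma_ge B_noise nu_basis beta0 hu
    (Cr := Cr)) => n.
  by rewrite /r (_ : _ - 2 * beta = - (d%:R / 2 + eps)) //; ring.
- move=> g h g2 h2; split.
    by apply: (is_power_exists e_basis g0 gamma_ge) => //; rewrite oppr_le0 mulr_ge0.
  exact: (solution_covariance e_basis g0 gamma_ge B_noise nu_basis beta0 hu).
Qed.
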